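(* Let $K\ge1$, let $\Omega\subset\mathbb C$ be a simply connected domain, let $A\in M^{2\times2}(\Omega)$ with ellipticity constant $K$, and let $\Omega$ be a volume-preserving $A$-quasiconformal $\beta$-regular domain for some $\beta>1$. Then $$\lambda_1(A,\Omega)\le K\,\lambda_1(\mathbb D).$$
   Context: Write $z=x+iy$, $w=u+iv$; $\mathbb D\subset\mathbb C$ is the unit disc. The class $M^{2\times2}(\Omega)$ (with ellipticity constant $K$, $1\le K<\infty$): all symmetric $2\times2$ real matrix functions $A(z)=\{a_{kl}(z)\}$ on $\Omega$ with measurable entries, $\det A=1$ a.e., and $\frac1K|\xi|^2\le\langle A(z)\xi,\xi\rangle\le K|\xi|^2$ for a.e. $z\in\Omega$ and all $\xi\in\mathbb C\cong\mathbb R^2$. $A$-quasiconformal mapping: a quasiconformal homeomorphism $\varphi:\Omega\to\widetilde\Omega$ satisfying the Beltrami equation $\varphi_{\bar z}=\mu\,\varphi_z$ a.e. in $\Omega$ with $\mu(z)=\dfrac{a_{22}(z)-a_{11}(z)-2ia_{12}(z)}{\det(I+A(z))}$, $I$ the identity matrix. Here a homeomorphism $\varphi$ is quasiconformal if $\varphi\in W^{1,2}_{\mathrm{loc}}(\Omega)$ and $|D\varphi(z)|^2\le K'|J(z,\varphi)|$ for a.e. $z\in\Omega$ for some constant $K'<\infty$; $J(z,\varphi)$ is the Jacobian determinant. A simply connected domain $\Omega$ is $A$-quasiconformal $\beta$-regular (about $\mathbb D$), $\beta>1$, if $\iint_{\mathbb D}|J(w,\varphi^{-1})|^\beta\,du\,dv<\infty$,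 where $\varphi:\Omega\to\mathbb D$ is a corresponding $A$-quasiconformal mapping. It is called volume-preserving if moreover $|J(z,\varphi)|=1$ for (almost every) $z\in\Omega$ for such an $A$-quasiconformal mapping $\varphi:\Omega\to\mathbb D$. First Dirichlet eigenvalue: $W^{1,2}_0(\Omega,A)$ is the closure of $C_0^\infty(\Omega)$ in the norm $\|f\,|\,L^2(\Omega)\|+\left(\iint_\Omega\langle A\nabla f,\nabla f\rangle\,dx\,dy\right)^{1/2}$, and $$\lambda_1(A,\Omega)=\inf_{f\in W^{1,2}_0(\Omega,A)\setminus\{0\}}\frac{\iint_\Omega\langle A(z)\nabla f(z),\nabla f(z)\rangle\,dx\,dy}{\iint_\Omega|f(z)|^2\,dx\,dy}.$$ $\lambda_1(\mathbb D)=\lambda_1(I,\mathbb D)$ is the first Dirichlet eigenvalue of the Laplacian in $\mathbb D$. *)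

(* Defs.v *)
From HB Require Import structures.
From mathcomp Require Import all_boot all_order all_algebra complex.
From mathcomp Require Import all_classical all_reals all_analysis.
Import Order.TTheory GRing.Theory Num.Theory.
Import numFieldNormedType.Exports.

Set Implicit Arguments.
Unset Strict Implicit.
Unset Printing Implicit Defensive.

Local Open Scope classical_set_scope.
Local Open Scope ring_scope.

(* The complex plane is identified with R * R, z = x + i y being (x, y);
   complex numbers R[i] are used for the values of the Wirtinger derivatives
   and of the Beltrami coefficient only. *)

Section Plane.
Context {R : realType}.
Local Notation plane := (R * R)%type.
Implicit Types (Omega : set plane) (A : plane -> 'M[R]_2).

Local Notation area := (@lebesgue_measure R \x @lebesgue_measure R)%E.

Definition ae_on Omega (P : plane -> Prop) : Prop :=
  {ae area, forall z, Omega z -> P z}.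

Definition unit_disc : set plane := [set z | z.1 ^+ 2 + z.2 ^+ 2 < 1].

Definition simply_connected Omega : Prop :=
  forall gamma : R -> plane,
    {within `[0, 1], continuous gamma} ->
    (forall t, t \in `[0, 1] -> Omega (gamma t)) -> gamma 0 = gamma 1 ->
  exists H : R * R -> plane,
    [/\ {within `[0, 1] `*` `[0, 1], continuous H},
        forall s t, s \in `[0, 1] -> t \in `[0, 1] -> Omega (H (s, t)),
        forall t, t \in `[0, 1] -> H (0, t) = gamma t,
        forall t, t \in `[0, 1] -> H (1, t) = gamma 0 &
        forall s, s \in `[0, 1] -> H (s, 0) = gamma 0 /\ H (s, 1) = gamma 0].

Definition simply_connected_domain Omega : Prop :=
  [/\ open Omega, Omega !=set0, connected Omega & simply_connected Omega].

(* Lebesgue (not just Borel) measurability: the Borel functions are completed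
   by those which agree with one of them off a set of measure zero. *)
Definition Lebesgue_measurable_on Omega (f : plane -> R) : Prop :=
  exists2 g : plane -> R, measurable_fun setT g & ae_on Omega (fun z => f z = g z).

Definition dot (xi eta : 'cV[R]_2) : R := \sum_i xi i 0 * eta i 0.

Definition M22 (K : R) Omega A : Prop :=
  [/\ forall k l, Lebesgue_measurable_on Omega (fun z => A z k l),
      forall z, Omega z -> (A z)^T = A z,
      ae_on Omega (fun z => \det (A z) = 1) &
      ae_on Omega (fun z => forall xi : 'cV[R]_2,
        K^-1 * dot xi xi <= dot (A z *m xi) xi <= K * dot xi xi)].

Definition dir (i : 'I_2) : plane := if i == 0 then (1, 0) else (0, 1).

Fixpoint Ck (k : nat) (f : plane -> R) : Prop :=
  match k with
  | 0 => continuous f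
  | k'.+1 => continuous f /\
      forall i, (forall z, derivable f z (dir i)) /\ Ck k' ('D_(dir i) f)
  end.

Definition test_function Omega (eta : plane -> R) : Prop :=
  let supp := closure [set z | eta z != 0] in
  [/\ forall k, Ck k eta, compact supp & supp `<=` Omega].

Definition Lloc (p : nat) Omega (f : plane -> R) : Prop :=
  forall C : set plane, compact C -> C `<=` Omega ->
    measurable_fun C f /\ (\int[area]_(z in C) (`|f z| ^+ p)%:E < +oo)%E.

Definition weak_pderiv Omega (i : 'I_2) (f g : plane -> R) : Prop :=
  [/\ Lloc 1 Omega f, Lloc 1 Omega g &
      forall eta, test_function Omega eta ->
        (\int[area]_(z in Omega) (f z * 'D_(dir i) eta z)%:E =
         - \int[area]_(z in Omega) (g z * eta z)%:E)%E].

Definition component (phi : plane -> plane) (i : 'I_2) (z : plane) : R :=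
  if i == 0 then (phi z).1 else (phi z).2.

(* Dphi z i j is the weak derivative of the i-th component of phi in the
   j-th variable; it is determined by phi up to a null set. *)
Definition weak_diff Omega (phi : plane -> plane) (Dphi : plane -> 'M[R]_2) :
    Prop :=
  forall i j, weak_pderiv Omega j (component phi i) (fun z => Dphi z i j).

Definition W12loc_diff Omega (phi : plane -> plane) (Dphi : plane -> 'M[R]_2) :
    Prop :=
  [/\ weak_diff Omega phi Dphi,
      forall i, Lloc 2 Omega (component phi i) &
      forall i j, Lloc 2 Omega (fun z => Dphi z i j)].

Definition opnorm (M : 'M[R]_2) : R :=
  sup [set Num.sqrt (dot (M *m xi) (M *m xi)) | xi in
       [set xi : 'cV[R]_2 | dot xi xi = 1]].

Definition homeomorphism_between Omega Omega' (phi psi : plane -> plane) : Prop :=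
  [/\ {homo phi : z / Omega z >-> Omega' z},
      {homo psi : w / Omega' w >-> Omega w},
      (forall z, Omega z -> psi (phi z) = z) /\
      (forall w, Omega' w -> phi (psi w) = w),
      {within Omega, continuous phi} &
      {within Omega', continuous psi}].

(* psi is the inverse of phi, and Dphi is the weak differential of phi. *)
Definition quasiconformal Omega Omega' (phi psi : plane -> plane)
    (Dphi : plane -> 'M[R]_2) : Prop :=
  [/\ homeomorphism_between Omega Omega' phi psi,
      W12loc_diff Omega phi Dphi &
      exists K' : R,
        ae_on Omega (fun z => opnorm (Dphi z) ^+ 2 <= K' * `|\det (Dphi z)|)].

Local Open Scope complex_scope.

(* phi_x, phi_y, phi_z and phi_zbar when M is the differential of phi. *)
Definition dx (M : 'M[R]_2) : R[i] := M 0 0 +i* M 1 0.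
Definition dy (M : 'M[R]_2) : R[i] := M 0 1 +i* M 1 1.
Definition dz (M : 'M[R]_2) : R[i] := (dx M - 'i * dy M) / 2.
Definition dzbar (M : 'M[R]_2) : R[i] := (dx M + 'i * dy M) / 2.

Definition beltrami_coef (B : 'M[R]_2) : R[i] :=
  ((B 1 1)%:C - (B 0 0)%:C - 2 * 'i * (B 0 1)%:C) / (\det (1%:M + B))%:C.

Local Close Scope complex_scope.

Definition A_quasiconformal A Omega Omega' (phi psi : plane -> plane)
    (Dphi : plane -> 'M[R]_2) : Prop :=
  quasiconformal Omega Omega' phi psi Dphi /\
  ae_on Omega (fun z => dzbar (Dphi z) = beltrami_coef (A z) * dz (Dphi z)).

Definition inverse_jacobian_integrable (beta : R) (psi : plane -> plane) : Prop :=
  exists2 Dpsi : plane -> 'M[R]_2, weak_diff unit_disc psi Dpsi &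
    (\int[area]_(w in unit_disc) (`|\det (Dpsi w)| `^ beta)%:E < +oo)%E.

Definition volume_preserving_A_qc_regular A (beta : R) Omega : Prop :=
  exists (phi psi : plane -> plane) (Dphi : plane -> 'M[R]_2),
    [/\ A_quasiconformal A Omega unit_disc phi psi Dphi,
        inverse_jacobian_integrable beta psi &
        ae_on Omega (fun z => `|\det (Dphi z)| = 1)].

Definition sq_L2norm Omega (f : plane -> R) : \bar R :=
  (\int[area]_(z in Omega) (`|f z| ^+ 2)%:E)%E.

Definition energy A Omega (G : plane -> 'cV[R]_2) : \bar R :=
  (\int[area]_(z in Omega) (dot (A z *m G z) (G z))%:E)%E.

Definition W12_norm A Omega (f : plane -> R) (G : plane -> 'cV[R]_2) : \bar R :=
  (sq_L2norm Omega f `^ (2^-1)%R + energy A Omega G `^ (2^-1)%R)%E.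

Definition grad (eta : plane -> R) (z : plane) : 'cV[R]_2 :=
  \col_i 'D_(dir i) eta z.

(* Limits of test functions in the norm, G being the weak gradient of the
   limit f, so that G - grad eta is the weak gradient of f - eta. *)
Definition W12_0 A Omega (f : plane -> R) (G : plane -> 'cV[R]_2) : Prop :=
  [/\ measurable_fun Omega f, (sq_L2norm Omega f < +oo)%E,
      forall i, weak_pderiv Omega i f (fun z => G z i 0) &
      forall eps : R, 0 < eps -> exists2 eta, test_function Omega eta &
        (W12_norm A Omega (fun z => f z - eta z)%R
                                 (fun z => G z - grad eta z)%R
           < eps%:E)%E].

Definition lambda1 A Omega : \bar R :=
  ereal_inf [set q | exists (f : plane -> R) (G : plane -> 'cV[R]_2),
    [/\ W12_0 A Omega f G, ~ ae_on Omega (fun z => f z = 0) &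
        q = (energy A Omega G / sq_L2norm Omega f)%E]].

End Plane.

Arguments unit_disc R : clear implicits.

(* Main.v *)
From HB Require Import structures.
Require Import Defs.
From mathcomp Require Import all_boot all_order all_algebra complex.
From mathcomp Require Import all_classical all_reals all_analysis.
From mathcomp Require Import measurable_realfun.
From mathcomp Require Import ring lra.
Import Order.TTheory GRing.Theory Num.Theory.
Import numFieldNormedType.Exports.
Set Implicit Arguments.
Unset Strict Implicit.
Unset Printing Implicit Defensive.
Local Open Scope classical_set_scope.
Local Open Scope ring_scope.

(** Let phi : Omega -> D be the given mapping onto the unit disc.  For
    det A = 1 the Beltrami equation says that phi is conformal from the metric
    defined by A to the Euclidean one: the quadratic form of A on the pull-back
    of a covector under the differential of phi is the Jacobian times the
    Euclidean form.  Ellipticity makes the Jacobian positive, so it is 1, and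
      <A grad (v o phi), grad (v o phi)> = |grad v|^2 o phi   almost everywhere
    (beltrami_isometry).  Thus the energy of v o phi is the integral of
    |grad v|^2 o phi, its squared norm is that of v^2 o phi, and as phi
    preserves the area, v o phi has the Rayleigh quotient of v.  This gives
    lambda1 A Omega <= lambda1 I D, and K >= 1 does the rest.

    Two steps of this sketch need an argument, because phi is merely a
    homeomorphism with weak derivatives.

    The function v o phi is not smooth.  Its support is compact in Omega, so its
    mollifications are test functions of Omega; by the weak chain rule
    (wder_chain) their gradients are the mollifications of its weak gradient
    (moll_pull_test).  The isometry also bounds the entries of the differential
    by K, so everything stays bounded, mollifications converge in L1 (moll_cvg),
    products of bounded L1 limits are again L1 limits, and both integrals of the
    Rayleigh quotient converge (lambda1_le_pull).

    The change of variables is obtained without the area formula.  With Jacobian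
    1, (D_0 v) o phi is the Jacobian determinant of the pair (v o phi, phi_2),
    which is a divergence, so that its integral vanishes; weakly, this is the
    symmetry of the second derivatives of a mollification (iint_pull_partial).
    Applied to the translates of a mollifier, it says that the image of the area
    under phi has, at each scale, constant density on smaller discs
    (pushed_mass_cst).  The image is therefore proportional to the area
    (pull_proportional); the factor cancels in a Rayleigh quotient.

    Finally a function of the Sobolev space of the disc is approximated by test
    functions, and the bound on their Rayleigh quotients passes to the limit
    (lambda1_unit_disc_ge). *)

(** * Smooth functions and directional derivatives *)

Lemma ord2_cases (i : 'I_2) : i = 0 \/ i = 1.
Proof. by case: i => [[|[|m]]//= Hm]; [left|right]; exact: val_inj. Qed.

Section SmoothFunctions.
Context {R : realType}.
Local Notation plane := (R * R)%type.
Implicit Types (f g : plane -> R) (i j : 'I_2) (z w a : plane).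

Definition smooth f := forall k, Ck k f.

Lemma Ck_continuous k f : Ck k f -> continuous f.
Proof. by case: k => [//|k] []. Qed.

Lemma CkW k f : Ck k.+1 f -> Ck k f.
Proof.
elim: k f => [|k IH] f; first by case.
case=> cf df; split=> // i; have [df1 df2] := df i.
by split=> //; exact: IH.
Qed.

Lemma CkD k f g : Ck k f -> Ck k g -> Ck k (fun z => f z + g z).
Proof.
elim: k f g => [|k IH] f g /=.
  by move=> cf cg z; apply: cvgD; [exact: cf|exact: cg].
move=> [cf df] [cg dg]; split.
  by move=> z; apply: cvgD; [exact: cf|exact: cg].
move=> i; have [df1 df2] := df i; have [dg1 dg2] := dg i; split.
  by move=> z; apply: derivableD.
have -> : 'D_(dir i) (fun z => f z + g z) =
    (fun z => 'D_(dir i) f z + 'D_(dir i) g z).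
  by apply/funext => z; exact: deriveD.
exact: IH.
Qed.

Lemma CkM k f g : Ck k f -> Ck k g -> Ck k (fun z => f z * g z).
Proof.
elim: k f g => [|k IH] f g.
  by move=> cf cg z; apply: cvgM; [exact: cf|exact: cg].
move=> Cf Cg; move: (Cf) (Cg) => [cf df] [cg dg]; split.
  by move=> z; apply: cvgM; [exact: cf|exact: cg].
move=> i; have [df1 df2] := df i; have [dg1 dg2] := dg i; split.
  by move=> z; apply: derivableM.
have -> : 'D_(dir i) (fun z => f z * g z) =
    (fun z => f z * 'D_(dir i) g z + g z * 'D_(dir i) f z).
  by apply/funext => z; exact: deriveM.
by apply: CkD; apply: IH => //; exact: CkW.
Qed.

Lemma Ck_cst k (c : R) : Ck k (fun=> c).
Proof.
elim: k c => [|k IH] c; first by move=> z; exact: cvg_cst.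
split; first by move=> z; exact: cvg_cst.
move=> i; split; first by move=> z; exact: derivable_cst.
have -> : 'D_(dir i) (fun=> c) = (fun _ : plane => 0 : R).
  by apply/funext => z; exact: derive_cst.
exact: IH.
Qed.

Lemma translate_quotient f a i z :
  (fun h : R => h^-1 *: (f (h *: dir i + (z + a)) - f (z + a))) =
  (fun h : R => h^-1 *: (f ((h *: dir i + z) + a) - f (z + a))).
Proof. by apply/funext => h; rewrite addrA. Qed.

Lemma derivable_translate f a i z :
  derivable f (z + a) (dir i) -> derivable (fun z => f (z + a)) z (dir i).
Proof. by rewrite /derivable translate_quotient. Qed.

Lemma derive_translate f a i z :
  'D_(dir i) (fun z => f (z + a)) z = 'D_(dir i) f (z + a).
Proof. by rewrite /derive translate_quotient. Qed.

Lemma Ck_translate k f a : Ck k f -> Ck k (fun z => f (z + a)).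
Proof.
have cT (g : plane -> R) : continuous g -> continuous (fun z => g (z + a)).
  move=> cg z; apply: (@continuous_comp _ _ _ (fun z => z + a) g).
    by apply: cvgD; [exact: cvg_id|exact: cvg_cst].
  exact: cg.
elim: k f => [|k IH] f /=; first exact: cT.
move=> [cf df]; split; first exact: cT.
move=> i; have [df1 df2] := df i; split.
  by move=> z; exact: derivable_translate.
have -> : 'D_(dir i) (fun z => f (z + a)) = (fun z => 'D_(dir i) f (z + a)).
  by apply/funext => z; exact: derive_translate.
exact: (IH ('D_(dir i) f)).
Qed.

Lemma smooth_continuous f : smooth f -> continuous f.
Proof. by move=> /(_ 0). Qed.

Lemma smooth_derivable f i z : smooth f -> derivable f z (dir i).
Proof. by move=> /(_ 1)[_ /(_ i)[]]. Qed.

Arguments smooth_derivable {f} i z.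

Lemma smooth_partial f i : smooth f -> smooth ('D_(dir i) f).
Proof. by move=> sf k; have [_ /(_ i)[]] := sf k.+1. Qed.

Lemma line_shift f i z (t : R) :
  (fun h : R => h^-1 *: (f (h *: dir i + (z + t *: dir i)) - f (z + t *: dir i))) =
  (fun h : R => h^-1 *: (f (z + (h *: 1 + t) *: dir i) - f (z + t *: dir i))).
Proof.
apply/funext => h; congr (_ *: (f _ - _)).
by rewrite addrCA -scalerDl; congr (_ + (_ + _) *: _); rewrite /GRing.scale/= mulr1.
Qed.

Lemma derivable_line f i z (t : R) :
  derivable f (z + t *: dir i) (dir i) <->
  derivable (fun t : R => f (z + t *: dir i)) t 1.
Proof. by rewrite /derivable line_shift. Qed.

Lemma derive_line f i z (t : R) :
  'D_1 (fun t : R => f (z + t *: dir i)) t = 'D_(dir i) f (z + t *: dir i).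
Proof. by rewrite /derive line_shift. Qed.

Lemma is_derive_line f i z (d : R) :
  is_derive (0 : R) 1 (fun t : R => f (z + t *: dir i)) d <->
  is_derive z (dir i) f d.
Proof.
have z0 : z + 0 *: dir i = z by rewrite scale0r addr0.
split=> -[df fE]; apply: DeriveDef.
- by rewrite -z0; apply/derivable_line.
- by rewrite -[in LHS]z0 -derive_line.
- by apply/derivable_line; rewrite z0.
- by rewrite derive_line z0.
Qed.

End SmoothFunctions.
Arguments smooth_derivable {R f} i z.

(** * A smooth bump with compact support *)

Section Bump.
Context {R : realType}.
Local Notation plane := (R * R)%type.

(** The functions x^-m exp (-1/x) on x > 0, extended by 0, for all m at once:
    the derivative of one of them is a combination of the next ones, which
    makes each of them smooth. *)
Definition flat (m : nat) (x : R) : R :=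
  if 0 < x then x^-1 ^+ m * expR (- x^-1) else 0.

Lemma flat_ge0 m x : 0 <= flat m x.
Proof.
by rewrite /flat; case: ifPn => // x0; rewrite mulr_ge0 ?exprn_ge0 ?expR_ge0// invr_ge0 ltW.
Qed.

Lemma flat_eq0 m x : x <= 0 -> flat m x = 0.
Proof. by rewrite /flat ltNge => ->. Qed.

(** exp (1/x) dominates its Taylor term of order m + 2.  The square on the
    right makes the difference quotients at 0 tend to 0. *)
Lemma flat_le m x : flat m x <= (m.+2)`!%:R * x ^+ 2.
Proof.
rewrite /flat; case: ifPn => [x0|_]; last by rewrite mulr_ge0 ?ler0n ?sqr_ge0.
have y0 : 0 < x^-1 by rewrite invr_gt0.
have := expR_ge1Dxn m.+1 (ltW y0).
move=> /(le_trans (ler_wpDl _ _)) => /(_ _ ler01 (lexx _)) H.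
rewrite expRN -ler_pdivlMr ?expR_gt0//.
rewrite ler_pdivrMr ?ltr0n ?fact_gt0// in H.
rewrite invrK mulrAC -ler_pdivrMr; last by rewrite exprn_gt0.
by rewrite [leRHS]mulrC (le_trans _ H)// -exprVn -exprD addn2.
by rewrite invr_gt0 expR_gt0.
Qed.

Lemma is_derive_flat m (x : R) :
  is_derive x 1 (flat m) (flat m.+2 x - m%:R * flat m.+1 x).
Proof.
have [x0|x0|->] := ltgtP x 0.
- apply: (@near_eq_is_derive _ _ _ (cst 0)).
    near=> y; rewrite flat_eq0//.
    by near: y; exact: lt_le_nbhsl.
  by rewrite !flat_eq0 ?(ltW x0)// mulr0 subr0; exact: is_derive_cst.
- apply: (@near_eq_is_derive R R R (fun y : R => (y^-1) ^+ m * expR (- y^-1))).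
    near=> y; rewrite /flat ifT//.
    by near: y; exact: lt_nbhsr.
  have dV : is_derive x 1 (fun y : R => y^-1) (- x ^- 2).
    have := @is_deriveV R id x 1 1 (lt0r_neq0 x0) (is_derive_id _ _).
    by rewrite /GRing.scale/= mulr1.
  have dE : is_derive x 1 (fun y : R => expR (- y^-1)) (expR (- x^-1) * x ^- 2).
    have dN := is_deriveN dV; rewrite opprK in dN.
    exact: (is_derive1_comp (is_derive_expR _) dN).
  have dX := is_deriveX m dV.
  have fE : (fun y : R => y^-1 ^+ m * expR (- y^-1)) =
      ((fun y : R => y^-1) ^+ m * (fun y : R => expR (- y^-1))).
    by apply/funext => y; rewrite fctE exprfctE.
  rewrite fE; apply: (is_derive_eq (is_deriveM dX dE)).
  rewrite exprfctE /flat x0 /GRing.scale/= -exprVn.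
  by case: m {dX fE} => [|m]/=; rewrite ?exprS; ring.
- rewrite /flat ltxx mulr0 subr0.
  have Hc : h^-1 *: (flat m (h *: 1 + 0) - flat m 0) @[h --> (0:R)^'] --> (0 : R).
    apply/cvgr0Pnorm_le => e e0; near=> h.
    have h0 : h != 0 by near: h; exact: nbhs_dnbhs_neq.
    rewrite addr0 [h *: 1]mulr1 [flat m 0]/flat ltxx subr0 normrM normfV.
    rewrite ler_pdivrMl ?normr_gt0// ger0_norm ?flat_ge0//.
    apply: (le_trans (flat_le _ _)).
    rewrite -normr_id -real_normK ?num_real// expr2 mulrCA normr_id.
    rewrite ler_wpM2l// -ler_pdivlMl ?ltr0n ?fact_gt0//.
    near: h; apply: dnbhs0_le; rewrite mulr_gt0// invr_gt0 ltr0n fact_gt0//.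
  by apply: DeriveDef; [apply/cvg_ex; exists 0|exact/cvg_lim].
Unshelve. all: by end_near. Qed.

Lemma flat_continuous m : continuous (flat m).
Proof.
move=> x; apply/differentiable_continuous/derivable1_diffP.
by have [] := is_derive_flat m x.
Qed.

Lemma is_derive_flat_comp m (p : plane -> R) i z : derivable p z (dir i) ->
  is_derive z (dir i) (fun z => flat m (p z))
    ((flat m.+2 (p z) - m%:R * flat m.+1 (p z)) * 'D_(dir i) p z).
Proof.
move=> dp; apply/is_derive_line.
have dl : is_derive z (dir i) p ('D_(dir i) p z) by exact: DeriveDef.
have := is_derive_flat m (p (z + 0 *: dir i)).
rewrite {2 3}scale0r addr0 => df.
by apply: (is_derive1_comp df); apply/is_derive_line.
Qed.

Lemma Ck_flat_comp k m (p : plane -> R) : smooth p -> Ck k (fun z => flat m (p z)).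
Proof.
move=> sp; elim: k m => [|k IH] m.
  move=> z; apply: (@continuous_comp _ _ _ p (flat m)).
    exact: smooth_continuous.
  exact: flat_continuous.
split; first exact: (Ck_continuous (IH m)).
move=> i; have D z := @is_derive_flat_comp m p i z (smooth_derivable i z sp).
split; first by move=> z; have [] := D z.
have -> : 'D_(dir i) (fun z => flat m (p z)) = (fun z =>
    (flat m.+2 (p z) + - m%:R * flat m.+1 (p z)) * 'D_(dir i) p z).
  by apply/funext => z; have [_ ->] := D z; rewrite mulNr.
apply: CkM; last exact: smooth_partial.
by apply: CkD; [exact: IH|apply: CkM; [exact: Ck_cst|exact: IH]].
Qed.

Lemma is_derive_affine (a b t : R) : is_derive t 1 (fun t : R => a + t * b) b.
Proof.
have -> : (fun t : R => a + t * b) = cst a + (fun t : R => b *: t).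
  by apply/funext => s; rewrite fctE/= [b *: s]mulrC.
have H : is_derive t 1 (cst a + (fun t : R => b *: t)) (0 + b *: 1).
  exact: is_deriveD.
by rewrite add0r [b *: 1]mulr1 in H.
Qed.

Lemma is_derive_coord1 (g : R -> R) (i : 'I_2) (z : plane) (dg : R) :
  is_derive z.1 1 g dg ->
  is_derive z (dir i) (fun z => g z.1) (dg * (dir i).1).
Proof.
move=> Dg; apply/is_derive_line.
apply: (@is_derive1_comp _ g (fun t : R => z.1 + t * (dir i).1)).
  by rewrite mul0r addr0.
exact: is_derive_affine.
Qed.

Lemma is_derive_coord2 (g : R -> R) (i : 'I_2) (z : plane) (dg : R) :
  is_derive z.2 1 g dg ->
  is_derive z (dir i) (fun z => g z.2) (dg * (dir i).2).
Proof.
move=> Dg; apply/is_derive_line.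
apply: (@is_derive1_comp _ g (fun t : R => z.2 + t * (dir i).2)).
  by rewrite mul0r addr0.
exact: is_derive_affine.
Qed.

Lemma smooth_coord1 : smooth (fun z : plane => z.1).
Proof.
case=> [|k]; first by move=> z; exact: cvg_fst.
split; first by move=> z; exact: cvg_fst.
move=> i; have D (z : plane) := is_derive_coord1 i (is_derive_id z.1 (1 : R)).
split; first by move=> z; have [] := D z.
suff -> : 'D_(dir i) (fun z : plane => z.1) = (fun=> (dir i).1) by exact: Ck_cst.
by apply/funext => z; have [_ ->] := D z; rewrite mul1r.
Qed.

Lemma smooth_coord2 : smooth (fun z : plane => z.2).
Proof.
case=> [|k]; first by move=> z; exact: cvg_snd.
split; first by move=> z; exact: cvg_snd.
move=> i; have D (z : plane) := is_derive_coord2 i (is_derive_id z.2 (1 : R)).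
split; first by move=> z; have [] := D z.
suff -> : 'D_(dir i) (fun z : plane => z.2) = (fun=> (dir i).2) by exact: Ck_cst.
by apply/funext => z; have [_ ->] := D z; rewrite mul1r.
Qed.

Definition bump (a x : R) : R := flat 0 (a ^+ 2 - x ^+ 2).

Lemma bump_ge0 a x : 0 <= bump a x. Proof. exact: flat_ge0. Qed.

Lemma bumpN a x : bump a (- x) = bump a x.
Proof. by rewrite /bump sqrrN. Qed.

Lemma bump_gt0 a : 0 < a -> 0 < bump a 0.
Proof.
move=> a0; rewrite /bump /flat expr0n/= subr0 exprn_gt0// expr0 mul1r.
exact: expR_gt0.
Qed.

Lemma bump_eq0 a x : 0 <= a -> a <= `|x| -> bump a x = 0.
Proof.
move=> a0 ax; rewrite /bump flat_eq0// subr_le0 -(real_normK (num_real x)).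
by rewrite ler_sqr ?nnegrE// (le_trans a0).
Qed.

Definition dbump (a x : R) : R := - (2 * x) * flat 2 (a ^+ 2 - x ^+ 2).

Lemma is_derive_subsq (a x : R) :
  is_derive x 1 (fun x : R => a ^+ 2 - x ^+ 2) (- (2 * x)).
Proof.
have -> : (fun x : R => a ^+ 2 - x ^+ 2) = cst (a ^+ 2) - id ^+ 2.
  by apply/funext => y; rewrite !fctE.
have H := is_deriveB (is_derive_cst (a ^+ 2) x (1 : R))
  (is_deriveX 2 (is_derive_id x (1 : R))).
by apply: (is_derive_eq H); rewrite add0r/= expr1 [_ *: 1]mulr1.
Qed.

Lemma is_derive_bump (a x : R) : is_derive x 1 (bump a) (dbump a x).
Proof.
have Df := is_derive_flat 0 (a ^+ 2 - x ^+ 2); rewrite mul0r subr0 in Df.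
have := @is_derive1_comp R _ (fun x => a ^+ 2 - x ^+ 2) x _ _ Df (is_derive_subsq a x).
by rewrite /dbump mulrC.
Qed.

Definition bump2 (a : R) (z : plane) : R := bump a z.1 * bump a z.2.

Lemma smooth_bump2 a : smooth (bump2 a).
Proof.
move=> k; apply: CkM.
  apply: (@Ck_flat_comp k 0 (fun z => a ^+ 2 - z.1 ^+ 2)) => {}k.
  apply: CkD; first exact: Ck_cst.
  have -> : (fun z : plane => - z.1 ^+ 2) = (fun z => -1 * (z.1 * z.1)).
    by apply/funext => z; rewrite mulN1r expr2.
  by apply: CkM; [exact: Ck_cst|apply: CkM; exact: smooth_coord1].
apply: (@Ck_flat_comp k 0 (fun z => a ^+ 2 - z.2 ^+ 2)) => {}k.
apply: CkD; first exact: Ck_cst.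
have -> : (fun z : plane => - z.2 ^+ 2) = (fun z => -1 * (z.2 * z.2)).
  by apply/funext => z; rewrite mulN1r expr2.
by apply: CkM; [exact: Ck_cst|apply: CkM; exact: smooth_coord2].
Qed.

Lemma is_derive_tensor (g h : R -> R) (i : 'I_2) (z : plane) (dg dh : R) :
  is_derive z.1 1 g dg -> is_derive z.2 1 h dh ->
  is_derive z (dir i) (fun z => g z.1 * h z.2)
    (g z.1 * (dh * (dir i).2) + h z.2 * (dg * (dir i).1)).
Proof.
move=> Dg Dh.
exact: is_deriveM (is_derive_coord1 i Dg) (is_derive_coord2 i Dh).
Qed.

Lemma derivable_dbump (a x : R) : derivable (dbump a) x 1.
Proof.
have Df := is_derive_flat 2 (a ^+ 2 - x ^+ 2).
have [D _] := @is_derive1_comp R _ (fun x => a ^+ 2 - x ^+ 2) x _ _ Df (is_derive_subsq a x).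
have -> : dbump a =
    (fun x : R => 0 + x * (-2)) * (flat 2 \o (fun x : R => a ^+ 2 - x ^+ 2)).
  by apply/funext => y; rewrite !fctE /dbump/=; ring.
by have [Da _] := is_derive_affine 0 (-2) x; exact: derivableM Da D.
Qed.

(** On a product of functions of one variable the symmetry of the second
    derivatives can be read off; mollification transports it to the functions
    that need it. *)
Lemma bump2_partial_comm a :
  'D_(dir 0) ('D_(dir 1) (bump2 a)) = 'D_(dir 1) ('D_(dir 0) (bump2 a)).
Proof.
have E i : 'D_(dir i) (bump2 a) = (fun z => bump a z.1 * (dbump a z.2 * (dir i).2)
    + bump a z.2 * (dbump a z.1 * (dir i).1)).
  apply/funext => z.
  by have [_ ->] := is_derive_tensor i (is_derive_bump a z.1) (is_derive_bump a z.2).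
have E0 : 'D_(dir 0) (bump2 a) = (fun z => dbump a z.1 * bump a z.2).
  by rewrite E /dir/=; apply/funext => z; rewrite !mulr0 add0r mulr1 mulrC.
have E1 : 'D_(dir 1) (bump2 a) = (fun z => bump a z.1 * dbump a z.2).
  by rewrite E /dir/=; apply/funext => z; rewrite !mulr0 addr0 mulr1.
have D (x : R) : is_derive x 1 (dbump a) ('D_1 (dbump a) x).
  by apply: DeriveDef => //; exact: derivable_dbump.
apply: (etrans (congr1 (fun f => 'D_(dir 0) f) E1)).
apply: (etrans _ (esym (congr1 (fun f => 'D_(dir 1) f) E0))).
apply/funext => z.
have [_ T0] := is_derive_tensor 0 (is_derive_bump a z.1) (D z.2).
have [_ T1] := is_derive_tensor 1 (D z.1) (is_derive_bump a z.2).
apply: (etrans T0); apply: (etrans _ (esym T1)).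
by rewrite /dir/= !mulr0 !mulr1 add0r addr0 mulrC.
Qed.

Lemma bump2_ge0 a z : 0 <= bump2 a z.
Proof. by rewrite mulr_ge0 ?bump_ge0. Qed.

Lemma bump2N a z : bump2 a (- z) = bump2 a z.
Proof. by rewrite /bump2 !bumpN. Qed.

Lemma bump2_gt0 a : 0 < a -> 0 < bump2 a 0.
Proof. by move=> a0; rewrite mulr_gt0 ?bump_gt0. Qed.

Lemma bump2_eq0 a z : 0 <= a -> a <= `|z| -> bump2 a z = 0.
Proof.
move=> a0; rewrite prod_normE le_max => /orP[] az; rewrite /bump2.
  by rewrite (@bump_eq0 _ z.1)// mul0r.
by rewrite (@bump_eq0 _ z.2)// mulr0.
Qed.

End Bump.

(** * Bounded Borel functions on the plane *)

Section PlaneMeasure.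
Context {R : realType}.
Local Notation plane := (R * R)%type.
Local Notation area := (@lebesgue_measure R \x @lebesgue_measure R)%E.
Local Notation Rm := (measurableTypeR R).
Local Notation mplane := (Rm * Rm)%type.
Implicit Types (f g h : plane -> R).

Lemma measurable_ball1 (x e : R) : measurable (ball x e : set Rm).
Proof. by apply: open_measurable; exact: ball_open. Qed.

(** The sigma-algebra here is generated by products, so U is covered by the
    countably many squares with rational centre and side 2/(n+1) that it
    contains. *)
Lemma open_measurable2 (U : set plane) : open U -> measurable (U : set mplane).
Proof.
move=> oU; pose B (q1 q2 : rat) (n : nat) : set mplane :=
  (ball (ratr q1 : R) n.+1%:R^-1 : set Rm) `*` (ball (ratr q2 : R) n.+1%:R^-1 : set Rm).
have mB q1 q2 n : measurable (B q1 q2 n).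
  by apply: measurableX; exact: measurable_ball1.
pose C q1 q2 n := if `[< B q1 q2 n `<=` (U : set mplane) >] then B q1 q2 n else set0.
have -> : (U : set mplane) = \bigcup_q1 \bigcup_q2 \bigcup_n C q1 q2 n.
  apply/seteqP; split => [z Uz|z [q1 _ [q2 _ [n _]]]]; last first.
    by rewrite /C; case: asboolP => // /[apply].
  have /nbhs_ballP[e /= e0 eU] := open_nbhs_nbhs (conj oU Uz).
  have [n nE] : exists n : nat, n.+1%:R^-1 < e / 2.
    have := @near_infty_natSinv_lt R (PosNum (divr_gt0 e0 (ltr0n R 2))).
    by case=> N _ /(_ N (leqnn N)) H; exists N.
  have n0 : 0 < n.+1%:R^-1 :> R by rewrite invr_gt0 ltr0n.
  have dens (x : R) : exists q : rat, ball (ratr q : R) n.+1%:R^-1 x.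
    have [q] : exists q : rat, ratr q \in `]x - n.+1%:R^-1, x[.
      by apply: rat_in_itvoo; rewrite ltrBlDr ltrDl.
    rewrite in_itv/= => /andP[h1 h2]; exists q.
    set d := n.+1%:R^-1 in n0 h1 *.
    by rewrite /ball /= /ball_ /mkset ltr_norml; apply/andP; split; lra.
  have [q1 h1] := dens z.1; have [q2 h2] := dens z.2.
  exists q1 => //; exists q2 => //; exists n => //; rewrite /C.
  case: asboolP => // abs; exfalso; apply: abs => w [w1 w2]; apply: eU.
  have e2 : n.+1%:R^-1 + n.+1%:R^-1 <= e.
    by move: nE; set d := n.+1%:R^-1 => nE; lra.
  by split; apply: (le_ball e2); [apply: (ball_triangle _ w1)|apply: (ball_triangle _ w2)];
    apply: ball_sym.
apply: bigcupT_measurable_rat => q1; apply: bigcupT_measurable_rat => q2.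
by apply: bigcup_measurable => n _; rewrite /C; case: asboolP.
Qed.

Lemma compact_measurable2 (C : set plane) : compact C -> measurable (C : set mplane).
Proof.
move=> cC; rewrite -(setCK C); apply: measurableC; apply: open_measurable2.
by apply: closed_openC; apply: compact_closed => //; exact: norm_hausdorff.
Qed.

Lemma continuous_measurable2 f : continuous f -> measurable_fun [set: mplane] f.
Proof.
move=> /continuousP cf; apply: (measurability _ (RGenOpens.measurableE R)).
move=> _ [_ [a [b ->] <-]]; rewrite setTI.
by apply: open_measurable2; apply: cf; exact: interval_open.
Qed.

Lemma ae_imp (P Q : plane -> Prop) : (forall z, P z -> Q z) ->
  {ae area, forall z, P z} -> {ae area, forall z, Q z}.
Proof. by move=> PQ; apply: (@filterS _ _ (ae_filter_ringOfSetsType area)). Qed.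

Lemma ae_and (P Q : plane -> Prop) : {ae area, forall z, P z} ->
  {ae area, forall z, Q z} -> {ae area, forall z, P z /\ Q z}.
Proof. exact: (@filterI _ _ (ae_filter_ringOfSetsType area)). Qed.

(** The class of all the integrands below: it is closed under sums and
    products and contained in L1, so that linearity and limits of integrals
    carry no integrability conditions.  One constant bounds both the values and
    the support. *)
Definition BM (M : R) f : Prop :=
  [/\ measurable_fun [set: mplane] f, (forall z, `|f z| <= M) &
      forall z, M < `|z| -> f z = 0].

Definition iint f : R := \int[area]_z f z.

Lemma BM_ge0 M f : BM M f -> 0 <= M.
Proof. by case=> _ /(_ 0) + _; apply: le_trans. Qed.

Lemma BM_dom M C f h : BM M f -> measurable_fun [set: mplane] h ->
  (forall z, `|h z| <= C) -> (forall z, f z = 0 -> h z = 0) ->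
  BM (Num.max M C) h.
Proof.
move=> [_ _ f0] mh hC h0; split=> // z.
  by rewrite (le_trans (hC z))// le_max lexx orbT.
by rewrite gt_max => /andP[Mz _]; rewrite h0// f0.
Qed.

Lemma BMW M N f : M <= N -> BM M f -> BM N f.
Proof.
move=> MN [mf fM f0]; split=> // z; first exact: le_trans (fM z) MN.
by move=> Nz; apply: f0; exact: le_lt_trans Nz.
Qed.

Lemma BMD M N f g : BM M f -> BM N g -> BM (M + N) (fun z => f z + g z).
Proof.
move=> bf bg; have M0 := BM_ge0 bf; have N0 := BM_ge0 bg.
case: bf bg => [mf fM f0] [mg gM g0]; split=> [|z|z MNz].
- exact: measurable_funD.
- by rewrite (le_trans (ler_normD _ _))// lerD.
- by rewrite f0 ?g0 ?addr0//; apply: le_lt_trans MNz; rewrite ?lerDl ?lerDr.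
Qed.

Lemma BMZ M f c : BM M f -> BM (Num.max M (`|c| * M)) (fun z => c * f z).
Proof.
move=> bf; apply: (BM_dom bf).
- by case: bf => mf _ _; apply: measurable_funM.
- by move=> z; rewrite normrM ler_wpM2l//; case: bf.
- by move=> z ->; rewrite mulr0.
Qed.

Lemma BMMr M N f h : BM M f -> measurable_fun [set: mplane] h ->
  (forall z, `|h z| <= N) -> BM (Num.max M (M * N)) (fun z => f z * h z).
Proof.
move=> bf mh hN; apply: (BM_dom bf).
- by case: bf => mf _ _; apply: measurable_funM.
- by move=> z; rewrite normrM ler_pM//; case: bf.
- by move=> z ->; rewrite mul0r.
Qed.

Lemma BM_norm M f : BM M f -> BM M (fun z => `|f z|).
Proof.
move=> [mf fM f0]; split=> [|z|z /f0->]; last by rewrite normr0.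
  exact: measurableT_comp.
by rewrite normr_id.
Qed.

Lemma BMN M f : BM M f -> BM M (fun z => - f z).
Proof.
move=> [mf fM f0]; split=> [|z|z /f0->]; last by rewrite oppr0.
  exact: measurableT_comp.
by rewrite normrN.
Qed.

Lemma BMB M N f g : BM M f -> BM N g -> BM (M + N) (fun z => f z - g z).
Proof. by move=> bf /BMN; exact: BMD. Qed.

Definition box (M : R) : set mplane :=
  (`[- M, M]%classic : set Rm) `*` (`[- M, M]%classic : set Rm).

Lemma boxP M (z : plane) : box M z <-> `|z| <= M.
Proof.
rewrite /box/= !in_itv/= -!ler_norml prod_normE ge_max.
by split=> [[-> ->]|/andP[]].
Qed.

Lemma measurable_box M : measurable (box M).
Proof. by apply: measurableX; exact: measurable_itv. Qed.

Lemma area_box M : 0 <= M -> area (box M) = ((2 * M) ^+ 2)%:E.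
Proof.
move=> M0; rewrite product_measure1E; [|exact: measurable_itv..].
have E : @lebesgue_measure R `[- M, M]%classic = (2 * M)%:E.
  rewrite lebesgue_measure_itv/= lte_fin.
  case: ltP => [_|MM]; first by rewrite -EFinD; congr EFin; ring.
  by have -> : M = 0; [lra|rewrite mulr0].
by transitivity ((2 * M)%:E * (2 * M)%:E)%E; [congr (_ * _)%E|rewrite -EFinM expr2].
Qed.

Lemma BM_patch M f : BM M f -> f \_ (box M) = f.
Proof.
move=> [_ _ f0]; apply/funext => z; rewrite patchE; case: ifPn => // /negP.
rewrite inE => /boxP/negP; rewrite -ltNge => /f0 -> //.
Qed.

Lemma BM_integrable M f : BM M f -> area.-integrable setT (EFin \o f).
Proof.
move=> bf; have := bf; case=> mf fM f0.
rewrite -(BM_patch bf) -restrict_EFin -integrable_mkcond; last exact: measurable_box.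
apply: measurable_bounded_integrable.
- exact: measurable_box.
- have : (area (box M) < +oo)%E by rewrite area_box ?ltry//; exact: (BM_ge0 bf).
  exact.
- exact: measurable_funTS.
- by exists M; split; rewrite ?num_real// => x Mx y _ /=; apply: le_trans (fM y) (ltW Mx).
Qed.

Lemma iint0 : iint (fun=> 0) = 0.
Proof. by rewrite /iint /Rintegral integral0. Qed.

Lemma iintD M N f g : BM M f -> BM N g ->
  iint (fun z => f z + g z) = iint f + iint g.
Proof. by move=> /BM_integrable bf /BM_integrable bg; exact: RintegralD. Qed.

Lemma iintB M N f g : BM M f -> BM N g ->
  iint (fun z => f z - g z) = iint f - iint g.
Proof. by move=> /BM_integrable bf /BM_integrable bg; exact: RintegralB. Qed.

Lemma iintZ M c f : BM M f -> iint (fun z => c * f z) = c * iint f.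
Proof. by move=> /BM_integrable bf; exact: RintegralZl. Qed.

Lemma iintN M f : BM M f -> iint (fun z => - f z) = - iint f.
Proof.
move=> bf; rewrite -mulN1r -(iintZ (-1) bf).
by congr iint; apply/funext => z; rewrite mulN1r.
Qed.

Lemma le_iint M N f g : BM M f -> BM N g -> (forall z, f z <= g z) ->
  iint f <= iint g.
Proof.
by move=> /BM_integrable bf /BM_integrable bg fg; apply: le_Rintegral.
Qed.

Lemma iint_ge0 f : (forall z, 0 <= f z) -> 0 <= iint f.
Proof. by move=> f0; apply: Rintegral_ge0. Qed.

Lemma le_norm_iint M f : BM M f -> `|iint f| <= iint (fun z => `|f z|).
Proof. by move=> /BM_integrable bf; apply: le_normr_Rintegral. Qed.

Lemma iint_EFin M f : BM M f -> (\int[area]_z (f z)%:E)%E = (iint f)%:E.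
Proof.
by move=> /BM_integrable bf; rewrite /iint /Rintegral fineK//; apply: integrable_fin_num.
Qed.

Lemma iint_le_sup M e f : BM M f -> (forall z, `|f z| <= e) ->
  iint (fun z => `|f z|) <= e * (2 * M) ^+ 2.
Proof.
move=> bf fe; have M0 := BM_ge0 bf.
rewrite -lee_fin -(iint_EFin (BM_norm bf)).
have -> : (\int[area]_z (`|f z|)%:E = \int[area]_(z in box M) (`|f z|)%:E)%E.
  rewrite [RHS]integral_mkcond; congr integral.
  by rewrite restrict_EFin (BM_patch (BM_norm bf)).
have H : (area (box M) < +oo)%E by rewrite area_box ?ltry.
rewrite EFinM -(area_box M0) -integral_cst; last exact: measurable_box.
apply: ge0_le_integral; rewrite ?lee_fin//=.
- exact: measurable_box.
- apply/measurable_EFinP; apply: measurable_funTS.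
  by case: (BM_norm bf).
- by move=> z _; rewrite lee_fin.
Qed.

Lemma iint_ae M N f g : BM M f -> BM N g ->
  {ae area, forall z, f z = g z} -> iint f = iint g.
Proof.
move=> [mf _ _] [mg _ _] fg; congr fine; apply: ae_eq_integral => //.
- exact/measurable_EFinP.
- exact/measurable_EFinP.
- by apply: ae_imp fg => z /= + _ => ->.
Qed.

(** The uniform bound is what makes the limit of a product the product of the
    limits. *)
Definition L1cvg (fn : nat -> plane -> R) f : Prop := exists M,
  [/\ forall n, BM M (fn n), BM M f &
      iint (fun z => `|fn n z - f z|) @[n --> \oo] --> (0 : R)].

Lemma L1cvg_le (fn gn : nat -> plane -> R) f g (c M : R) :
  L1cvg fn f -> (forall n, BM M (gn n)) -> BM M g ->
  (forall n z, `|gn n z - g z| <= c * `|fn n z - f z|) -> L1cvg gn g.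
Proof.
move=> [N [bfn bf cf]] bgn bg H; exists M; split=> //.
have cz : c * iint (fun z => `|fn n z - f z|) @[n --> \oo] --> (0 : R).
  by rewrite -[X in _ --> X](mulr0 c); apply: cvgM => //; exact: cvg_cst.
apply: (squeeze_cvgr _ (cvg_cst 0) cz); apply: nearW => n.
rewrite iint_ge0//=.
have B := BM_norm (BMB (bfn n) bf).
by rewrite -(iintZ c B); apply: le_iint (BM_norm (BMB (bgn n) bg)) (BMZ c B) _.
Qed.

Lemma L1cvgD fn gn f g : L1cvg fn f -> L1cvg gn g ->
  L1cvg (fun n z => fn n z + gn n z) (fun z => f z + g z).
Proof.
move=> [M [bfn bf cf]] [N [bgn bg cg]]; exists (M + N); split=> [n||].
- exact: BMD.
- exact: BMD.
have cz : iint (fun z => `|fn n z - f z|) + iint (fun z => `|gn n z - g z|)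
    @[n --> \oo] --> (0 : R).
  by rewrite -[X in _ --> X](addr0 0); exact: cvgD.
apply: (squeeze_cvgr _ (cvg_cst 0) cz); apply: nearW => n.
rewrite iint_ge0//=.
have B1 := BM_norm (BMB (bfn n) bf); have B2 := BM_norm (BMB (bgn n) bg).
rewrite -(iintD B1 B2).
apply: le_iint (BM_norm (BMB (BMD (bfn n) (bgn n)) (BMD bf bg))) (BMD B1 B2) _ => z.
by rewrite opprD addrACA ler_normD.
Qed.

Lemma L1cvgMr fn f (h : plane -> R) (N : R) : L1cvg fn f ->
  measurable_fun [set: mplane] h -> (forall z, `|h z| <= N) ->
  L1cvg (fun n z => fn n z * h z) (fun z => f z * h z).
Proof.
move=> cf mh hN; case: (cf) => M [bfn bf _].
apply: (@L1cvg_le _ _ _ _ N _ cf (fun n => BMMr (bfn n) mh hN) (BMMr bf mh hN)).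
by move=> n z; rewrite -mulrBl normrM mulrC ler_wpM2r.
Qed.

Lemma L1cvg_cst f M : BM M f -> L1cvg (fun=> f) f.
Proof.
move=> bf; exists M; split=> //.
have -> : (fun z => `|f z - f z|) = (fun=> 0).
  by apply/funext => z; rewrite subrr normr0.
rewrite iint0; exact: cvg_cst.
Qed.

Lemma L1cvgM fn gn f g : L1cvg fn f -> L1cvg gn g ->
  L1cvg (fun n z => fn n z * gn n z) (fun z => f z * g z).
Proof.
move=> [M [bfn bf cf]] [N [bgn bg cg]].
have N0 := BM_ge0 bg; have M0 := BM_ge0 bf.
have mg n : measurable_fun [set: mplane] (gn n) by case: (bgn n).
have Mg n z : `|gn n z| <= N by case: (bgn n).
have Mg' z : `|g z| <= N by case: bg.
have Mf z : `|f z| <= M by case: bf.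
have mg' : measurable_fun [set: mplane] g by case: bg.
exists (Num.max M (M * N)); split=> [n||].
- exact: BMMr.
- exact: BMMr.
have cz : N * iint (fun z => `|fn n z - f z|) + M * iint (fun z => `|gn n z - g z|)
    @[n --> \oo] --> (0 : R).
  rewrite -[X in _ --> X](addr0 0); apply: cvgD.
    by rewrite -[X in _ --> X](mulr0 N); apply: cvgM => //; exact: cvg_cst.
  by rewrite -[X in _ --> X](mulr0 M); apply: cvgM => //; exact: cvg_cst.
apply: (squeeze_cvgr _ (cvg_cst 0) cz); apply: nearW => n.
rewrite iint_ge0//=.
have B1 := BM_norm (BMB (bfn n) bf); have B2 := BM_norm (BMB (bgn n) bg).
rewrite -(iintZ N B1) -(iintZ M B2) -(iintD (BMZ N B1) (BMZ M B2)).
apply: le_iint (BM_norm (BMB (BMMr (bfn n) (mg n) (Mg n)) (BMMr bf mg' Mg')))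
  (BMD (BMZ N B1) (BMZ M B2)) _ => z.
have -> : fn n z * gn n z - f z * g z =
  gn n z * (fn n z - f z) + f z * (gn n z - g z) by ring.
rewrite (le_trans (ler_normD _ _))// !normrM.
by rewrite lerD// ler_wpM2r.
Qed.

Lemma L1cvg_iint fn f : L1cvg fn f -> iint (fn n) @[n --> \oo] --> iint f.
Proof.
move=> [M [bfn bf cf]].
suff H : `|iint (fn n) - iint f| @[n --> \oo] --> (0 : R).
  by apply/subr_cvg0; exact: norm_cvg0.
apply: (squeeze_cvgr _ (cvg_cst 0) cf); apply: nearW => n.
by rewrite normr_ge0/= -(iintB (bfn n) bf); apply: le_norm_iint (BMB (bfn n) bf).
Qed.

Lemma L1cvg_unif fn f M : (forall n, BM M (fn n)) -> BM M f ->
  (forall e, 0 < e -> \forall n \near \oo, forall z, `|fn n z - f z| <= e) ->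
  L1cvg fn f.
Proof.
move=> bfn bf H; exists M; split=> //.
have M0 := BM_ge0 bf.
apply/cvgr0Pnorm_le => e e0.
pose c := (2 * (M + M)) ^+ 2 + 1.
have c0 : 0 < c by rewrite ltr_wpDl// sqr_ge0.
near=> n; rewrite ger0_norm ?iint_ge0//.
apply: (le_trans (@iint_le_sup _ (e / c) _ (BMB (bfn n) bf) _)).
  by near: n; apply: H; rewrite divr_gt0.
by rewrite mulrAC ler_pdivrMr// ler_wpM2l ?(ltW e0)// lerDl.
Unshelve. all: by end_near. Qed.

End PlaneMeasure.

(** * Taylor estimate and chain rule *)

Section SmoothEstimates.
Context {R : realType}.
Local Notation plane := (R * R)%type.
Local Notation Rm := (measurableTypeR R).
Local Notation mplane := (Rm * Rm)%type.
Implicit Types (f g k : plane -> R) (i : 'I_2) (z w a b : plane).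

Definition bump_like k : Prop := smooth k /\ exists r, forall z, r < `|z| -> k z = 0.

Lemma bump_like_partial k i : bump_like k -> bump_like ('D_(dir i) k).
Proof.
move=> [sk [r k0]]; split; first exact: smooth_partial.
exists r => z rz; rewrite -(@near_eq_derive _ _ _ (cst 0)) ?derive_cst//.
near=> w; rewrite /= k0//; near: w.
have : `|w| @[w --> z] --> `|z| by apply: cvg_norm; exact: cvg_id.
by move=> /cvgr_gt; apply.
Unshelve. all: by end_near. Qed.

Lemma compact_box (M : R) : compact [set z : plane | `|z| <= M].
Proof.
have -> : [set z : plane | `|z| <= M] = `[- M, M]%classic `*` `[- M, M]%classic.
  by apply/seteqP; split => z /boxP.
by apply: compact_setX; exact: segment_compact.
Qed.

Lemma bump_like_BM k : bump_like k -> exists M, BM M k.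
Proof.
move=> [sk [r k0]].
have ck := smooth_continuous sk.
have [M [_ HM]] := compact_bounded (continuous_compact
   (continuous_subspaceT ck) (compact_box (M := r))).
exists (Num.max r (Num.max (M + 1) 0)); split=> [|z|z].
- exact: continuous_measurable2.
- have [rz|zr] := ltP r `|z|; first by rewrite k0// normr0 !le_max lexx !orbT.
  have kM : `|k z| <= M + 1 by apply: (HM (M + 1)); [rewrite ltrDl|exists z].
  by rewrite !le_max kM orbT.
- by rewrite !gt_max => /andP[+ _]; exact: k0.
Qed.

Lemma line_mvt k i z (t : R) : smooth k -> exists2 s : R, `|s| <= `|t| &
  k (z + t *: dir i) - k z = 'D_(dir i) k (z + s *: dir i) * t.
Proof.
move=> sk; pose l := fun t : R => k (z + t *: dir i).
have l0 : l 0 = k z by rewrite /l scale0r addr0.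
have dl (s : R) : is_derive s 1 l ('D_(dir i) k (z + s *: dir i)).
  apply: DeriveDef; first by apply/derivable_line; exact: smooth_derivable.
  by rewrite derive_line.
have cl : continuous l.
  move=> s; apply/differentiable_continuous/derivable1_diffP.
  by have [] := dl s.
have [t0|t0] := leP 0 t.
  have [s s0] := MVT_segment t0 (fun x _ => dl x) (continuous_subspaceT cl).
  rewrite l0 subr0 => E; exists s => //.
  by move: s0; rewrite in_itv/= => /andP[s0 st]; rewrite !ger0_norm.
have [s s0] := MVT_segment (ltW t0) (fun x _ => dl x) (continuous_subspaceT cl).
rewrite l0 sub0r => E; exists s; last by rewrite -[LHS]opprB E mulrN opprK.
by move: s0; rewrite in_itv/= => /andP[s0 st]; rewrite ler0_norm// (ltr0_norm t0) lerN2.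
Qed.

Lemma dirE z : z = z.1 *: dir 0 + z.2 *: dir 1.
Proof.
case: z => x y; rewrite /dir eqxx (_ : (1 == 0 :> 'I_2) = false)//=.
have -> : x *: (1, 0) = (x * 1, x * 0) :> plane by [].
have -> : y *: (0, 1) = (y * 0, y * 1) :> plane by [].
rewrite !mulr0 !mulr1; congr (_, _); first exact: (esym (addr0 x)).
exact: (esym (add0r y)).
Qed.

Lemma norm_dir i : `|dir i : plane| = 1.
Proof.
rewrite prod_normE /dir; case: ifP => _ /=; rewrite normr1 normr0.
  by rewrite max_l.
by rewrite max_r.
Qed.

Lemma norm1_le z : `|z.1| <= `|z|. Proof. by rewrite prod_normE le_max lexx. Qed.

Lemma norm2_le z : `|z.2| <= `|z|. Proof. by rewrite prod_normE le_max lexx orbT. Qed.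

Lemma smooth_lipschitz k (C : R) : smooth k ->
  (forall i z, `|'D_(dir i) k z| <= C) ->
  forall z w, `|k w - k z| <= 2 * C * `|w - z|.
Proof.
move=> sk kC z w; set h := w - z.
have C0 : 0 <= C by apply: le_trans (kC 0 0).
have -> : w = z + h.1 *: dir 0 + h.2 *: dir 1.
  by rewrite -addrA -dirE /h addrC subrK.
have [s _ Es] := line_mvt 1 (z + h.1 *: dir 0) h.2 sk.
have [t _ Et] := line_mvt 0 z h.1 sk.
rewrite -(subrKA (k (z + h.1 *: dir 0))) Es Et (le_trans (ler_normD _ _))//.
rewrite !normrM (_ : 2 * C * `|h| = C * `|h| + C * `|h|); last by ring.
by rewrite lerD// ler_pM ?norm1_le ?norm2_le.
Qed.

Lemma bump_like_lipschitz k : bump_like k ->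
  exists C : R, forall z w, `|k w - k z| <= C * `|w - z|.
Proof.
move=> bk; have [sk _] := bk.
have [M0 B0] := bump_like_BM (bump_like_partial 0 bk).
have [M1 B1] := bump_like_BM (bump_like_partial 1 bk).
exists (2 * Num.max M0 M1); apply: smooth_lipschitz => // i z; rewrite le_max.
have [->|->] := ord2_cases i.
- by case: B0 => _ ->.
- by case: B1 => _ ->; rewrite orbT.
Qed.

(** Two mean value steps along the axes; the Lipschitz bounds of the partial
    derivatives compare the slopes found there with the gradient at z. *)
Lemma bump_like_taylor k : bump_like k -> exists2 C : R, 0 <= C & forall z h,
  `|k (z + h) - k z - ('D_(dir 0) k z * h.1 + 'D_(dir 1) k z * h.2)|
    <= C * `|h| ^+ 2.
Proof.
move=> bk; have [sk _] := bk.
have [C0 L0] := bump_like_lipschitz (bump_like_partial 0 bk).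
have [C1 L1] := bump_like_lipschitz (bump_like_partial 1 bk).
have pos C (f : plane -> R) : (forall z w, `|f w - f z| <= C * `|w - z|) -> 0 <= C.
  move=> /(_ 0 (dir 0)); rewrite subr0 norm_dir mulr1; exact: le_trans.
have C00 := pos _ _ L0; have C10 := pos _ _ L1.
exists (C0 + 2 * C1) => [|z h]; first by rewrite addr_ge0// mulr_ge0.
have -> : z + h = z + h.1 *: dir 0 + h.2 *: dir 1 by rewrite -addrA -dirE.
have [s sh Es] := line_mvt 1 (z + h.1 *: dir 0) h.2 sk.
have [t th Et] := line_mvt 0 z h.1 sk.
have lin (a b c d x y e : R) :
  a * y + (b * x + e) - e - (c * x + d * y) = (b - c) * x + (a - d) * y by ring.
rewrite -(subrK (k (z + h.1 *: dir 0)) (k (z + h.1 *: dir 0 + _))) Es.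
rewrite -(subrK (k z) (k (z + h.1 *: dir 0))) Et.
rewrite lin (le_trans (ler_normD _ _))// !normrM mulrDl lerD//.
  rewrite expr2 mulrA ler_pM ?norm1_le// (le_trans (L0 _ _))//.
  rewrite addrAC subrr add0r ler_wpM2l// normrZ norm_dir mulr1.
  by rewrite (le_trans th) ?norm1_le.
rewrite expr2 mulrA ler_pM ?norm2_le// (le_trans (L1 _ _))//.
rewrite addrAC [z + _]addrC addrK [2 * C1]mulrC -mulrA ler_wpM2l//.
rewrite (le_trans (ler_normD _ _))// !normrZ !norm_dir !mulr1 mulr_natl mulr2n.
by rewrite lerD ?norm1_le// (le_trans sh) ?norm2_le.
Qed.

(** Only directional derivatives of p and q are given, so there is no
    differentiable map to compose: the quadratic Taylor remainder of k is
    evaluated on the increments of p and q instead. *)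
Lemma is_derive_bump_like_comp k (p q : plane -> R) i z (dp dq : R) :
  bump_like k -> is_derive z (dir i) p dp -> is_derive z (dir i) q dq ->
  is_derive z (dir i) (fun z => k (p z, q z))
    ('D_(dir 0) k (p z, q z) * dp + 'D_(dir 1) k (p z, q z) * dq).
Proof.
move=> bk [Dp Ep] [Dq Eq].
set c0 := 'D_(dir 0) k (p z, q z); set c1 := 'D_(dir 1) k (p z, q z).
have [C C0 HC] := bump_like_taylor bk.
pose P (h : R) := h^-1 * (p (h *: dir i + z) - p z).
pose Q (h : R) := h^-1 * (q (h *: dir i + z) - q z).
have cP : P h @[h --> (0 : R)^'] --> dp by rewrite -Ep; exact: Dp.
have cQ : Q h @[h --> (0 : R)^'] --> dq by rewrite -Eq; exact: Dq.
have cid : (h : R) @[h --> (0 : R)^'] --> (0 : R) by exact: cvg_within.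
pose N (h : R) := C * (`|h| * ((`|P h| + `|Q h|) * (`|P h| + `|Q h|))).
have cN : N h @[h --> (0 : R)^'] --> (0 : R).
  rewrite -[X in _ --> X](mulr0 C); apply: cvgM; first exact: cvg_cst.
  rewrite -[X in _ --> X](mul0r ((`|dp| + `|dq|) * (`|dp| + `|dq|))).
  have cn : `|h| @[h --> (0 : R)^'] --> (0 : R).
    exact/norm_cvg0P.
  have cS : `|P h| + `|Q h| @[h --> (0 : R)^'] --> `|dp| + `|dq|.
    exact: cvgD (cvg_norm cP) (cvg_norm cQ).
  exact: cvgM cn (cvgM cS cS).
have cL : c0 * P h + c1 * Q h @[h --> (0 : R)^'] --> c0 * dp + c1 * dq.
  exact: cvgD (cvgM (cvg_cst c0) cP) (cvgM (cvg_cst c1) cQ).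
have Hc : h^-1 *: (k (p (h *: dir i + z), q (h *: dir i + z)) - k (p z, q z))
    @[h --> (0 : R)^'] --> c0 * dp + c1 * dq.
  apply: (cvg_sub0 _ cL); apply: norm_cvg0.
  apply: (squeeze_cvgr _ (cvg_cst 0) cN); near=> h.
  have h0 : h != 0 by near: h; exact: nbhs_dnbhs_neq.
  rewrite normr_ge0/= fctE.
  have hP : p (h *: dir i + z) - p z = h * P h by rewrite /P mulVKf.
  have hQ : q (h *: dir i + z) - q z = h * Q h by rewrite /Q mulVKf.
  have := HC (p z, q z) (h * P h, h * Q h); rewrite -/c0 -/c1 /=.
  have -> : (p z, q z) + (h * P h, h * Q h) =
      (p (h *: dir i + z), q (h *: dir i + z)) :> plane.
    by rewrite -hP -hQ; congr (_, _); rewrite addrC subrK.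
  set X := k _ - k _ => HX.
  rewrite (_ : _ - _ = h^-1 * (X - (c0 * (h * P h) + c1 * (h * Q h)))); last first.
    have lin (a b x y X' : R) : h^-1 * X' - (a * x + b * y) =
      h^-1 * (X' - (a * (h * x) + b * (h * y))) by field.
    exact: lin.
  rewrite normrM normfV ler_pdivrMl ?normr_gt0// (le_trans HX)//.
  rewrite (_ : `|h| * N h = C * (`|h| * (`|P h| + `|Q h|)) ^+ 2); last by rewrite /N; ring.
  rewrite ler_wpM2l// ler_sqr ?nnegrE ?mulr_ge0 ?addr_ge0//.
  rewrite prod_normE ge_max/= !normrM.
  by rewrite !ler_wpM2l ?lerDl ?lerDr.
by apply: DeriveDef; [apply/cvg_ex; eexists; exact: Hc|apply/cvg_lim].
Unshelve. all: by end_near. Qed.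

End SmoothEstimates.

(** * Differentiation under the integral sign *)

Section ParameterIntegral.
Context {R : realType}.
Local Notation plane := (R * R)%type.
Local Notation Rm := (measurableTypeR R).
Local Notation mplane := (Rm * Rm)%type.
Local Notation area := (@lebesgue_measure R \x @lebesgue_measure R)%E.
Implicit Types (f g k : plane -> R) (i : 'I_2) (z w a b : plane).
Implicit Types (Phi : plane -> plane).

Lemma lipschitz_continuous f (C : R) :
  (forall z w, `|f w - f z| <= C * `|w - z|) -> continuous f.
Proof.
move=> fC z; apply/cvgrPdist_le => e e0.
have C1 : 0 < `|C| + 1 by rewrite ltr_wpDl.
near=> w; rewrite distrC (le_trans (fC _ _))//.
rewrite (@le_trans _ _ ((`|C| + 1) * `|w - z|))//.
  by rewrite ler_wpM2r// (le_trans (ler_norm _))// lerDl.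
rewrite -ler_pdivlMl//; near: w.
by apply: (@cvgr_distC_le _ _ _ (nbhs z) _ id z) => //; rewrite mulr_gt0// invr_gt0.
Unshelve. all: by end_near. Qed.

(** Mollification is the case Phi = id; with a general Phi and f an indicator
    this mollifies the image of a measure under Phi. *)
Definition pint k Phi f w : R := iint (fun z => k (Phi z - w) * f z).

Definition measurable_map Phi := measurable_fun [set: mplane] (Phi : mplane -> mplane).

Lemma measurable_comp2 k Phi w : continuous k -> measurable_map Phi ->
  measurable_fun [set: mplane] (fun z => k (Phi z - w)).
Proof.
move=> ck mP.
have mS : measurable_map (fun z => Phi z - w).
  have mP1 : measurable_fun [set: mplane] (fun z => (Phi z).1 - w.1).
    apply: measurable_funB => //.
    exact: (measurableT_comp (@measurable_fst _ _ Rm Rm) mP).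
  have mP2 : measurable_fun [set: mplane] (fun z => (Phi z).2 - w.2).
    apply: measurable_funB => //.
    exact: (measurableT_comp (@measurable_snd _ _ Rm Rm) mP).
  exact: (measurable_fun_pair mP1 mP2).
exact: (measurableT_comp (continuous_measurable2 ck) mS).
Qed.

Lemma BM_pint k Phi f w K M : BM K k -> continuous k -> measurable_map Phi -> BM M f ->
  BM (Num.max M (M * K)) (fun z => k (Phi z - w) * f z).
Proof.
move=> bk ck mP bf.
have -> : (fun z => k (Phi z - w) * f z) = (fun z => f z * k (Phi z - w)).
  by apply/funext => z; rewrite mulrC.
apply: (BMMr bf); first exact: measurable_comp2.
by move=> z; case: bk.
Qed.

Lemma continuous_pint k Phi f M : bump_like k -> measurable_map Phi -> BM M f ->
  continuous (pint k Phi f).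
Proof.
move=> bk mP bf.
have [C HC] := bump_like_lipschitz bk.
have [K bK] := bump_like_BM bk.
have ck := smooth_continuous bk.1.
have bn := BM_norm bf.
apply: (@lipschitz_continuous _ (C * iint (fun z => `|f z|))) => w0 w.
have B w := BM_pint w bK ck mP bf.
rewrite /pint -(iintB (B w) (B w0)) (le_trans (le_norm_iint (BMB (B w) (B w0))))//.
rewrite mulrAC -(iintZ _ bn).
apply: le_iint (BM_norm (BMB (B w) (B w0))) (BMZ _ bn) _ => z.
rewrite -mulrBl normrM ler_wpM2r// (le_trans (HC _ _))//.
by rewrite opprD addrACA subrr add0r opprK addrC distrC.
Qed.

Lemma is_derive_pint k Phi f M i w : bump_like k -> measurable_map Phi -> BM M f ->
  is_derive w (dir i) (pint k Phi f) (- pint ('D_(dir i) k) Phi f w).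
Proof.
move=> bk mP bf; have [sk _] := bk.
have bk' := bump_like_partial i bk; have [sk' _] := bk'.
have [K bK] := bump_like_BM bk; have [K' bK'] := bump_like_BM bk'.
have ck := smooth_continuous sk; have ck' := smooth_continuous sk'.
pose F (t : R) (z : mplane) : R := k (Phi z - (w + t *: dir i)) * f z.
have dF (t : R) (z : mplane) : is_derive t 1 (F^~ z)
    (- 'D_(dir i) k (Phi z - (w + t *: dir i)) * f z).
  have dl (s : R) : is_derive s 1 (fun s : R => k (Phi z - w + s *: dir i))
      ('D_(dir i) k (Phi z - w + s *: dir i)).
    apply: DeriveDef; first by apply/derivable_line; exact: smooth_derivable.
    by rewrite derive_line.
  have dN := is_deriveN (is_derive_id t (1 : R)).
  have := @is_derive1_comp _ _ (fun t : R => - t) t _ _ (dl (- t)) dN.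
  move=> D; have := is_deriveM D (is_derive_cst (f z) t (1 : R)).
  have E (s : R) : Phi z - (w + s *: dir i) = Phi z - w + (- s) *: dir i.
    by rewrite opprD addrA scaleNr.
  have -> : F^~ z = ((fun s : R => k (Phi z - w + s *: dir i)) \o -%R) * cst (f z).
    by apply/funext => s; rewrite fctE /F E.
  move=> D'; apply: (is_derive_eq D').
  rewrite scaler0 add0r E mulrN1 /cst /GRing.scale/= mulrC.
  by [].
have B t := BM_pint (w + t *: dir i) bK ck mP bf.
have pE (t : R) (z : mplane) : partial1of2 F t z =
    - ('D_(dir i) k (Phi z - (w + t *: dir i)) * f z).
  by rewrite partial1of2E; have [_ ->] := dF t z; rewrite mulNr.
have I0 : `]-1, 1[%classic (0 : R) by rewrite /= in_itv/= ltrN10 ltr01.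
have G0 (z : mplane) : 0 <= K' * `|f z| by rewrite mulr_ge0// (BM_ge0 bK').
have := @cvg_differentiation_under_integral R _ _ area F setT measurableT 0 (-1) 1
  I0 (fun t _ => BM_integrable (B t))
  (fun t z _ _ => @ex_derive _ _ _ _ _ _ _ (dF t z)) (fun z => K' * `|f z|) G0
  (BM_integrable (BMZ K' (BM_norm bf))).
move=> /(_ _)/wrap[].
  move=> t z _ _; rewrite pE normrN normrM ler_wpM2r//.
  by case: bK'.
have -> : (\int[area]_y partial1of2 F 0 y)%R = - pint ('D_(dir i) k) Phi f w.
  rewrite -(iintN (BM_pint w bK' ck' mP bf)); congr fine; congr integral.
  by apply/funext => z /=; rewrite pE scale0r addr0.
move=> H; apply/is_derive_line.
have H' : h^-1 *: ((fun t : R => pint k Phi f (w + t *: dir i)) (h *: 1 + 0) -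
    pint k Phi f (w + 0 *: dir i)) @[h --> (0 : R)^'] --> - pint ('D_(dir i) k) Phi f w.
  apply: cvg_trans H; apply: near_eq_cvg; apply: nearW => h.
  by rewrite [h *: 1]mulr1.
by apply: DeriveDef; [apply/cvg_ex; eexists; exact: H'|apply/cvg_lim].
Qed.

Lemma smooth_pint k Phi f M : bump_like k -> measurable_map Phi -> BM M f ->
  smooth (pint k Phi f).
Proof.
move=> bk mP bf n; elim: n k bk => [|n IH] k bk.
  exact: (continuous_pint bk mP bf).
split; first exact: (continuous_pint bk mP bf).
move=> i; have D w := is_derive_pint i w bk mP bf.
split; first by move=> w; have [] := D w.
have -> : 'D_(dir i) (pint k Phi f) = (fun w => -1 * pint ('D_(dir i) k) Phi f w).
  by apply/funext => w; have [_ ->] := D w; rewrite mulN1r.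
by apply: CkM; [exact: Ck_cst|apply: IH; exact: bump_like_partial].
Qed.

End ParameterIntegral.

(** * Density of the continuous functions in L1 of a square *)

Section Density.
Context {R : realType}.
Local Notation plane := (R * R)%type.
Local Notation Rm := (measurableTypeR R).
Local Notation mplane := (Rm * Rm)%type.
Local Notation area := (@lebesgue_measure R \x @lebesgue_measure R)%E.
Local Notation mu := (@lebesgue_measure R).
Implicit Types (f g h : plane -> R).
Variable N : R.
Hypothesis N0 : 0 <= N.

(** Membership in the L1 (box N) closure of the continuous functions. *)
Definition approx f : Prop := forall e : R, 0 < e -> exists2 g, continuous g &
  (\int[area]_(z in box N) (`|f z - g z|)%:E <= e%:E)%E.

Definition mfun f := measurable_fun [set: mplane] f.

Lemma mfun_dist f g : mfun f -> mfun g ->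
  measurable_fun (box N) (fun z : mplane => (`|f z - g z|)%:E).
Proof.
move=> mf mg; apply/measurable_EFinP; apply: measurable_funTS.
by apply: measurableT_comp => //; exact: measurable_funB.
Qed.

Lemma L1box_le f g h : mfun f -> mfun g -> mfun h -> forall c d : R,
  (forall z, `|h z| <= c * `|f z| + d * `|g z|) -> 0 <= c -> 0 <= d ->
  (\int[area]_(z in box N) (`|h z|)%:E <=
   c%:E * (\int[area]_(z in box N) (`|f z|)%:E) +
   d%:E * (\int[area]_(z in box N) (`|g z|)%:E))%E.
Proof.
move=> mf mg mh c d H c0 d0.
have mn f' : mfun f' -> measurable_fun (box N) (fun z : mplane => (`|f' z|)%:E).
  by move=> mf'; apply/measurable_EFinP; apply: measurable_funTS; exact: measurableT_comp.
have mB := measurable_box N.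
rewrite -!ge0_integralZl//=; try by [exact: mn|rewrite lee_fin|move=> z _; rewrite lee_fin].
rewrite -ge0_integralD//=; first last.
- by apply: measurable_funeM; exact: mn.
- by move=> z _; rewrite mule_ge0 ?lee_fin.
- by apply: measurable_funeM; exact: mn.
- by move=> z _; rewrite mule_ge0 ?lee_fin.
apply: ge0_le_integral => //=.
- exact: mn.
- by apply: emeasurable_funD; apply: measurable_funeM; exact: mn.
- by move=> z _; rewrite -!EFinM -EFinD lee_fin.
Qed.

Lemma approx_lim f : mfun f ->
  (forall e : R, 0 < e -> exists h, [/\ mfun h, approx h &
    (\int[area]_(z in box N) (`|f z - h z|)%:E <= e%:E)%E]) -> approx f.
Proof.
move=> mf H e e0; have [|h [mh ah hf]] := H (e / 2); first by rewrite divr_gt0.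
have [|g cg hg] := ah (e / 2); first by rewrite divr_gt0.
exists g => //; have mg : mfun g by exact: continuous_measurable2.
have := @L1box_le (fun z => f z - h z) (fun z => h z - g z) (fun z => f z - g z)
  (measurable_funB mf mh) (measurable_funB mh mg) (measurable_funB mf mg) 1 1.
move=> /(_ _)/wrap[|].
  by move=> z; rewrite !mul1r (le_trans _ (ler_normD _ _))// addrA subrK.
move=> /(_ ler01 ler01)/le_trans; apply; rewrite !mul1e [e]splitr EFinD.
exact: leeD.
Qed.

Lemma approx_continuous f : continuous f -> approx f.
Proof.
move=> cf e e0; exists f => //.
rewrite (eq_integral (cst 0%E)) ?integral0 ?lee_fin ?ltW// => z _.
by rewrite subrr normr0.
Qed.

Lemma approxD f g : mfun f -> mfun g -> approx f -> approx g ->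
  approx (fun z => f z + g z).
Proof.
move=> mf mg af ag e e0.
have [|f' cf' hf] := af (e / 2); first by rewrite divr_gt0.
have [|g' cg' hg] := ag (e / 2); first by rewrite divr_gt0.
exists (fun z => f' z + g' z); first by move=> z; apply: cvgD; [exact: cf'|exact: cg'].
have mf' : mfun f' by exact: continuous_measurable2.
have mg' : mfun g' by exact: continuous_measurable2.
have := @L1box_le (fun z => f z - f' z) (fun z => g z - g' z)
  (fun z => f z + g z - (f' z + g' z))
  (measurable_funB mf mf') (measurable_funB mg mg')
  (measurable_funB (measurable_funD mf mg) (measurable_funD mf' mg')) 1 1.
move=> /(_ _)/wrap[|].
  by move=> z; rewrite !mul1r (le_trans _ (ler_normD _ _))// addrACA opprD.
move=> /(_ ler01 ler01)/le_trans; apply; rewrite !mul1e [e]splitr EFinD.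
exact: leeD.
Qed.

Lemma approxZ f c : mfun f -> approx f -> approx (fun z => c * f z).
Proof.
move=> mf af e e0.
have c1 : 0 < `|c| + 1 by rewrite ltr_wpDl.
have [|f' cf' hf] := af (e / (`|c| + 1)); first by rewrite divr_gt0.
exists (fun z => c * f' z); first by move=> z; apply: cvgM; [exact: cvg_cst|exact: cf'].
have mf' : mfun f' by exact: continuous_measurable2.
have mc : mfun (cst c) by exact: measurable_cst.
have := @L1box_le (fun z => f z - f' z) (fun z => f z - f' z)
  (fun z => c * f z - c * f' z)
  (measurable_funB mf mf') (measurable_funB mf mf')
  (measurable_funB (measurable_funM mc mf) (measurable_funM mc mf')) (`|c| + 1) 0.
move=> /(_ _)/wrap[|].
  by move=> z; rewrite mul0r addr0 -mulrBr normrM ler_wpM2r// lerDl.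
move=> /(_ (ltW c1) (lexx _))/le_trans; apply; rewrite mul0e adde0.
have -> : e%:E = ((`|c| + 1)%:E * (e / (`|c| + 1))%:E)%E.
  by rewrite -EFinM mulrC divfK ?gt_eqF.
by apply: lee_wpmul2l; rewrite // lee_fin ltW.
Qed.

(** Clipping the approximations of f and g to [-1, 1] keeps them bounded and
    brings them no further from f and g, so that their product is close to
    f g. *)
Lemma approxM f g : mfun f -> mfun g -> approx f -> approx g ->
  (forall z, `|f z| <= 1) -> (forall z, `|g z| <= 1) ->
  approx (fun z => f z * g z).
Proof.
move=> mf mg af ag f1 g1 e e0.
have [|f' cf' hf] := af (e / 2); first by rewrite divr_gt0.
have [|g' cg' hg] := ag (e / 2); first by rewrite divr_gt0.
have n11 : -1 <= 1 :> R by lra.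
pose clip (x : R) : R := Num.max (-1) (Num.min x 1).
have cclip u : continuous u -> continuous (fun z : plane => clip (u z)).
  move=> cu; apply: (@max_fun_continuous _ _ R (cst (-1)) (u \min cst 1)).
    by move=> z; exact: cvg_cst.
  by apply: (@min_fun_continuous _ _ R) => // z; exact: cvg_cst.
have clip1 x : `|clip x| <= 1.
  rewrite /clip ler_norml le_max lexx/= ge_max ge_min lexx orbT andbT.
  by rewrite n11.
have clipd (x y : R) : `|x| <= 1 -> `|x - clip y| <= `|x - y|.
  rewrite ler_norml => /andP[x0 x1]; rewrite /clip.
  have [y1|y1] := leP y 1.
    have [//|y0] := leP (-1) y.
    by rewrite !ger0_norm; lra.
  have -> : Num.max (-1) 1 = 1 :> R by rewrite max_r.
  by rewrite !ler0_norm; lra.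
exists (fun z => clip (f' z) * clip (g' z)).
  by move=> z; apply: cvgM; [exact: (cclip _ cf')|exact: (cclip _ cg')].
have mf' : mfun f' by exact: continuous_measurable2.
have mg' : mfun g' by exact: continuous_measurable2.
have mcf : mfun (fun z => clip (f' z)) by apply: continuous_measurable2; exact: cclip.
have mcg : mfun (fun z => clip (g' z)) by apply: continuous_measurable2; exact: cclip.
have := @L1box_le (fun z => f z - f' z) (fun z => g z - g' z)
  (fun z => f z * g z - clip (f' z) * clip (g' z))
  (measurable_funB mf mf') (measurable_funB mg mg')
  (measurable_funB (measurable_funM mf mg) (measurable_funM mcf mcg)) 1 1.
move=> /(_ _)/wrap[|].
  move=> z; rewrite !mul1r.
  have -> : f z * g z - clip (f' z) * clip (g' z) =
    (f z - clip (f' z)) * g z + clip (f' z) * (g z - clip (g' z)) by ring.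
  rewrite (le_trans (ler_normD _ _))// !normrM lerD//.
    by rewrite (le_trans (ler_piMr _ (g1 z)))// clipd.
  by rewrite (le_trans (ler_piMl _ (clip1 _)))// clipd.
move=> /(_ ler01 ler01)/le_trans; apply; rewrite !mul1e [e]splitr EFinD.
exact: leeD.
Qed.

Let I : set Rm := `[- N, N]%classic.

Let mI : measurable I. Proof. exact: measurable_itv. Qed.

Let muI : mu I = (2 * N)%:E.
Proof.
rewrite /I lebesgue_measure_itv/= lte_fin.
case: ltP => [_|MM]; first by rewrite -EFinD; congr EFin; ring.
have -> : N = 0 by apply: le_anti; rewrite N0 andbT; lra.
by rewrite mulr0.
Qed.

Lemma integral_tensor (a b : Rm -> R) : measurable_fun setT a -> measurable_fun setT b ->
  (forall x, 0 <= a x) -> (forall x, 0 <= b x) ->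
  (\int[area]_z (a z.1 * b z.2)%:E = (\int[mu]_x (a x)%:E) * (\int[mu]_y (b y)%:E))%E.
Proof.
move=> ma mb a0 b0; pose F (z : mplane) : \bar R := (a z.1 * b z.2)%:E.
have mF : measurable_fun setT F.
  apply/measurable_EFinP; apply: measurable_funM.
    exact: (measurableT_comp ma (@measurable_fst _ _ Rm Rm)).
  exact: (measurableT_comp mb (@measurable_snd _ _ Rm Rm)).
have F0 z : (0 <= F z)%E by rewrite lee_fin mulr_ge0.
rewrite (fubini_tonelli1 F mF F0) /fubini_F/=.
have inner x : (\int[mu]_y F (x, y) = (a x)%:E * \int[mu]_y (b y)%:E)%E.
  rewrite /F/=; under eq_integral do rewrite EFinM.
  rewrite ge0_integralZl//=;
    by [exact/measurable_EFinP|move=> y _; rewrite lee_fin|rewrite lee_fin].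
under eq_integral do rewrite inner.
rewrite ge0_integralZr//=.
- exact/measurable_EFinP.
- by move=> x _; rewrite lee_fin.
- by apply: integral_ge0 => y _; rewrite lee_fin.
Qed.

Let boxE (z : mplane) (c : R) : ((fun=> c%:E) \_ (box N)) z = (c * \1_I z.1 * \1_I z.2)%:E.
Proof.
rewrite patchE !indicE; case: ifPn => [|/negP zB].
  by rewrite inE => -[z1 z2]; rewrite !mem_set// !mulr1.
have [z1|] := boolP (z.1 \in I); last by rewrite mulr0 mul0r.
have [z2|] := boolP (z.2 \in I); last by rewrite mulr0.
by exfalso; apply: zB; rewrite inE; split; apply/set_mem.
Qed.

Let integral_1I : (\int[mu]_x (\1_I x)%:E = (2 * N)%:E)%E.
Proof. by rewrite integral_indic// setIT; exact: muI. Qed.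

Let integral_patchI (phi : Rm -> R) :
  (\int[mu]_x (phi x * \1_I x)%:E = \int[mu]_(x in I) (phi x)%:E)%E.
Proof.
rewrite [RHS]integral_mkcond; congr integral; apply/funext => x.
by rewrite patchE indicE; case: ifPn => _; rewrite ?mulr1 ?mulr0.
Qed.

Lemma integral_box_fst (phi : Rm -> R) : measurable_fun setT phi ->
  (forall x, 0 <= phi x) ->
  (\int[area]_(z in box N) (phi z.1)%:E =
   (2 * N)%:E * \int[mu]_(x in I) (phi x)%:E)%E.
Proof.
move=> mphi phi0; rewrite integral_mkcond.
rewrite (_ : _ \_ _ = fun z => ((phi z.1 * \1_I z.1) * \1_I z.2)%:E); last first.
  by apply/funext => z; rewrite -boxE !patchE.
rewrite (@integral_tensor (fun x => phi x * \1_I x) \1_I)//.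
- by rewrite integral_1I integral_patchI muleC.
- exact: measurable_funM.
- by move=> x; rewrite mulr_ge0.
Qed.

Lemma integral_box_snd (phi : Rm -> R) : measurable_fun setT phi ->
  (forall x, 0 <= phi x) ->
  (\int[area]_(z in box N) (phi z.2)%:E =
   (2 * N)%:E * \int[mu]_(x in I) (phi x)%:E)%E.
Proof.
move=> mphi phi0; rewrite integral_mkcond.
rewrite (_ : _ \_ _ = fun z => (\1_I z.1 * (phi z.2 * \1_I z.2))%:E); last first.
  by apply/funext => z; rewrite mulrCA mulrA -boxE !patchE.
rewrite (@integral_tensor \1_I (fun x => phi x * \1_I x))//.
- by rewrite integral_1I integral_patchI.
- exact: measurable_funM.
- by move=> x; rewrite mulr_ge0.
Qed.

Lemma approx_1d (A : set Rm) : measurable A -> forall e : R, 0 < e ->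
  exists2 g : R -> R, continuous g &
  ((2 * N)%:E * \int[mu]_(x in I) (`|\1_A x - g x|)%:E <= e%:E)%E.
Proof.
move=> mA e e0.
have m1A : measurable_fun I (\1_A : Rm -> R) by apply: measurable_funTS; exact: measurable_indic.
have iA : mu.-integrable I (EFin \o \1_A).
  apply: measurable_bounded_integrable => //.
    by have : (mu I < +oo)%E by rewrite muI ltry.
  exists 1; split; rewrite ?num_real// => x x1 y _ /=.
  by rewrite indicE; case: (_ \in _); rewrite ?normr1 ?normr0 ltW// (lt_trans ltr01).
have Ifin : (mu I < +oo)%E by rewrite muI ltry.
have [gn [cg ig H]] := approximation_continuous_integrable mI Ifin iA.
pose d := e / (2 * N + 1).
have N1 : 0 < 2 * N + 1 by rewrite ltr_wpDl// mulr_ge0.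
have d0 : 0 < d by rewrite divr_gt0.
have [n _ Hn] : \forall n \near \oo, (\int[mu]_(x in I) `|(\1_A x - gn n x)%:E| < d%:E)%E.
  apply: (H [set x | (x < d%:E)%E]); apply: open_nbhs_nbhs.
  by split; [exact: open_ereal_lt_ereal|rewrite /= lte_fin].
exists (gn n) => //; have {Hn} := Hn n (leqnn n) => /= Hn.
have HN : (\int[mu]_(x in I) (`|\1_A x - gn n x|)%:E <= d%:E)%E by exact: ltW.
apply: (@le_trans _ _ ((2 * N)%:E * d%:E)%E).
  by apply: lee_wpmul2l => //; rewrite lee_fin mulr_ge0.
rewrite -EFinM lee_fin /d mulrCA -[leRHS]mulr1 ler_wpM2l ?(ltW e0)//.
by rewrite ler_pdivrMr// mul1r lerDl.
Qed.

Lemma approx_fst (A : set Rm) : measurable A -> approx (fun z => \1_A z.1).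
Proof.
move=> mA e e0; have [g cg Hg] := approx_1d mA e0.
exists (fun z => g z.1).
  by move=> z; apply: (@continuous_comp _ _ _ fst g); [exact: cvg_fst|exact: cg].
rewrite (@integral_box_fst (fun x => `|\1_A x - g x|))//.
apply: measurableT_comp => //; apply: measurable_funB; first exact: measurable_indic.
exact: continuous_measurable_fun.
Qed.

Lemma approx_snd (A : set Rm) : measurable A -> approx (fun z => \1_A z.2).
Proof.
move=> mA e e0; have [g cg Hg] := approx_1d mA e0.
exists (fun z => g z.2).
  by move=> z; apply: (@continuous_comp _ _ _ snd g); [exact: cvg_snd|exact: cg].
rewrite (@integral_box_snd (fun x => `|\1_A x - g x|))//.
apply: measurableT_comp => //; apply: measurable_funB; first exact: measurable_indic.
exact: continuous_measurable_fun.
Qed.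

Lemma mfun_indic (S : set mplane) : measurable S -> mfun (\1_S : plane -> R).
Proof. by move=> mS; exact: measurable_indic. Qed.

Lemma indic_le1 (S : set mplane) z : `|\1_S z : R| <= 1.
Proof. by rewrite indicE; case: (_ \in _); rewrite ?normr1 ?normr0. Qed.

Lemma approx_setC (S : set mplane) : measurable S -> approx \1_S -> approx \1_(~` S).
Proof.
move=> mS aS; have -> : \1_(~` S) = (fun z => 1 + -1 * \1_S z) :> (plane -> R).
  apply/funext => z; rewrite !indicE in_setC.
  by case: (_ \in _); rewrite /= ?mulr1 ?mulr0 ?subrr ?addr0.
apply: approxD.
- exact: measurable_cst.
- by apply: measurable_funM; [exact: measurable_cst|exact: mfun_indic].
- by apply: approx_continuous => z; exact: cvg_cst.
- by apply: approxZ => //; exact: mfun_indic.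
Qed.

Lemma approx_setI (S T : set mplane) : measurable S -> measurable T ->
  approx \1_S -> approx \1_T -> approx \1_(S `&` T).
Proof.
move=> mS mT aS aT; have -> : \1_(S `&` T) = (fun z => \1_S z * \1_T z) :> (plane -> R).
  by rewrite indicI.
by apply: approxM => //; try exact: mfun_indic; exact: indic_le1.
Qed.

Lemma approx_setU (S T : set mplane) : measurable S -> measurable T ->
  approx \1_S -> approx \1_T -> approx \1_(S `|` T).
Proof.
move=> mS mT aS aT; rewrite -(setCK (S `|` T)) setCU.
apply: approx_setC; first by apply: measurableI; exact: measurableC.
by apply: approx_setI; try exact: measurableC; exact: approx_setC.
Qed.

(** The finite unions exhaust the union up to sets that decrease to the empty
    set inside a square of finite area. *)
Lemma approx_bigcup (F : (set mplane)^nat) : (forall n, measurable (F n)) ->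
  (forall n, approx \1_(F n)) -> approx \1_(\bigcup_n F n).
Proof.
move=> mF aF; pose U n := \big[setU/set0]_(k < n) F k.
have mU n : measurable (U n) by exact: bigsetU_measurable.
have aU n : approx \1_(U n).
  elim: n => [|n IH].
    rewrite /U big_ord0 indic0; apply: approx_continuous => z; exact: cvg_cst.
  by rewrite /U big_ord_recr/=; exact: (approx_setU (mU n) (mF n) IH (aF n)).
have mUU : measurable (\bigcup_n F n) by exact: bigcup_measurable.
have mB := measurable_box N.
pose E n := box N `&` (\bigcup_n F n `\` U n).
have mE n : measurable (E n) by apply: measurableI => //; exact: measurableD.
have E0 : \bigcap_n E n = set0.
  apply/seteqP; split => // z Ez; have [_ [[k _ Fk] _]] := Ez 0%N Logic.I.
  have [_ [_]] := Ez k.+1 Logic.I; apply.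
  by rewrite /U big_ord_recr/=; right.
have cE : (area \o E) n @[n --> \oo] --> 0%E.
  rewrite -(measure0 area) -E0; apply: nonincreasing_cvg_mu => //.
  - apply: (@le_lt_trans _ _ (area (box N))); last first.
      by have : (area (box N) < +oo)%E by rewrite area_box// ltry.
    by apply: le_measure; rewrite ?inE//; exact: subIsetl.
  - by rewrite E0.
  - move=> m n mn; apply/subsetPset; apply: setIS; apply: setDS.
    exact: subset_bigsetU.
apply: approx_lim; first exact: mfun_indic.
move=> e e0.
have [n _ Hn] : \forall n \near \oo, (area (E n) < e%:E)%E.
  apply: (cE [set x | (x < e%:E)%E]); apply: open_nbhs_nbhs.
  by split; [exact: open_ereal_lt_ereal|rewrite /= lte_fin].
exists (\1_(U n)); split => //; first exact: mfun_indic.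
apply: (@le_trans _ _ (area (E n))); last exact: (ltW (Hn n (leqnn n))).
rewrite /E setIC -integral_indic//; last exact: measurableD.
apply: ge0_le_integral => //.
- by apply: mfun_dist; exact: mfun_indic.
- by apply/measurable_EFinP; apply: measurable_funTS; apply: measurable_indic; exact: measurableD.
move=> z _; rewrite lee_fin !indicE.
have [zU|zU] := boolP (z \in U n); last first.
  rewrite subr0 in_setD zU andbT.
  by case: (_ \in _); rewrite ?normr1 ?normr0.
have -> : z \in \bigcup_n F n.
  by move: zU; rewrite !inE /U -bigcup_mkord => -[k _ Fk]; exists k.
by rewrite subrr normr0.
Qed.

(** Dynkin's theorem for the rectangles, whose indicators are products of
    functions of one coordinate. *)
Lemma approx_measurable (S : set mplane) : measurable S -> approx \1_S.
Proof.
have GE := @measurable_prod_measurableType _ _ Rm Rm.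
move=> mS; have gS := mS; rewrite GE in gS.
apply: (@dynkin_induction _ mplane _ (fun S => approx \1_S) GE) gS.
- move=> _ _ [A mA [B mB <-]] [A' mA' [B' mB' <-]].
  exists (A `&` A'); first exact: measurableI.
  by exists (B `&` B'); [exact: measurableI|rewrite setXI].
- by rewrite indicT; apply: approx_continuous => z; exact: cvg_cst.
- move=> _ [A mA [B mB <-]].
  have -> : \1_(A `*` B) = (fun z => \1_A z.1 * \1_B z.2) :> (plane -> R).
    by apply/funext => z; rewrite !indicE in_setX; case: (_ \in A); rewrite ?mul1r ?mul0r.
  apply: approxM; [| |exact: approx_fst|exact: approx_snd| |].
  - exact: (measurableT_comp (measurable_indic mA) (@measurable_fst _ _ Rm Rm)).
  - exact: (measurableT_comp (measurable_indic mB) (@measurable_snd _ _ Rm Rm)).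
  - by move=> z; rewrite indicE; case: (_ \in _); rewrite ?normr1 ?normr0.
  - by move=> z; rewrite indicE; case: (_ \in _); rewrite ?normr1 ?normr0.
- by move=> T mT aT; exact: approx_setC.
- by move=> F mF _ aF; exact: approx_bigcup.
Qed.

Import HBSimple.

Lemma approx_sfun (g : {sfun mplane >-> R}) : approx g.
Proof.
have mg (y : R) : measurable (g @^-1` [set y]) by exact: measurable_sfunP.
pose h (s : seq R) (z : plane) : R := \sum_(y <- s) y * \1_(g @^-1` [set y]) z.
have -> : (g : plane -> R) = h (finmap.enum_fset (fset_set (range g))).
  by apply/funext => z; rewrite [LHS]fimfunE fsbig_finite.
elim: (finmap.enum_fset _) => [|y s IH]; rewrite /h.
  have -> : (fun z => \sum_(y <- [::]) y * \1_(g @^-1` [set y]) z) = (fun=> 0) :> (plane -> R).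
    by apply/funext => z; rewrite big_nil.
  by apply: approx_continuous => z; exact: cvg_cst.
have -> : (fun z => \sum_(y <- y :: s) y * \1_(g @^-1` [set y]) z) =
  (fun z => y * \1_(g @^-1` [set y]) z + \sum_(y <- s) y * \1_(g @^-1` [set y]) z) :> (plane -> R).
  by apply/funext => z; rewrite big_cons.
apply: approxD => //.
- by apply: measurable_funM; [exact: measurable_cst|exact: mfun_indic].
- apply: measurable_sum => x; apply: measurable_funM; first exact: measurable_cst.
  exact: mfun_indic.
- by apply: approxZ; [exact: mfun_indic|exact: approx_measurable].
Qed.

Lemma approx_BM f M : BM M f -> approx f.
Proof.
move=> bf; have mf : mfun f by case: bf.
have mB := measurable_box N.
have ifB : area.-integrable (box N) (EFin \o f).
  exact: (integrableS measurableT mB (@subsetT _ _) (BM_integrable bf)).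
have [gn [_ _ H]] := approximation_sfun_integrable mB ifB.
apply: approx_lim => // e e0.
have [n _ Hn] : \forall n \near \oo,
    (\int[area]_(z in box N) `|(EFin \o f) z - (gn n z)%:E| < e%:E)%E.
  apply: (H [set x | (x < e%:E)%E]); apply: open_nbhs_nbhs.
  by split; [exact: open_ereal_lt_ereal|rewrite /= lte_fin].
exists (gn n); split; [|exact: approx_sfun|exact: (ltW (Hn n (leqnn n)))].
exact: measurable_funP.
Qed.

End Density.

(** * Translation and positivity of integrals *)

Section Translation.
Context {R : realType}.
Local Notation plane := (R * R)%type.
Local Notation Rm := (measurableTypeR R).
Local Notation mplane := (Rm * Rm)%type.
Local Notation area := (@lebesgue_measure R \x @lebesgue_measure R)%E.
Local Notation mu := (@lebesgue_measure R).
Implicit Types (f g k : plane -> R) (z w : plane).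

Lemma integral_translate1 (G : R -> R) (a : R) : continuous G -> (forall x, 0 <= G x) ->
  (\int[mu]_x (G (x - a))%:E = \int[mu]_x (G x)%:E)%E.
Proof.
move=> cG G0; pose F (x : R) := x - a.
have dF (x : R) : is_derive x 1 F 1.
  have := is_deriveB (is_derive_id x (1 : R)) (is_derive_cst a x (1 : R)).
  by rewrite subr0.
have F' : F^`()%classic = cst 1.
  by apply/funext => x; rewrite derive1E; have [_ ->] := dF x.
rewrite (@increasing_ge0_integration_by_substitutionT R F G) //.
- by apply: eq_integral => x _; rewrite F' fctE/= mulr1.
- by move=> x y xy; rewrite /F ltrD2r.
- by rewrite F' => x; exact: cvg_cst.
- by rewrite F'; exact: is_cvg_cst.
- by rewrite F'; exact: is_cvg_cst.
- by apply/cvgrNyPle => A; near=> x; rewrite /F lerBlDr; near: x; apply: nbhs_ninfty_le; exact: num_real.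
- by apply/cvgryPge => A; near=> x; rewrite /F lerBrDr; near: x; apply: nbhs_pinfty_ge; exact: num_real.
Unshelve. all: by end_near. Qed.

Lemma continuous_pair (T : topologicalType) (a b : T -> R) :
  continuous a -> continuous b -> continuous (fun t => (a t, b t)).
Proof. by move=> ca cb t; exact: (cvg_pair (ca t) (cb t)). Qed.

Lemma continuous_comp2 (T : topologicalType) (a b : T -> R) f :
  continuous f -> continuous a -> continuous b -> continuous (fun t => f (a t, b t)).
Proof.
move=> cf ca cb t; apply: (@continuous_comp _ _ _ (fun t => (a t, b t)) f).
  exact: continuous_pair.
exact: cf.
Qed.

(** Tonelli reduces this to one coordinate at a time; continuity serves the
    substitution rule on the line. *)
Lemma integral_translate f w : continuous f -> (forall z, 0 <= f z) ->
  (\int[area]_z (f (z - w))%:E = \int[area]_z (f z)%:E)%E.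
Proof.
move=> cf f0.
pose fs (z : plane) : R := f (z - w).
have cs : continuous fs.
  move=> z; apply: (@continuous_comp _ _ _ (fun z => z - w) f); last exact: cf.
  by apply: cvgB; [exact: cvg_id|exact: cvg_cst].
have m1 : measurable_fun [set: mplane] (EFin \o f).
  by apply/measurable_EFinP; exact: continuous_measurable2.
have m2 : measurable_fun [set: mplane] (EFin \o fs).
  by apply/measurable_EFinP; exact: continuous_measurable2.
have p1 (z : mplane) : (0 <= (EFin \o f) z)%E by rewrite lee_fin.
have p2 (z : mplane) : (0 <= (EFin \o fs) z)%E by rewrite lee_fin; exact: f0.
have cx (x : R) : continuous (fun y : R => f (x, y)).
  by apply: continuous_comp2 => // y; [exact: cvg_cst|exact: cvg_id].
have cy (y : R) : continuous (fun x : R => f (x, y)).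
  by apply: continuous_comp2 => // x; [exact: cvg_id|exact: cvg_cst].
transitivity (\int[mu]_x \int[mu]_y (f (x - w.1, y - w.2))%:E)%E.
  exact: (fubini_tonelli1 _ m2 p2).
transitivity (\int[mu]_x \int[mu]_y (f (x - w.1, y))%:E)%E.
  by apply: eq_integral => x _; apply: (@integral_translate1 (fun y => f (x - w.1, y))).
transitivity (\int[mu]_y \int[mu]_x (f (x - w.1, y))%:E)%E.
  pose g (z : plane) := f (z.1 - w.1, z.2).
  have mg : measurable_fun [set: mplane] (EFin \o g).
    apply/measurable_EFinP; apply: continuous_measurable2.
    apply: continuous_comp2 => // z; last exact: cvg_snd.
    by apply: cvgB; [exact: cvg_fst|exact: cvg_cst].
  have g0 (z : mplane) : (0 <= (EFin \o g) z)%E by rewrite lee_fin; exact: f0.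
  exact: (fubini_tonelli _ mg g0).
transitivity (\int[mu]_y \int[mu]_x (f (x, y))%:E)%E.
  by apply: eq_integral => y _; apply: (@integral_translate1 (fun x => f (x, y))).
by rewrite (fubini_tonelli2 _ m1 p1).
Qed.

Lemma iint_gt0 f M z0 : BM M f -> continuous f -> (forall z, 0 <= f z) -> 0 < f z0 ->
  0 < iint f.
Proof.
move=> bf cf f0 fz0; pose c := f z0 / 2.
have c0 : 0 < c by rewrite divr_gt0.
have : \forall z \near z0, c < f z.
  by apply: (cvgr_gt _ (cf z0)); rewrite ltr_pdivrMr// mulr_natr mulr2n ltrDl.
move=> /nbhs_ballP[e /= e0 He].
pose B : set mplane := (ball z0.1 e : set Rm) `*` (ball z0.2 e : set Rm).
have mB : measurable B by apply: measurableX; exact: measurable_ball1.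
have aB : (0 < area B)%E.
  have E (x : R) : mu (ball x e) = (e *+ 2)%:E by rewrite lebesgue_measure_ball// ltW.
  have -> : area B = ((e *+ 2)%:E * (e *+ 2)%:E)%E.
    rewrite product_measure1E; [|exact: measurable_ball1..].
    by congr (_ * _)%E; exact: E.
  by rewrite -EFinM lte_fin mulr_gt0 ?pmulrn_lgt0.
rewrite -lte_fin -(iint_EFin bf).
apply: (@lt_le_trans _ _ (\int[area]_(z in B) c%:E)%E).
  by rewrite integral_cst// mule_gt0// lte_fin.
apply: (@le_trans _ _ (\int[area]_(z in B) (f z)%:E)%E).
  apply: ge0_le_integral => //.
  - by move=> z _; rewrite lee_fin ltW.
  - by apply/measurable_EFinP; apply: measurable_funTS; case: bf.
  - by move=> z [z1 z2]; rewrite lee_fin ltW// He.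
apply: ge0_subset_integral => //.
  by apply/measurable_EFinP; case: bf.
by move=> z _; rewrite lee_fin; exact: f0.
Qed.

End Translation.

(** * Mollification *)

Section Mollifier.
Context {R : realType}.
Local Notation plane := (R * R)%type.
Local Notation Rm := (measurableTypeR R).
Local Notation mplane := (Rm * Rm)%type.
Local Notation area := (@lebesgue_measure R \x @lebesgue_measure R)%E.
Implicit Types (f g k : plane -> R) (z w : plane) (n : nat) (i : 'I_2).

Definition eps n : R := n.+1%:R^-1.

Lemma eps_gt0 n : 0 < eps n. Proof. by rewrite invr_gt0 ltr0n. Qed.

Lemma eps_le1 n : eps n <= 1.
Proof. by rewrite invf_le1 ?ltr0n// ler1n. Qed.

Lemma eps_small (e : R) : 0 < e -> \forall n \near \oo, eps n < e.
Proof. by move=> e0; exact: (near_infty_natSinv_lt (PosNum e0)). Qed.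

Lemma bump_like_bump2 (a : R) : 0 < a -> bump_like (bump2 a).
Proof.
move=> a0; split; first exact: smooth_bump2.
by exists a => z az; rewrite bump2_eq0// ltW.
Qed.

Definition mass n : R := iint (bump2 (eps n)).

Lemma mass_gt0 n : 0 < mass n.
Proof.
have [K bK] := bump_like_BM (bump_like_bump2 (eps_gt0 n)).
apply: (iint_gt0 bK).
- by apply: smooth_continuous; exact: smooth_bump2.
- exact: bump2_ge0.
- exact: bump2_gt0 (eps_gt0 n).
Qed.

Definition mol n z : R := (mass n)^-1 * bump2 (eps n) z.

Lemma bump_like_mol n : bump_like (mol n).
Proof.
have [s [r Hr]] := bump_like_bump2 (eps_gt0 n); split.
  by move=> k; apply: CkM; [exact: Ck_cst|exact: s].
by exists r => z rz; rewrite /mol Hr ?mulr0.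
Qed.

Lemma mol_ge0 n z : 0 <= mol n z.
Proof. by rewrite mulr_ge0 ?bump2_ge0// invr_ge0 ltW// mass_gt0. Qed.

Lemma mol_sym n z w : mol n (z - w) = mol n (w - z).
Proof. by rewrite /mol -bump2N opprB. Qed.

Lemma mol_eq0 n z : eps n <= `|z| -> mol n z = 0.
Proof. by move=> ez; rewrite /mol bump2_eq0 ?mulr0// ltW// eps_gt0. Qed.

Lemma derive_mol n i : 'D_(dir i) (mol n) = (fun z => (mass n)^-1 * 'D_(dir i) (bump2 (eps n)) z).
Proof.
apply/funext => z; apply: (@deriveZ R plane R (bump2 (eps n)) (mass n)^-1).
by apply: smooth_derivable; exact: smooth_bump2.
Qed.

Lemma mol_partial_comm n :
  'D_(dir 0) ('D_(dir 1) (mol n)) = 'D_(dir 1) ('D_(dir 0) (mol n)).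
Proof.
have S i j : 'D_(dir j) ('D_(dir i) (mol n)) =
    (fun z => (mass n)^-1 * 'D_(dir j) ('D_(dir i) (bump2 (eps n))) z).
  apply/funext => z.
  apply: (etrans (congr1 (fun f : plane -> R => 'D_(dir j) f z) (derive_mol n i))).
  apply: (@deriveZ R plane R ('D_(dir i) (bump2 (eps n))) (mass n)^-1).
  by apply: smooth_derivable; apply: smooth_partial; exact: smooth_bump2.
apply: (etrans (S 1 0)); apply: (etrans _ (esym (S 0 1))); apply/funext => z.
exact: (congr1 (fun f : plane -> R => (mass n)^-1 * f z) (bump2_partial_comm (eps n))).
Qed.

Lemma mol_BM_translate n w : exists K, BM K (fun z => mol n (z - w)).
Proof.
have [K [mK K1 K0]] := bump_like_BM (bump_like_mol n).
exists (K + `|w|); split.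
- apply: continuous_measurable2; apply: smooth_continuous => k.
  exact: (Ck_translate (- w) ((bump_like_mol n).1 k)).
- by move=> z; rewrite (le_trans (K1 _))// lerDl.
- move=> z Kz; apply: K0; rewrite -(ltrD2r `|w|) (lt_le_trans Kz)//.
  by rewrite -{1}(subrK w z) ler_normD.
Qed.

Lemma iint_mol n w : iint (fun z => mol n (z - w)) = 1.
Proof.
have [K bK] := mol_BM_translate n w.
have [K' bK'] := bump_like_BM (bump_like_mol n).
apply: EFin_inj; rewrite -(iint_EFin bK).
rewrite (integral_translate w (smooth_continuous (bump_like_mol n).1) (mol_ge0 n)).
rewrite (iint_EFin bK').
have [K2 bK2] := bump_like_BM (bump_like_bump2 (eps_gt0 n)).
by rewrite /mol (iintZ _ bK2) -/(mass n) mulVf// gt_eqF// mass_gt0.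
Qed.

Definition moll n f : plane -> R := pint (mol n) id f.

Lemma measurable_map_id : measurable_map (@id plane).
Proof. exact: measurable_id. Qed.

Lemma smooth_moll n f M : BM M f -> smooth (moll n f).
Proof. exact: (smooth_pint (bump_like_mol n) measurable_map_id). Qed.

Lemma BM_moll_integrand n f M z : BM M f -> exists K, BM K (fun s => mol n (s - z) * f s).
Proof.
move=> bf; have [K bK] := bump_like_BM (bump_like_mol n); eexists.
exact: (BM_pint z bK (smooth_continuous (bump_like_mol n).1) measurable_map_id bf).
Qed.

(** A mean of values at distance at most e from c is itself at that distance.
    The bounds, the support and the local uniform convergence of mollifications
    all come from here. *)
Lemma moll_near n f M z (c e : R) : BM M f ->
  (forall s, `|s - z| < eps n -> `|f s - c| <= e) -> `|moll n f z - c| <= e.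
Proof.
move=> bf H; have [K bK] := mol_BM_translate n z.
have [K' bK'] := BM_moll_integrand n z bf.
have Ec : c = iint (fun s => c * mol n (s - z)) by rewrite (iintZ c bK) iint_mol mulr1.
have Ee : e = iint (fun s => e * mol n (s - z)) by rewrite (iintZ e bK) iint_mol mulr1.
rewrite [X in _ - X]Ec [leRHS]Ee /moll /pint -(iintB bK' (BMZ c bK)).
apply: (le_trans (le_norm_iint (BMB bK' (BMZ c bK)))).
apply: le_iint (BM_norm (BMB bK' (BMZ c bK))) (BMZ e bK) _ => s.
rewrite [c * _]mulrC -mulrBr normrM ger0_norm ?mol_ge0// mulrC.
have [se|se] := ltP `|s - z| (eps n); last by rewrite mol_eq0// !mulr0.
by rewrite ler_wpM2r ?mol_ge0// H.
Qed.

Lemma moll_eq0 n f M z : BM M f -> (forall s, `|s - z| < eps n -> f s = 0) ->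
  moll n f z = 0.
Proof.
move=> bf H; apply/eqP; rewrite -normr_le0 -[moll n f z]subr0.
by apply: (moll_near bf) => s /H->; rewrite subrr normr0.
Qed.

Lemma BM_moll n f M : BM M f -> BM (M + 1) (moll n f).
Proof.
move=> bf; split.
- by apply: continuous_measurable2; apply: smooth_continuous; exact: smooth_moll bf.
- move=> z; rewrite -[moll n f z]subr0 (@le_trans _ _ M) ?lerDl//.
  by apply: (moll_near bf) => s _; rewrite subr0; case: bf.
- move=> z Mz; apply: (moll_eq0 bf) => s sz; case: bf => _ _; apply.
  have : `|z| <= `|s - z| + `|s| by rewrite -{1}(subKr s z) distrC ler_normB.
  have := eps_le1 n; lra.
Qed.

End Mollifier.

(** * Convergence of mollifications in L1 *)

Section AreaSigmaFinite.
Context {R : realType}.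
Local Notation Rm := (measurableTypeR R).
Local Notation area := (@lebesgue_measure R \x @lebesgue_measure R)%E.

Lemma area_sigma_finite : sigma_finite [set: (Rm * Rm)%type] area.
Proof.
exists (fun n => box n%:R).
  apply/seteqP; split => // z _.
  exists (Num.bound `|z : R * R|) => //; apply/boxP; apply: ltW.
  exact: archi_boundP (normr_ge0 (z : R * R)).
move=> n; split; first exact: measurable_box.
by rewrite area_box ?ltry.
Qed.

(** Tonelli's theorem on the product of two planes takes a measure packed with
    its sigma-finiteness. *)
Definition area_sf : {sigma_finite_measure set (Rm * Rm)%type -> \bar R} :=
  HB.pack area (Measure_isSigmaFinite.Build _ _ _ area area_sigma_finite).

Variable H : (Rm * Rm) * (Rm * Rm) -> \bar R.
Hypotheses (mH : measurable_fun setT H) (H0 : forall p, (0 <= H p)%E).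

Lemma tonelli_area : (\int[area]_z \int[area]_s H (z, s) =
  \int[area]_s \int[area]_z H (z, s))%E.
Proof. exact: (@fubini_tonelli _ _ _ _ R area_sf area_sf H mH H0). Qed.

Lemma measurable_tonelli1 : measurable_fun setT (fun z => \int[area]_s H (z, s))%E.
Proof. exact: (@measurable_fun_fubini_tonelli_F _ _ _ _ R area_sf H mH H0). Qed.

Lemma measurable_tonelli2 : measurable_fun setT (fun s => \int[area]_z H (z, s))%E.
Proof. exact: (@measurable_fun_fubini_tonelli_G _ _ _ _ R area_sf H mH H0). Qed.

End AreaSigmaFinite.

Section MollifierConvergence.
Context {R : realType}.
Local Notation plane := (R * R)%type.
Local Notation Rm := (measurableTypeR R).
Local Notation mplane := (Rm * Rm)%type.
Local Notation area := (@lebesgue_measure R \x @lebesgue_measure R)%E.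
Implicit Types (f g k : plane -> R) (z w : plane) (n : nat) (i : 'I_2).

(** Uniform continuity near K: only one of the two points lies in K. *)
Lemma heine f (K : set plane) (d : R) : compact K ->
  (forall x, K x -> {for x, continuous f}) -> 0 < d ->
  \forall n \near \oo, forall x, K x -> forall w, `|w - x| < eps n -> `|f w - f x| <= d.
Proof.
move=> cK cf d0; move/compact_near_coveringP: cK.
move=> /(_ nat \oo (fun n x => forall w, `|w - x| < eps n -> `|f w - f x| <= d)); apply.
move=> x Kx; have /cvgrPdist_le /(_ (d / 2)) := cf _ Kx.
rewrite divr_gt0// => /(_ isT) /nbhs_ballP[r /= r0 Hr].
have r2 : 0 < r / 2 by rewrite divr_gt0.
near=> x' n => w wx'.
have xx' : `|x - x'| < r / 2 by near: x'; exact: (@cvgr_dist_lt _ _ _ (nbhs x) _ id x).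
have en : eps n < r / 2 by near: n; exact: eps_small.
have B (y : plane) : `|x - y| < r -> `|f x - f y| <= d / 2.
  by move=> xy; apply: Hr; rewrite -ball_normE.
have xw : `|x - w| < r.
  rewrite -(subrKA x') (le_lt_trans (ler_normD _ _))// [ltRHS]splitr.
  by rewrite ltrD// distrC (lt_trans wx').
rewrite -(subrKA (f x)) (le_trans (ler_normD _ _))// [leRHS]splitr.
rewrite lerD//; first by rewrite distrC B.
by rewrite B// (lt_trans xx')// ltr_pdivrMr// mulr_natr mulr2n ltrDl.
Unshelve. all: by end_near. Qed.

(** The factor 2 leaves room for a ball around a point that is itself at
    distance eps n from K. *)
Lemma lebesgue_number (K O : set plane) : compact K -> open O -> K `<=` O ->
  \forall n \near \oo, forall x, K x -> forall w, `|w - x| <= 2 * eps n -> O w.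
Proof.
move=> cK oO KO; move/compact_near_coveringP: cK.
move=> /(_ nat \oo (fun n x => forall w, `|w - x| <= 2 * eps n -> O w)); apply.
move=> x Kx; have /nbhs_ballP[r /= r0 Hr] := open_nbhs_nbhs (conj oO (KO _ Kx)).
have r2 : 0 < r / 2 by rewrite divr_gt0.
have r4 : 0 < r / 4 by rewrite divr_gt0.
near=> x' n => w wx'.
have xx' : `|x - x'| < r / 2 by near: x'; exact: (@cvgr_dist_lt _ _ _ (nbhs x) _ id x).
have en : eps n < r / 4 by near: n; exact: eps_small.
apply: Hr; rewrite -ball_normE /ball_/=.
rewrite -(subrKA x') (le_lt_trans (ler_normD _ _))// [ltRHS]splitr.
by rewrite ltrD// distrC (le_lt_trans wx')//; lra.
Unshelve. all: by end_near. Qed.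

Lemma moll_unif f M (K : set plane) (d : R) : BM M f -> compact K ->
  (forall x, K x -> {for x, continuous f}) -> 0 < d ->
  \forall n \near \oo, forall z, K z -> `|moll n f z - f z| <= d.
Proof.
move=> bf cK cf d0; have := heine cK cf d0; apply: filterS => n H z Kz.
by apply: (moll_near bf) => s; exact: H.
Qed.

Lemma mollB n f g M N : BM M f -> BM N g ->
  moll n (fun z => f z - g z) = (fun z => moll n f z - moll n g z).
Proof.
move=> bf bg; apply/funext => z; rewrite /moll /pint.
have [K bK] := BM_moll_integrand n z bf; have [K' bK'] := BM_moll_integrand n z bg.
by rewrite -(iintB bK bK'); congr iint; apply/funext => s; rewrite mulrBr.
Qed.

(** Tonelli, since the mollifier is symmetric and has mass 1. *)
Lemma moll_L1_le n f M : BM M f ->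
  iint (fun z => `|moll n f z|) <= iint (fun z => `|f z|).
Proof.
move=> bf; have bn := BM_norm bf.
have mf : measurable_fun [set: mplane] f by case: bf.
pose H (p : mplane * mplane) : \bar R := (mol n (p.2 - p.1) * `|f p.2|)%:E.
have mH : measurable_fun setT H.
  apply/measurable_EFinP; apply: measurable_funM; last first.
    apply: measurableT_comp => //.
    exact: (measurableT_comp mf (@measurable_snd _ _ mplane mplane)).
  have mo : measurable_fun [set: mplane] (mol n).
    apply: continuous_measurable2; apply: smooth_continuous.
    exact: (bump_like_mol n).1.
  pose d (p : mplane * mplane) : mplane := (p.2.1 - p.1.1, p.2.2 - p.1.2).
  have md : measurable_fun setT d.
    have m11 := measurableT_comp (@measurable_fst _ _ Rm Rm) (@measurable_fst _ _ mplane mplane).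
    have m12 := measurableT_comp (@measurable_snd _ _ Rm Rm) (@measurable_fst _ _ mplane mplane).
    have m21 := measurableT_comp (@measurable_fst _ _ Rm Rm) (@measurable_snd _ _ mplane mplane).
    have m22 := measurableT_comp (@measurable_snd _ _ Rm Rm) (@measurable_snd _ _ mplane mplane).
    exact: (measurable_fun_pair (measurable_funB m21 m11) (measurable_funB m22 m12)).
  exact: (measurableT_comp mo md).
have H0 p : (0 <= H p)%E by rewrite lee_fin mulr_ge0 ?mol_ge0.
rewrite -lee_fin -(iint_EFin (BM_norm (BM_moll n bf))) -(iint_EFin bn).
have bm z := BM_moll_integrand n z bn.
apply: (@le_trans _ _ (\int[area]_z \int[area]_s H (z, s))%E).
  apply: ge0_le_integral => //.
  - by apply/measurable_EFinP; case: (BM_norm (BM_moll n bf)).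
  - exact: measurable_tonelli1.
  move=> z _; have [K bK] := bm z.
  rewrite (iint_EFin bK) lee_fin; have [K' bK'] := BM_moll_integrand n z bf.
  rewrite (le_trans (le_norm_iint bK'))//.
  by apply: (le_iint (BM_norm bK') bK) => s; rewrite normrM ger0_norm ?mol_ge0.
rewrite (tonelli_area mH H0); apply: ge0_le_integral => //.
- by move=> s _; apply: integral_ge0.
- exact: measurable_tonelli2.
- by apply/measurable_EFinP; apply: measurableT_comp.
move=> s _; have [K bK] := mol_BM_translate n s.
rewrite [leLHS](_ : _ = (iint (fun z => `|f s| * mol n (z - s)))%:E).
  by rewrite (iintZ _ bK) iint_mol mulr1.
rewrite -(iint_EFin (BMZ _ bK)); apply: eq_integral => z _.
by rewrite /H/= mol_sym mulrC.
Qed.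

Lemma BM_patch_box g (N : R) : continuous g -> exists K, BM K (g \_ (box N)).
Proof.
move=> cg.
have [M [_ HM]] := compact_bounded (continuous_compact
   (continuous_subspaceT cg) (compact_box (M := N))).
exists (Num.max N (Num.max (M + 1) 0)); split=> [|z|z].
- apply/(measurable_restrictT g (measurable_box N)).
  by apply: measurable_funTS; exact: continuous_measurable2.
- rewrite patchE; case: ifPn; last by rewrite normr0 !le_max lexx !orbT.
  rewrite inE => /boxP zN.
  have kM : `|g z| <= M + 1 by apply: (HM (M + 1)); [rewrite ltrDl|exists z].
  by rewrite !le_max kM orbT.
- rewrite gt_max => /andP[Nz _]; rewrite patchE; case: ifPn => //.
  by rewrite inE => /boxP zN; move: Nz; rewrite ltNge zN.
Qed.

(** Compare f with a continuous g that is close in L1: mollification does not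
    increase L1 distances, and it moves g uniformly little. *)
Lemma moll_cvg f M : BM M f -> L1cvg (fun n => moll n f) f.
Proof.
move=> bf; have M0 := BM_ge0 bf.
have bfn n := BM_moll n bf.
have bf1 : BM (M + 1) f by apply: BMW bf; rewrite lerDl.
exists (M + 1); split=> //.
apply/cvgr0Pnorm_le => e e0.
(* moll n f vanishes off box (M + 1) and sees only values at distance at most 1 *)
pose N := M + 2; have N0 : 0 <= N by rewrite addr_ge0.
have e4 : 0 < e / 4 by rewrite divr_gt0.
have [g cg Hg] := approx_BM N0 bf e4.
have [K bg] := BM_patch_box N cg; set g' := g \_ (box N) in bg.
pose d := e / 2 / ((2 * (M + 1)) ^+ 2 + 1).
have D0 : 0 < (2 * (M + 1)) ^+ 2 + 1 by rewrite ltr_wpDl// sqr_ge0.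
have d0 : 0 < d by rewrite !divr_gt0.
have bfg := BMB bf bg.
have Ifg : iint (fun z => `|f z - g' z|) <= e / 4.
  rewrite -lee_fin -(iint_EFin (BM_norm bfg)); apply: le_trans Hg.
  rewrite [leRHS]integral_mkcond le_eqVlt; apply/orP; left; apply/eqP.
  apply: eq_integral => z _; rewrite patchE /g' patchE; case: ifPn => //.
  move=> /negP; rewrite inE => /boxP/negP; rewrite -ltNge => Nz.
  by case: bf => _ _ ->; rewrite ?subrr ?normr0// (lt_trans _ Nz)// ltrDl.
pose one : plane -> R := (fun=> d) \_ (box (M + 1)).
have [K1 b1] : exists K, BM K one by apply: BM_patch_box => z; exact: cvg_cst.
have I1 : iint one <= e / 2.
  have d1 z : `|one z| <= d.
    by rewrite /one patchE; case: ifPn => _; rewrite ?normr0 ?ger0_norm// ltW.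
  have b1' : BM (Num.max (M + 1) d) one.
    split=> [|z|z]; first by case: b1.
      by rewrite le_max d1 orbT.
    rewrite gt_max => /andP[Mz _]; rewrite /one patchE; case: ifPn => //.
    by rewrite inE => /boxP; rewrite leNgt Mz.
  rewrite -lee_fin -(iint_EFin b1').
  have -> : (\int[area]_z (one z)%:E = \int[area]_(z in box (M + 1)) d%:E)%E.
    rewrite [RHS]integral_mkcond; apply: eq_integral => z _.
    by rewrite /one !patchE; case: ifPn.
  rewrite integral_cst; last exact: measurable_box.
  rewrite [X in (_ * X)%E](_ : _ = ((2 * (M + 1)) ^+ 2)%:E); last first.
    by apply: area_box; rewrite addr_ge0.
  by rewrite -EFinM lee_fin mulrAC ler_pdivrMr// ler_wpM2l ?(ltW (divr_gt0 _ _))// lerDl.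
have cK : compact [set z : plane | `|z| <= M + 2] by exact: compact_box.
have H := heine cK (fun x _ => cg x) d0.
near=> n; rewrite ger0_norm ?iint_ge0//.
have Hn : forall x, `|x| <= M + 2 -> forall w, `|w - x| < eps n -> `|g w - g x| <= d.
  by near: n; exact: H.
have bm := BM_norm (BM_moll n bfg).
have bB := BM_norm (BMB (bfn n) bf1).
have bS := BMD (BMD bm (BM_norm bfg)) b1.
apply: (@le_trans _ _ (iint (fun z => `|moll n (fun z => f z - g' z) z| + `|f z - g' z| + one z))).
  apply: (le_iint bB bS) => z.
  have [zM|Mz] := leP `|z| (M + 1); last first.
    have -> : moll n f z = 0 by case: (bfn n) => _ _ ->.
    have -> : f z = 0 by case: bf1 => _ _ ->.
    rewrite subrr normr0 !addr_ge0// /one patchE; case: ifPn => // _; exact: ltW.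
  have -> : one z = d by rewrite /one patchE mem_set//; apply/boxP.
  rewrite (mollB n bf bg).
  have G : `|moll n g' z - g' z| <= d.
    apply: (moll_near bg) => s sz.
    have E1 := @eps_le1 R n.
    have sN : `|s| <= N.
      have : `|s| <= `|s - z| + `|z| by rewrite -{1}(subrK z s) ler_normD.
      by rewrite /N; lra.
    have zN : `|z| <= N by rewrite /N; lra.
    rewrite /g' !patchE !mem_set; [|exact/boxP|exact/boxP].
    exact: Hn.
  have -> : moll n f z - f z = (moll n f z - moll n g' z) + (moll n g' z - g' z) - (f z - g' z) by ring.
  rewrite (le_trans (ler_normB _ _))// (le_trans (lerD (ler_normD _ _) (lexx _)))//.
  by rewrite addrAC lerD.
rewrite (iintD (BMD bm (BM_norm bfg)) b1) (iintD bm (BM_norm bfg)).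
have := moll_L1_le n bfg; lra.
Unshelve. all: by end_near. Qed.

End MollifierConvergence.

(** * Integration by parts and weak derivatives *)

Section IntegrationByParts.
Context {R : realType}.
Local Notation plane := (R * R)%type.
Local Notation Rm := (measurableTypeR R).
Local Notation mplane := (Rm * Rm)%type.
Local Notation area := (@lebesgue_measure R \x @lebesgue_measure R)%E.
Local Notation mu := (@lebesgue_measure R).
Implicit Types (f g k eta : plane -> R) (z w : plane) (n : nat) (i : 'I_2).

Lemma integral_derive1_eq0 (g g' : R -> R) (r : R) :
  (forall x : R, is_derive x 1 g (g' x)) -> continuous g' ->
  (forall x, r < `|x| -> g x = 0) -> (forall x, r < `|x| -> g' x = 0) ->
  (\int[mu]_x (g' x)%:E = 0)%E.
Proof.
move=> dg cg' g0 g'0; pose a : R := `|r| + 1.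
have ra : r < a by rewrite (le_lt_trans (ler_norm r))// ltrDl.
have a0 : 0 < a by rewrite ltr_wpDl.
have cg : continuous g.
  move=> x; apply/differentiable_continuous/derivable1_diffP.
  by have [] := dg x.
have -> : (\int[mu]_x (g' x)%:E = \int[mu]_(x in `[(- a)%R, a]) (g' x)%:E)%E.
  rewrite [RHS]integral_mkcond; apply: eq_integral => x _.
  rewrite patchE; case: ifPn => // /negP; rewrite inE/= in_itv/= -ler_norml.
  by move=> /negP; rewrite -ltNge => ax; rewrite g'0// (lt_trans ra).
rewrite (@continuous_FTC2 _ g' g (- a) a).
- by rewrite !g0 ?subee// ?normrN gtr0_norm.
- by rewrite -subr_gt0 opprK addr_gt0.
- exact: continuous_subspaceT.
- split.
  + by move=> x _; have [] := dg x.
  + by apply: cvg_at_right_filter; exact: cg.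
  + by apply: cvg_at_left_filter; exact: cg.
- by move=> x _; rewrite derive1E; have [_ ->] := dg x.
Qed.

(** Integrate first along the direction of differentiation. *)
Lemma iint_partial_eq0 f i (M r : R) : (forall z, derivable f z (dir i)) ->
  BM M ('D_(dir i) f) -> continuous ('D_(dir i) f) ->
  (forall z, r < `|z| -> f z = 0) -> iint ('D_(dir i) f) = 0.
Proof.
move=> df bD cD f0; apply: EFin_inj; rewrite -(iint_EFin bD).
have iD := BM_integrable bD.
pose s := Num.max r M.
have sf z : s < `|z| -> f z = 0 by rewrite gt_max => /andP[/f0].
have sD z : s < `|z| -> 'D_(dir i) f z = 0.
  by rewrite gt_max => /andP[_ Mz]; case: bD => _ _; apply.
have lineD z (t : R) : is_derive t 1 (fun t : R => f (z + t *: dir i))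
    ('D_(dir i) f (z + t *: dir i)).
  by apply: DeriveDef; [apply/derivable_line|rewrite derive_line].
have [iE|iE] := ord2_cases i.
- rewrite iE in lineD cD sD iD *.
  have E (x y : R) : (x, y) = (0, y) + x *: dir 0 :> plane.
    rewrite /dir eqxx; have -> : x *: (1, 0) = (x * 1, x * 0) :> plane by [].
    by rewrite mulr1 mulr0; congr (_, _); rewrite ?add0r ?addr0.
  rewrite -(integral21_prod_meas1 iD)/= /fubini_G.
  rewrite (eq_integral (fun=> 0%E)) ?integral0// => y _ /=.
  apply: (@integral_derive1_eq0 (fun x => f (x, y)) (fun x => 'D_(dir 0) f (x, y)) s).
  + move=> x; have -> : (fun x : R => f (x, y)) = (fun t : R => f ((0, y) + t *: dir 0)).
      by apply/funext => t; rewrite (E t y).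
    by have := lineD (0, y) x; rewrite -E.
  + by apply: (@continuous_comp2 R R id (fun=> (y : R)) _ cD) => x; [exact: cvg_id|exact: cvg_cst].
  + by move=> x sx; apply: (sf (x : R, y : R)); rewrite (lt_le_trans sx)// (norm1_le (x : R, y : R)).
  + by move=> x sx; apply: (sD (x : R, y : R)); rewrite (lt_le_trans sx)// (norm1_le (x : R, y : R)).
rewrite iE in lineD cD sD iD *.
have E (x y : R) : (x, y) = (x, 0) + y *: dir 1 :> plane.
  rewrite /dir/=; have -> : y *: (0, 1) = (y * 0, y * 1) :> plane by [].
  by rewrite mulr1 mulr0; congr (_, _); rewrite ?add0r ?addr0.
rewrite -(integral12_prod_meas1 iD)/= /fubini_F.
rewrite (eq_integral (fun=> 0%E)) ?integral0// => x _ /=.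
apply: (@integral_derive1_eq0 (fun y => f (x, y)) (fun y => 'D_(dir 1) f (x, y)) s).
+ move=> y; have -> : (fun y : R => f (x, y)) = (fun t : R => f ((x, 0) + t *: dir 1)).
    by apply/funext => t; rewrite (E x t).
  by have := lineD (x, 0) y; rewrite -E.
+ by apply: (@continuous_comp2 R R (fun=> (x : R)) id _ cD) => y; [exact: cvg_cst|exact: cvg_id].
+ by move=> y sy; apply: (sf (x : R, y : R)); rewrite (lt_le_trans sy)// (norm2_le (x : R, y : R)).
+ by move=> y sy; apply: (sD (x : R, y : R)); rewrite (lt_le_trans sy)// (norm2_le (x : R, y : R)).
Qed.

Lemma BM_continuous f (r : R) : continuous f -> (forall z, r < `|z| -> f z = 0) ->
  exists M, BM M f.
Proof.
move=> cf f0; have [K bK] := BM_patch_box r cf; exists K.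
suff <- : f \_ (box r) = f by [].
apply/funext => z; rewrite patchE; case: ifPn => // /negP.
by rewrite inE => /boxP/negP; rewrite -ltNge => /f0.
Qed.

Lemma iint_by_parts (h : plane -> R) eta i : bump_like eta ->
  (forall z, derivable h z (dir i)) -> continuous h -> continuous ('D_(dir i) h) ->
  iint (fun z => h z * 'D_(dir i) eta z) = - iint (fun z => 'D_(dir i) h z * eta z).
Proof.
move=> be dh ch cDh; have [se [r e0]] := be.
have [sDe [r' De0]] := bump_like_partial i be.
have ce := smooth_continuous se; have cDe := smooth_continuous sDe.
have DE : 'D_(dir i) (fun z => h z * eta z) =
    (fun z => h z * 'D_(dir i) eta z + 'D_(dir i) h z * eta z).
  apply/funext => z; rewrite [X in _ = _ + X]mulrC.
  by apply: (deriveM (dh z)); exact: smooth_derivable.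
have [M1 B1] : exists M, BM M (fun z => h z * 'D_(dir i) eta z).
  apply: (@BM_continuous _ r').
    by move=> z; apply: cvgM; [exact: ch|exact: cDe].
  by move=> z /De0 ->; rewrite mulr0.
have [M2 B2] : exists M, BM M (fun z => 'D_(dir i) h z * eta z).
  apply: (@BM_continuous _ r).
    by move=> z; apply: cvgM; [exact: cDh|exact: ce].
  by move=> z /e0 ->; rewrite mulr0.
apply/eqP; rewrite -addr_eq0 -(iintD B1 B2) -DE; apply/eqP.
apply: (@iint_partial_eq0 _ i (M1 + M2) r).
- by move=> z; apply: derivableM => //; exact: smooth_derivable.
- by rewrite DE; exact: BMD.
- rewrite DE => z; apply: cvgD; apply: cvgM.
  + exact: ch.
  + exact: cDe.
  + exact: cDh.
  + exact: ce.
- by move=> z /e0 ->; rewrite mulr0.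
Qed.

Lemma test_function_bump_like (O : set plane) eta : test_function O eta -> bump_like eta.
Proof.
move=> [se cs _]; split=> //.
have [M [_ HM]] := compact_bounded cs; exists (M + 1) => z Mz.
apply/eqP; apply/negP => /negP ez.
have : `|z| <= M + 1 by apply: (HM (M + 1)); [rewrite ltrDl|apply: subset_closure].
by rewrite leNgt Mz.
Qed.

Lemma test_function_intro (O K : set plane) eta : smooth eta -> compact K -> K `<=` O ->
  (forall z, eta z != 0 -> K z) -> test_function O eta.
Proof.
move=> se cK KO eK.
have clK : closed K by apply: compact_closed => //; exact: norm_hausdorff.
have sK : closure [set z | eta z != 0] `<=` K.
  by rewrite closure_id in clK; rewrite clK; exact: closure_subset.
split=> //; last exact: (subset_trans sK).
by apply: (subclosed_compact _ cK) => //; exact: closed_closure.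
Qed.

Lemma test_function_eq0 (O : set plane) eta : test_function O eta ->
  forall z, ~ O z -> eta z = 0.
Proof.
move=> [_ _ sO] z nO; apply/eqP; apply: contra_notT nO => ez.
by apply: sO; exact: subset_closure.
Qed.

Lemma partial_support eta i z : smooth eta ->
  'D_(dir i) eta z != 0 -> closure [set z | eta z != 0] z.
Proof.
move=> se; apply: contraNP => ncl.
have oC : open (~` closure [set z | eta z != 0]).
  by apply: closed_openC; exact: closed_closure.
rewrite -(@near_eq_derive _ _ _ (cst 0)) ?derive_cst//.
have := open_nbhs_nbhs (conj oC ncl); apply: filterS => w nw.
by apply/eqP; rewrite eq_sym; apply/negP => /negP ew; apply: nw; exact: subset_closure.
Qed.

Lemma test_function_partial (O : set plane) eta i : test_function O eta ->
  test_function O ('D_(dir i) eta).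
Proof.
move=> [se cs sO]; apply: (test_function_intro (K := closure [set z | eta z != 0])) => //.
  exact: smooth_partial.
by move=> z; exact: partial_support.
Qed.

(** Weak derivatives for functions of the class BM: as test functions vanish
    off O, the integrals may run over the plane. *)
Definition wder (O : set plane) i f g : Prop := forall eta, test_function O eta ->
  iint (fun z => f z * 'D_(dir i) eta z) = - iint (fun z => g z * eta z).

Lemma test_function_mol (O : set plane) n z : (forall s, `|s - z| <= eps n -> O s) ->
  test_function O (fun s => mol n (s - z)).
Proof.
move=> HO; apply: (test_function_intro (K := [set s | `|s - z| <= eps n])) => //.
- by move=> k; exact: (Ck_translate (- z) ((bump_like_mol n).1 k)).
- have -> : [set s | `|s - z| <= eps n] = (fun s => s + z) @` [set s : plane | `|s| <= eps n].
    apply/seteqP; split => [s /= sz|_ [s /= sn <-]]; last by rewrite addrK.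
    by exists (s - z) => //; rewrite subrK.
  apply: continuous_compact; last exact: compact_box.
  by apply: continuous_subspaceT => s; apply: cvgD; [exact: cvg_id|exact: cvg_cst].
- by move=> s; apply: contraNP => /negP; rewrite -ltNge => /ltW/mol_eq0 ->.
Qed.

Lemma derive_moll n f M i z : BM M f ->
  'D_(dir i) (moll n f) z = - iint (fun s => 'D_(dir i) (mol n) (s - z) * f s).
Proof.
move=> bf.
by have [_ ->] := is_derive_pint i z (bump_like_mol n) measurable_map_id bf.
Qed.

(** A translate of the mollifier supported in O is a test function of O. *)
Lemma moll_wder (O : set plane) i f g M n z : BM M f -> wder O i f g ->
  (forall s, `|s - z| <= eps n -> O s) -> 'D_(dir i) (moll n f) z = moll n g z.
Proof.
move=> bf fg HO; rewrite (derive_moll n i z bf).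
have := fg _ (test_function_mol HO).
have -> : (fun s => f s * 'D_(dir i) (fun s => mol n (s - z)) s) =
    (fun s => 'D_(dir i) (mol n) (s - z) * f s).
  by apply/funext => s; rewrite derive_translate mulrC.
move=> ->; rewrite opprK /moll /pint; congr iint; apply/funext => s.
by rewrite mulrC.
Qed.

End IntegrationByParts.

(** * The weak chain rule *)

Section ChainRule.
Context {R : realType}.
Local Notation plane := (R * R)%type.
Local Notation Rm := (measurableTypeR R).
Local Notation mplane := (Rm * Rm)%type.
Local Notation area := (@lebesgue_measure R \x @lebesgue_measure R)%E.
Implicit Types (f g h p q v eta : plane -> R) (z w : plane) (n : nat) (i : 'I_2).

Lemma measurable_pair_comp v p q : continuous v -> measurable_fun [set: mplane] p ->
  measurable_fun [set: mplane] q -> measurable_fun [set: mplane] (fun z => v (p z, q z)).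
Proof.
move=> cv mp mq.
exact: (measurableT_comp (continuous_measurable2 cv) (measurable_fun_pair mp mq)).
Qed.

(** The compact support of h turns the continuity of p and q into uniform
    convergence of their mollifications. *)
Lemma comp_moll_cvg v p q h (K : set plane) (P Q H : R) : bump_like v ->
  BM P p -> BM Q q -> BM H h -> compact K ->
  (forall z, K z -> {for z, continuous p}) -> (forall z, K z -> {for z, continuous q}) ->
  (forall z, h z != 0 -> K z) ->
  L1cvg (fun n z => h z * v (moll n p z, moll n q z)) (fun z => h z * v (p z, q z)).
Proof.
move=> bv bp bq bh cK cp cq hK.
have [V bV] := bump_like_BM bv; have cv := smooth_continuous bv.1.
have [C HC] := bump_like_lipschitz bv.
have v1 z : `|v z| <= V by case: bV.
have mv p' q' : measurable_fun [set: mplane] p' -> measurable_fun [set: mplane] q' ->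
  BM (Num.max H (H * V)) (fun z => h z * v (p' z, q' z)).
  by move=> mp mq; apply: BMMr => //; exact: measurable_pair_comp.
have mp n : measurable_fun [set: mplane] (moll n p) by case: (BM_moll n bp).
have mq n : measurable_fun [set: mplane] (moll n q) by case: (BM_moll n bq).
apply: (@L1cvg_unif _ _ _ (Num.max H (H * V))).
- by move=> n; exact: mv.
- by apply: mv; [case: bp|case: bq].
move=> e e0; have H0 := BM_ge0 bh.
pose c := H * `|C| + 1; have c0 : 0 < c by rewrite ltr_wpDl// mulr_ge0.
have d0 : 0 < e / c by rewrite divr_gt0.
have U1 := moll_unif bp cK cp d0; have U2 := moll_unif bq cK cq d0.
apply: filterS2 U1 U2 => n U1 U2 z; rewrite -mulrBr normrM.
have [->|hz] := eqVneq (h z) 0; first by rewrite normr0 mul0r ltW.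
have Kz := hK _ hz.
apply: (@le_trans _ _ (H * (`|C| * (e / c)))).
  apply: ler_pM => //; first by case: bh.
  apply: (le_trans (HC _ _)); apply: (@le_trans _ _ (`|C| * `|(moll n p z, moll n q z) - (p z, q z)|)).
    by rewrite ler_wpM2r// ler_norm.
  by rewrite ler_wpM2l// prod_normE ge_max/= U1// U2.
by rewrite mulrA mulrCA ler_piMr ?(ltW e0)// ler_pdivrMr// mul1r lerDl.
Qed.

(** For the mollifications of p and q this is the chain rule followed by an
    integration by parts.  In the limit v (p, q) converges uniformly on the
    support of the test function, the derivatives of p and q in L1. *)
Lemma wder_chain (O : set plane) i v p q pi qi (P Q P' Q' : R) : open O -> bump_like v ->
  BM P p -> BM Q q -> BM P' pi -> BM Q' qi ->
  (forall z, O z -> {for z, continuous p}) -> (forall z, O z -> {for z, continuous q}) ->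
  wder O i p pi -> wder O i q qi ->
  wder O i (fun z => v (p z, q z))
    (fun z => 'D_(dir 0) v (p z, q z) * pi z + 'D_(dir 1) v (p z, q z) * qi z).
Proof.
move=> oO bv bp bq bpi bqi cp cq wp wq eta te.
have be := test_function_bump_like te; have [se cs sO] := te.
set K := closure [set z | eta z != 0] in cs sO.
have cpK z : K z -> {for z, continuous p} by move=> /sO; exact: cp.
have cqK z : K z -> {for z, continuous q} by move=> /sO; exact: cq.
have etaK z : eta z != 0 -> K z by move=> ez; apply: subset_closure.
have DetaK z : 'D_(dir i) eta z != 0 -> K z by exact: partial_support.
have [E bE] := bump_like_BM be.
have [E' bE'] := bump_like_BM (bump_like_partial i be).
have bv0 := bump_like_partial 0 bv; have bv1 := bump_like_partial 1 bv.
have L := comp_moll_cvg bv bp bq bE' cs cpK cqK DetaK.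
have R0 := L1cvgM (comp_moll_cvg bv0 bp bq bE cs cpK cqK etaK) (moll_cvg bpi).
have R1 := L1cvgM (comp_moll_cvg bv1 bp bq bE cs cpK cqK etaK) (moll_cvg bqi).
have RR := L1cvgD R0 R1; have [N [bRR bR _]] := RR.
have near_eq : \forall n \near \oo,
   iint (fun z => 'D_(dir i) eta z * v (moll n p z, moll n q z)) =
   - iint (fun z => eta z * 'D_(dir 0) v (moll n p z, moll n q z) * moll n pi z +
             eta z * 'D_(dir 1) v (moll n p z, moll n q z) * moll n qi z).
  have LN := lebesgue_number cs oO sO; apply: filterS LN => n LN.
  have sp := smooth_moll n bp; have sq := smooth_moll n bq.
  have Dv z : is_derive z (dir i) (fun z => v (moll n p z, moll n q z))
    ('D_(dir 0) v (moll n p z, moll n q z) * 'D_(dir i) (moll n p) z +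
     'D_(dir 1) v (moll n p z, moll n q z) * 'D_(dir i) (moll n q) z).
    by apply: is_derive_bump_like_comp => //; apply: DeriveDef => //; exact: smooth_derivable.
  have DvE : 'D_(dir i) (fun z => v (moll n p z, moll n q z)) = (fun z =>
     'D_(dir 0) v (moll n p z, moll n q z) * 'D_(dir i) (moll n p) z +
     'D_(dir 1) v (moll n p z, moll n q z) * 'D_(dir i) (moll n q) z).
    by apply/funext => z; have [_ ->] := Dv z.
  have cm k : bump_like k -> continuous (fun z => k (moll n p z, moll n q z)).
    move=> bk; apply: continuous_comp2; first exact: smooth_continuous bk.1.
      exact: smooth_continuous.
    exact: smooth_continuous.
  have := @iint_by_parts _ (fun z => v (moll n p z, moll n q z)) eta i be.
  have c0 := cm _ bv0; have c1 := cm _ bv1.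
  have cp' := smooth_continuous (smooth_partial i sp).
  have cq' := smooth_continuous (smooth_partial i sq).
  have cDv : continuous ('D_(dir i) (fun z => v (moll n p z, moll n q z))).
    rewrite DvE => z.
    exact: (cvgD (cvgM (c0 z) (cp' z)) (cvgM (c1 z) (cq' z))).
  move=> /(_ (fun z => @ex_derive _ _ _ _ _ _ _ (Dv z)) (cm _ bv) cDv).
  under eq_fun do rewrite mulrC.
  move=> ->; congr (- iint _); apply/funext => z.
  rewrite (congr1 (fun f : plane -> R => f z) DvE).
  have [->|ez] := eqVneq (eta z) 0; first by rewrite !mul0r addr0 mulr0.
  have HO s : `|s - z| <= eps n -> O s.
    move=> sz; apply: (LN z (etaK _ ez)); apply: (le_trans sz).
    by rewrite mulr_natl mulr2n lerDl ltW// eps_gt0.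
  rewrite (moll_wder bp wp HO) (moll_wder bq wq HO); ring.
have cL := L1cvg_iint L; have cR := L1cvg_iint RR.
have cR' : - iint (fun z => eta z * 'D_(dir 0) v (moll n p z, moll n q z) * moll n pi z +
             eta z * 'D_(dir 1) v (moll n p z, moll n q z) * moll n qi z) @[n --> \oo]
   --> - iint (fun z => eta z * 'D_(dir 0) v (p z, q z) * pi z +
             eta z * 'D_(dir 1) v (p z, q z) * qi z) by exact: cvgN.
have cL' : - iint (fun z => eta z * 'D_(dir 0) v (moll n p z, moll n q z) * moll n pi z +
             eta z * 'D_(dir 1) v (moll n p z, moll n q z) * moll n qi z) @[n --> \oo]
   --> iint (fun z => 'D_(dir i) eta z * v (p z, q z)).
  apply: cvg_trans cL; apply: near_eq_cvg.
  by apply: filterS near_eq => n ->.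
have := cvg_unique (@Rhausdorff R) cL' cR'.
have -> : (fun z => 'D_(dir i) eta z * v (p z, q z)) = (fun z => v (p z, q z) * 'D_(dir i) eta z).
  by apply/funext => z; rewrite mulrC.
by move=> ->; congr (- iint _); apply/funext => z; ring.
Qed.

End ChainRule.

(** * Composition with an area-preserving map *)

Section PullBack.
Context {R : realType}.
Local Notation plane := (R * R)%type.
Local Notation Rm := (measurableTypeR R).
Local Notation mplane := (Rm * Rm)%type.
Local Notation area := (@lebesgue_measure R \x @lebesgue_measure R)%E.
Implicit Types (f g h v eta : plane -> R) (z w : plane) (n : nat) (i j : 'I_2).

Lemma moll_partial_comm n f M : BM M f ->
  'D_(dir 0) ('D_(dir 1) (moll n f)) = 'D_(dir 1) ('D_(dir 0) (moll n f)).
Proof.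
move=> bf; have D2 i j z : 'D_(dir j) ('D_(dir i) (moll n f)) z =
    pint ('D_(dir j) ('D_(dir i) (mol n))) id f z.
  have bm := @bump_like_mol R n.
  have E : 'D_(dir i) (moll n f) = (fun w => - pint ('D_(dir i) (mol n)) id f w).
    apply/funext => w.
    by have [_ ->] := is_derive_pint i w bm measurable_map_id bf.
  have Dn := is_deriveN (is_derive_pint j z (bump_like_partial i bm) measurable_map_id bf).
  have [_ En] := Dn.
  apply: (etrans (congr1 (fun g : plane -> R => 'D_(dir j) g z) E)).
  by apply: (etrans En); rewrite opprK.
apply/funext => z; apply: (etrans (D2 1 0 z)); apply: (etrans _ (esym (D2 0 1 z))).
exact: (congr1 (fun k => pint k id f z) (mol_partial_comm n)).
Qed.

(** On the open set O the map (p, q) is continuous with weak differential (P, Q).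
    C will contain the supports of the functions composed with it, so that the
    compositions live in the compact set S. *)

Variables (O S C : set plane) (p q : plane -> R) (P Q : 'I_2 -> plane -> R) (M : R).
Hypotheses (oO : open O) (cS : compact S) (SO : S `<=` O) (clC : closed C).
Hypotheses (bp : BM M p) (bq : BM M q).
Hypotheses (bP : forall i, BM M (P i)) (bQ : forall i, BM M (Q i)).
Hypotheses (cp : forall z, O z -> {for z, continuous p}).
Hypotheses (cq : forall z, O z -> {for z, continuous q}).
Hypotheses (wp : forall i, wder O i p (P i)) (wq : forall i, wder O i q (Q i)).
Hypothesis HS : forall z, O z -> C (p z, q z) -> S z.
Hypothesis J1 : {ae area, forall z, S z -> P 0 z * Q 1 z - P 1 z * Q 0 z = 1}.

Let mS : measurable (S : set mplane).
Proof. exact: compact_measurable2. Qed.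

Lemma BM_indicS : exists K, BM K (\1_S : plane -> R).
Proof.
have [K [_ HK]] := compact_bounded cS.
exists (Num.max (K + 1) 1); split=> [|z|z].
- exact: measurable_indic.
- by rewrite le_max; apply/orP; right; exact: indic_le1.
- rewrite gt_max => /andP[Kz _]; rewrite indicE memNset// => Sz.
  have : `|z| <= K + 1 by apply: (HK (K + 1)); rewrite ?ltrDl.
  by rewrite leNgt Kz.
Qed.

(** For h supported in C, the function equal to h (p, q) on O and to 0
    elsewhere (pull_eq).  The cut-off by S rather than by O gives it compact
    support in O. *)
Definition pull h z : R := \1_S z * h (p z, q z).

Lemma pull_cases h z : (pull h z = 0 /\ ~ S z) \/ (pull h z = h (p z, q z) /\ S z).
Proof.
rewrite /pull indicE; have [|] := boolP (z \in S).
  by rewrite inE => Sz; right; rewrite mul1r.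
by rewrite notin_setE => nS; left; rewrite mul0r.
Qed.

Lemma BM_pull : exists K, forall h B, continuous h -> (forall z, `|h z| <= B) ->
  BM (Num.max K (K * B)) (pull h).
Proof.
have [K bK] := BM_indicS; exists K => h B ch hB.
apply: (BMMr bK) => //; apply: measurable_pair_comp => //; first by case: bp.
by case: bq.
Qed.

Lemma BM_pull_ex h B : continuous h -> (forall z, `|h z| <= B) -> exists K, BM K (pull h).
Proof. by move=> ch hB; have [K HK] := BM_pull; eexists; exact: HK ch hB. Qed.

Lemma pull_eq h z : (forall z, h z != 0 -> C z) -> O z -> pull h z = h (p z, q z).
Proof.
move=> hC Oz; have [[-> nS]|[]//] := pull_cases h z.
have [->//|hz] := eqVneq (h (p z, q z)) 0.
by exfalso; apply: nS; apply: HS => //; exact: hC.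
Qed.

Section OneFunction.
Variable v : plane -> R.
Hypotheses (bv : bump_like v) (vC : forall z, v z != 0 -> C z).

Let DvC i z : 'D_(dir i) v z != 0 -> C z.
Proof.
move=> /(partial_support bv.1).
by move: z; rewrite (closure_id C).1 //; exact: closure_subset.
Qed.

Let u := pull v.
(** The weak gradient of pull v, by the chain rule. *)
Definition pull_grad i z : R :=
  pull ('D_(dir 0) v) z * P i z + pull ('D_(dir 1) v) z * Q i z.
Let G := pull_grad.

Lemma BM_pull_bump (k : plane -> R) : bump_like k -> exists K, BM K (pull k).
Proof.
move=> bk; have [K [_ K1 _]] := bump_like_BM bk.
exact: (BM_pull_ex (smooth_continuous bk.1) K1).
Qed.

Lemma BM_pull_grad i : exists K, BM K (G i).
Proof.
have [K0 B0] := BM_pull_bump (bump_like_partial 0 bv).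
have [K1 B1] := BM_pull_bump (bump_like_partial 1 bv).
have [mP PM _] := bP i; have [mQ QM _] := bQ i.
by eexists; apply: BMD (BMMr B0 mP PM) (BMMr B1 mQ QM).
Qed.

Lemma wder_pull i : wder O i u (G i).
Proof.
move=> eta te; have tD := test_function_partial i te.
have E1 : (fun z => u z * 'D_(dir i) eta z) = (fun z => v (p z, q z) * 'D_(dir i) eta z).
  apply/funext => z; have [Oz|nO] := pselect (O z); first by rewrite /u pull_eq.
  by rewrite (test_function_eq0 tD nO) !mulr0.
have E2 : (fun z => G i z * eta z) =
   (fun z => ('D_(dir 0) v (p z, q z) * P i z + 'D_(dir 1) v (p z, q z) * Q i z) * eta z).
  apply/funext => z; have [Oz|nO] := pselect (O z).
    by rewrite /G /pull_grad !pull_eq//; exact: DvC.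
  by rewrite (test_function_eq0 te nO) !mulr0.
rewrite E1 E2.
exact: (wder_chain oO bv bp bq (bP i) (bQ i) cp cq (wp i) (wq i) te).
Qed.

Let uS z : ~ S z -> u z = 0.
Proof. by move=> nS; have [[]|[_ /nS]] := pull_cases v z. Qed.

Let GS i z : ~ S z -> G i z = 0.
Proof.
move=> nS; rewrite /G /pull_grad.
have [[-> _]|[_ /nS//]] := pull_cases ('D_(dir 0) v) z.
have [[-> _]|[_ /nS//]] := pull_cases ('D_(dir 1) v) z.
by rewrite !mul0r addr0.
Qed.

(** Near S the weak derivative passes under the mollifier; at a point whose
    eps n-ball leaves O both sides vanish, because that ball misses S. *)
Lemma moll_pull_test : \forall n \near \oo, test_function O (moll n u) /\
  forall i, 'D_(dir i) (moll n u) = moll n (G i).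
Proof.
have [K bu] := BM_pull_bump bv.
have LN := lebesgue_number cS oO SO; apply: filterS LN => n LN.
have e0 := @eps_gt0 R n.
split.
  pose Kn := (fun x : plane * plane => x.1 + x.2) @` (S `*` [set h : plane | `|h| <= eps n]).
  apply: (test_function_intro (K := Kn)).
  - exact: smooth_moll bu.
  - apply: continuous_compact; last by apply: compact_setX => //; exact: compact_box.
    apply: continuous_subspaceT => x.
    by apply: cvgD; [exact: cvg_fst|exact: cvg_snd].
  - move=> _ [[s h] [/= Ss hn] <-]; apply: (LN s Ss).
    rewrite [s + h]addrC addrK (le_trans hn)// mulr_natl mulr2n lerDl ltW//.
  - move=> z; apply: contra_neqP => nK; apply: (moll_eq0 bu) => s sz.
    apply: uS => Ss; apply: nK; exists (s, z - s) => /=.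
      by split=> //=; rewrite distrC ltW.
    by rewrite addrC subrK.
move=> i; apply/funext => z; have [KG bG] := BM_pull_grad i.
have [HO|] := pselect (forall s, `|s - z| <= eps n -> O s).
  exact: (moll_wder bu (@wder_pull i) HO).
move=> /existsNP[w /not_implyP[wz nOw]].
have far s : `|s - z| <= eps n -> ~ S s.
  move=> sz Ss; apply: nOw; apply: (LN s Ss).
  rewrite -(subrKA z) (le_trans (ler_normD _ _))// mulr_natl mulr2n lerD//.
  by rewrite distrC.
rewrite (moll_eq0 bG); last by move=> s /ltW /far; exact: GS.
rewrite (derive_moll n i z bu).
rewrite [X in iint X](_ : _ = fun=> 0) ?iint0 ?oppr0//.
apply/funext => s; have [/far/uS us|ns] := leP `|s - z| (eps n).
  by rewrite -[pull v s]/(u s) us mulr0.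
suff -> : 'D_(dir i) (mol n) (s - z) = 0 by rewrite mul0r.
rewrite -(@near_eq_derive _ _ _ (cst 0)) ?derive_cst//.
have : \forall w \near s - z, eps n < `|w|.
  have : `|w| @[w --> s - z] --> `|s - z| by apply: cvg_norm; exact: cvg_id.
  by move=> /cvgr_gt; apply.
by apply: filterS => x nx; rewrite mol_eq0// ltW.
Qed.

Let limit_eq0 (F : nat -> plane -> R) f : L1cvg F f ->
  (\forall n \near \oo, iint (F n) = 0) -> iint f = 0.
Proof.
move=> /L1cvg_iint cF F0; apply: (cvg_unique (@Rhausdorff R) cF).
apply: cvg_near_cst; exact: F0.
Qed.

(** The weak derivatives of f are tested on the partial derivatives of
    moll n u, whose mixed second derivatives coincide. *)
Let commuted n : test_function O (moll n u) ->
  (forall i, 'D_(dir i) (moll n u) = moll n (G i)) ->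
  forall (f g0 g1 : plane -> R), wder O 0 f g0 -> wder O 1 f g1 ->
  iint (fun z => g1 z * moll n (G 0) z) = iint (fun z => g0 z * moll n (G 1) z).
Proof.
move=> tn Dn f g0 g1 w0 w1; have [K bu] := BM_pull_bump bv.
have t0 : test_function O (moll n (G 0)) by rewrite -Dn; exact: test_function_partial.
have t1 : test_function O (moll n (G 1)) by rewrite -Dn; exact: test_function_partial.
have E1 := w1 _ t0; have E0 := w0 _ t1; apply: oppr_inj.
apply: (etrans (esym E1)); apply: (etrans _ E0).
have CC : 'D_(dir 1) (moll n (G 0)) = 'D_(dir 0) (moll n (G 1)).
  apply: (etrans (congr1 (fun f => 'D_(dir 1) f) (esym (Dn 0)))).
  apply: (etrans (esym (moll_partial_comm n bu))).
  exact: (congr1 (fun f => 'D_(dir 0) f) (Dn 1)).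
exact: (congr1 (fun k : plane -> R => iint (fun z => f z * k z)) CC).
Qed.

(** As P 0 * Q 1 - P 1 * Q 0 = 1 on S, (D_0 v) (p, q) is the Jacobian
    determinant of v (p, q) and q, and (D_1 v) (p, q) that of p and v (p, q).
    By commuted, such a determinant has integral 0. *)
Lemma iint_pull_partial j : iint (pull ('D_(dir j) v)) = 0.
Proof.
have [K0 B0] := BM_pull_bump (bump_like_partial 0 bv).
have [K1 B1] := BM_pull_bump (bump_like_partial 1 bv).
have [KG0 bG0] := BM_pull_grad 0; have [KG1 bG1] := BM_pull_grad 1.
have L i (g : plane -> R) KG : BM KG (G i) -> BM M g ->
    L1cvg (fun n z => g z * moll n (G i) z) (fun z => g z * G i z).
  by move=> bG bg; exact: L1cvgM (L1cvg_cst bg) (moll_cvg bG).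
have sub (f0 f1 : nat -> plane -> R) (g0 g1 : plane -> R) : L1cvg f0 g0 -> L1cvg f1 g1 ->
    L1cvg (fun n z => f0 n z - f1 n z) (fun z => g0 z - g1 z).
  move=> l0 l1; have [N [b0 bg0 _]] := l0; have [N' [b1 bg1 _]] := l1.
  have l1' : L1cvg (fun n z => - f1 n z) (fun z => - g1 z).
    apply: (@L1cvg_le _ _ _ _ _ 1 N' l1 (fun n => BMN (b1 n)) (BMN bg1)) => n z.
    by rewrite mul1r -opprD normrN.
  exact: L1cvgD l0 l1'.
have zero (f g0 g1 : plane -> R) : wder O 0 f g0 -> wder O 1 f g1 -> BM M g0 -> BM M g1 ->
    iint (fun z => g1 z * G 0 z - g0 z * G 1 z) = 0.
  move=> w0 w1 bg0 bg1; apply: (limit_eq0 (sub _ _ _ _ (L 0 _ _ bG0 bg1) (L 1 _ _ bG1 bg0))).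
  apply: filterS moll_pull_test => n [tn Dn].
  have [mg0 g0M _] := bg0; have [mg1 g1M _] := bg1.
  have [m0 h0 _] := BM_moll n bG0; have [m1 h1 _] := BM_moll n bG1.
  rewrite (iintB (BMMr bg1 m0 h0) (BMMr bg0 m1 h1)).
  by rewrite (commuted tn Dn w0 w1) subrr.
have [mP0 PM0 _] := bP 0; have [mP1 PM1 _] := bP 1.
have [mQ0 QM0 _] := bQ 0; have [mQ1 QM1 _] := bQ 1.
have [mG0 GM0 _] := bG0; have [mG1 GM1 _] := bG1.
have [->|->] := ord2_cases j.
- rewrite -(zero q (Q 0) (Q 1) (wq 0) (wq 1) (bQ 0) (bQ 1)).
  apply: (iint_ae B0 (BMB (BMMr (bQ 1) mG0 GM0) (BMMr (bQ 0) mG1 GM1))).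
  apply: ae_imp J1 => z J; rewrite /G /pull_grad.
  have [[-> nS]|[_ Sz]] := pull_cases ('D_(dir 0) v) z.
    have [[-> _]|[_ /nS//]] := pull_cases ('D_(dir 1) v) z.
    by rewrite !mul0r addr0 !mulr0 subr0.
  rewrite -[LHS]mulr1 -(J Sz); ring.
- have H := zero p (P 0) (P 1) (wp 0) (wp 1) (bP 0) (bP 1).
  apply: oppr_inj; rewrite oppr0 -H -(iintN B1).
  apply: (iint_ae (BMN B1) (BMB (BMMr (bP 1) mG0 GM0) (BMMr (bP 0) mG1 GM1))).
  apply: ae_imp J1 => z J; rewrite /G /pull_grad.
  have [[-> nS]|[_ Sz]] := pull_cases ('D_(dir 1) v) z.
    have [[-> _]|[_ /nS//]] := pull_cases ('D_(dir 0) v) z.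
    by rewrite !mul0r addr0 !mulr0 subr0 oppr0.
  rewrite -[LHS]mulr1 -(J Sz); ring.
Qed.

End OneFunction.

(** r is the square of the radius. *)
Definition disc (r : R) : set plane := [set z | z.1 ^+ 2 + z.2 ^+ 2 <= r].

Variables (r s : R).
Hypotheses (rs : r < s) (s1 : s <= 1) (sC : disc s `<=` C).

Let Phi z : plane := (p z, q z).

Lemma measurable_Phi : measurable_map Phi.
Proof. by apply: measurable_fun_pair; [case: bp|case: bq]. Qed.

(** The density, at the scale eps n, of the image under (p, q) of the area
    restricted to S. *)
Definition pushed_mass n : plane -> R := pint (mol n) Phi \1_S.

Lemma bump_like_mol_translate n w : bump_like (fun z => mol n (z - w)).
Proof.
have [sm [b mb]] := @bump_like_mol R n; split.
  by move=> k; exact: (Ck_translate (- w) (sm k)).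
exists (b + `|w|) => z bz; apply: mb; rewrite -(ltrD2r `|w|) (lt_le_trans bz)//.
by rewrite -{1}(subrK w z) ler_normD.
Qed.

Lemma disc_mol n w z : disc r w -> 6 * eps n <= s - r -> mol n (z - w) != 0 -> disc s z.
Proof.
move=> dw en; rewrite /disc/= in dw *; apply: contraNP => nz.
rewrite mol_eq0//; rewrite leNgt; apply/negP => zw; apply: nz.
have e1 := @eps_le1 R n; have e0 := @eps_gt0 R n.
have /ltW z1 := le_lt_trans (norm1_le (z - w)) zw.
have /ltW z2 := le_lt_trans (norm2_le (z - w)) zw.
have dw1 := le_trans dw (le_trans (ltW rs) s1).
have w1 : `|w.1| <= 1.
  rewrite -(@expr_le1 _ 2)// real_normK ?num_real// (le_trans _ dw1)//.
  by rewrite lerDl sqr_ge0.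
have w2 : `|w.2| <= 1.
  rewrite -(@expr_le1 _ 2)// real_normK ?num_real// (le_trans _ dw1)//.
  by rewrite lerDr sqr_ge0.
(* a square moves by at most 3 e on each axis, which explains the factor 6 *)
have step (a b e : R) : `|a - b| <= e -> `|b| <= 1 -> e <= 1 -> a ^+ 2 <= b ^+ 2 + 3 * e.
  rewrite !ler_norml => /andP[h1 h2] /andP[h3 h4] h5; nra.
have := step _ _ _ z1 w1 e1; have := step _ _ _ z2 w2 e1.
lra.
Qed.

Lemma is_derive_pushed_mass n w i : disc r w -> 6 * eps n <= s - r ->
  is_derive w (dir i) (pushed_mass n) 0.
Proof.
move=> dw en; have [K bS] := BM_indicS.
have D := is_derive_pint i w (@bump_like_mol R n) measurable_Phi bS.
apply: (is_derive_eq D); rewrite -[RHS]oppr0; congr (- _).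
have vC z : mol n (z - w) != 0 -> C z by move=> /(disc_mol dw en) /sC.
rewrite -(iint_pull_partial (bump_like_mol_translate n w) vC i).
by congr iint; apply/funext => z; rewrite /pull derive_translate mulrC.
Qed.

Lemma disc_axes w (t : R) : disc r w -> `|t| <= `|w.1| -> disc r (t, 0).
Proof.
rewrite /disc/= => dw tw; have := sqr_ge0 w.2.
have : t ^+ 2 <= w.1 ^+ 2.
  rewrite -(real_normK (num_real t)) -(real_normK (num_real w.1)).
  by rewrite ler_sqr ?nnegrE.
rewrite expr0n/=; lra.
Qed.

Lemma disc_axes2 w (t : R) : disc r w -> `|t| <= `|w.2| -> disc r (w.1, t).
Proof.
rewrite /disc/= => dw tw; have : t ^+ 2 <= w.2 ^+ 2.
  rewrite -(real_normK (num_real t)) -(real_normK (num_real w.2)).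
  by rewrite ler_sqr ?nnegrE.
lra.
Qed.

Lemma line_constant (g : plane -> R) z i (t : R) :
  (forall x : R, `|x| <= `|t| -> is_derive (z + x *: dir i) (dir i) g 0) ->
  g (z + t *: dir i) = g z.
Proof.
move=> dg; pose l := fun x : R => g (z + x *: dir i).
have dl (x : R) : `|x| <= `|t| -> is_derive x 1 l 0.
  move=> xt; have [D1 D2] := dg x xt.
  by apply: DeriveDef; [apply/derivable_line|rewrite derive_line].
have cl (a b : R) : (forall x, x \in `[a, b] -> `|x| <= `|t|) -> {within `[a, b], continuous l}.
  move=> ab; apply: derivable_within_continuous => x /ab /dl [].
  by [].
have l0 : l 0 = g z by rewrite /l scale0r addr0.
rewrite -l0 -[LHS]/(l t).
have [t0|t0] := leP 0 t.
  have B x : x \in `[0, t] -> `|x| <= `|t|.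
    by rewrite in_itv/= => /andP[x0 xt]; rewrite !ger0_norm.
  have [c _ H] := MVT_segment t0 (fun x xi => dl x (B x (subset_itv_oo_cc xi))) (cl _ _ B).
  by apply/eqP; rewrite -subr_eq0 H mul0r.
have B x : x \in `[t, 0] -> `|x| <= `|t|.
  by rewrite in_itv/= => /andP[x0 xt]; rewrite ler0_norm// ltr0_norm// lerN2.
have [c _ H] := MVT_segment (ltW t0) (fun x xi => dl x (B x (subset_itv_oo_cc xi))) (cl _ _ B).
by apply/eqP; rewrite eq_sym -subr_eq0 H mul0r.
Qed.

(** The gradient vanishes on disc r by iint_pull_partial, and w is joined to 0
    inside disc r by a vertical and a horizontal segment. *)
Lemma pushed_mass_cst n w : disc r w -> 6 * eps n <= s - r ->
  pushed_mass n w = pushed_mass n 0.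
Proof.
move=> dw en.
have E1 (t : R) : 0 + t *: dir 0 = (t, 0) :> plane.
  by rewrite add0r [RHS]dirE /= scale0r addr0.
have E2 (t : R) : (w.1, 0) + t *: dir 1 = (w.1, t) :> plane.
  by rewrite [RHS]dirE [X in X + _ = _]dirE /= scale0r addr0.
have H1 : pushed_mass n (w.1, 0) = pushed_mass n 0.
  rewrite -E1; apply: line_constant => x xw; rewrite E1.
  by apply: is_derive_pushed_mass => //; exact: (disc_axes dw xw).
have H2 : pushed_mass n (w.1, w.2) = pushed_mass n (w.1, 0).
  rewrite -{1}E2; apply: line_constant => x xw; rewrite E2.
  by apply: is_derive_pushed_mass => //; exact: (disc_axes2 dw xw).
by case: w {E2 dw} H1 H2 => x y /= -> ->.
Qed.

(** By Tonelli, the left side is the integral of h against pushed_mass n. *)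
Lemma iint_pull_moll n h B : BM B h -> continuous h -> (forall z, 0 <= h z) ->
  (forall z, h z != 0 -> disc r z) -> 6 * eps n <= s - r ->
  iint (pull (moll n h)) = pushed_mass n 0 * iint h.
Proof.
move=> bh ch h0 hr en; have [K bS] := BM_indicS.
have bm := @bump_like_mol R n; have [Km bKm] := bump_like_BM bm.
have cm := smooth_continuous bm.1.
have mh : measurable_fun [set: mplane] h by case: bh.
have mS1 : measurable_fun [set: mplane] (\1_S : plane -> R) by case: bS.
pose H (x : mplane * mplane) : \bar R :=
  (\1_S x.1 * (mol n (Phi x.1 - x.2) * h x.2))%:E.
have mH : measurable_fun setT H.
  apply/measurable_EFinP; apply: measurable_funM.
    exact: (measurableT_comp mS1 (@measurable_fst _ _ mplane mplane)).
  apply: measurable_funM; last first.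
    exact: (measurableT_comp mh (@measurable_snd _ _ mplane mplane)).
  have mp : measurable_fun [set: mplane] p by case: bp.
  have mq : measurable_fun [set: mplane] q by case: bq.
  pose d (x : mplane * mplane) : mplane := (p x.1 - x.2.1, q x.1 - x.2.2).
  have md : measurable_fun setT d.
    have m1 := measurableT_comp mp (@measurable_fst _ _ mplane mplane).
    have m2 := measurableT_comp mq (@measurable_fst _ _ mplane mplane).
    have m21 := measurableT_comp (@measurable_fst _ _ Rm Rm) (@measurable_snd _ _ mplane mplane).
    have m22 := measurableT_comp (@measurable_snd _ _ Rm Rm) (@measurable_snd _ _ mplane mplane).
    exact: (measurable_fun_pair (measurable_funB m1 m21) (measurable_funB m2 m22)).
  exact: (measurableT_comp (continuous_measurable2 cm) md).
have H0 x : (0 <= H x)%E by rewrite lee_fin mulr_ge0// mulr_ge0 ?mol_ge0//; exact: h0.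
have [Kp bpull] : exists K, BM K (pull (moll n h)).
  have [_ hB _] := BM_moll n bh.
  exact: (BM_pull_ex (smooth_continuous (smooth_moll n bh)) hB).
apply: EFin_inj; rewrite -(iint_EFin bpull) -(iintZ _ bh) -(iint_EFin (BMZ _ bh)).
transitivity (\int[area]_z \int[area]_w H (z, w))%E.
  apply: eq_integral => z _.
  have [Kz bz] := BM_moll_integrand n (Phi z) bh.
  rewrite /pull /moll /pint -(iintZ _ bz) -(iint_EFin (BMZ _ bz)).
  by apply: eq_integral => w _; rewrite /H/= mol_sym.
rewrite (tonelli_area mH H0); apply: eq_integral => w _.
have bw := BM_pint w bKm cm measurable_Phi bS.
transitivity (iint (fun z => h w * (mol n (Phi z - w) * \1_S z)))%:E.
  rewrite -(iint_EFin (BMZ _ bw)); apply: eq_integral => z _.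
  by rewrite /H/=; congr EFin; ring.
rewrite (iintZ _ bw) mulrC.
have [->|hw] := eqVneq (h w) 0; first by rewrite !mulr0.
by rewrite -(pushed_mass_cst (hr _ hw) en).
Qed.

Lemma cvg_iint_pull_moll h B : BM B h -> continuous h ->
  iint (pull (moll n h)) @[n --> \oo] --> iint (pull h).
Proof.
move=> bh ch; have [K HK] := BM_pull.
have [_ hB _] := bh; have B0 := BM_ge0 bh.
have B1 : B <= B + 1 by rewrite lerDl.
apply: L1cvg_iint; apply: (@L1cvg_unif _ _ _ (Num.max K (K * (B + 1)))).
- move=> n; have [_ hBn _] := BM_moll n bh.
  exact: (HK _ _ (smooth_continuous (smooth_moll n bh)) hBn).
- by apply: HK => // z; exact: le_trans (hB z) B1.
move=> e e0; have U := moll_unif bh (compact_box (M := B + 1)) (fun z _ => ch z) e0.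
apply: filterS U => n U z.
have Uz w : `|moll n h w - h w| <= e.
  have [wB|Bw] := leP `|w| (B + 1); first exact: U.
  have [_ _ ->//] := BM_moll n bh.
  have [_ _ ->//] := bh; last exact: le_lt_trans Bw.
  by rewrite subrr normr0 ltW.
rewrite /pull -mulrBr normrM (le_trans _ (Uz (p z, q z)))// ler_piMl//.
exact: indic_le1.
Qed.

(** Replacing h1 and h2 by their mollifications, both sides become
    pushed_mass n 0 * iint h1 * iint h2. *)
Lemma pull_proportional h1 h2 B : BM B h1 -> BM B h2 ->
  continuous h1 -> continuous h2 -> (forall z, 0 <= h1 z) -> (forall z, 0 <= h2 z) ->
  (forall z, h1 z != 0 -> disc r z) -> (forall z, h2 z != 0 -> disc r z) ->
  iint (pull h1) * iint h2 = iint (pull h2) * iint h1.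
Proof.
move=> b1 b2 c1 c2 p1 p2 d1 d2.
have L1 : iint (pull (moll n h1)) * iint h2 @[n --> \oo] --> iint (pull h1) * iint h2.
  by apply: cvgM; [exact: (cvg_iint_pull_moll b1)|exact: cvg_cst].
have L2 : iint (pull (moll n h2)) * iint h1 @[n --> \oo] --> iint (pull h2) * iint h1.
  by apply: cvgM; [exact: (cvg_iint_pull_moll b2)|exact: cvg_cst].
have E : \forall n \near \oo, iint (pull (moll n h1)) * iint h2 = iint (pull (moll n h2)) * iint h1.
  have sr : 0 < (s - r) / 6 by rewrite divr_gt0// subr_gt0.
  apply: filterS (@eps_small R _ sr) => n en.
  have en6 : 6 * eps n <= s - r by rewrite mulrC -ler_pdivlMr// ltW.
  by rewrite (iint_pull_moll b1 c1 p1 d1 en6) (iint_pull_moll b2 c2 p2 d2 en6); ring.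
apply: (cvg_unique (@Rhausdorff R) _ L2).
apply: cvg_trans L1; apply: near_eq_cvg.
apply: filterS E => n En; exact: En.
Qed.

End PullBack.

(** * The Beltrami equation as an isometry *)

Section Beltrami.
Context {R : realType}.
Implicit Types (B D : 'M[R]_2).

Local Open Scope complex_scope.

(** The real and imaginary parts of the Beltrami equation, multiplied by the
    denominator of the coefficient. *)
Lemma beltrami_real B D : \det (1%:M + B) != 0 ->
  dzbar D = beltrami_coef B * dz D ->
  [/\ (D 0 0 - D 1 1) * \det (1%:M + B) =
        (B 1 1 - B 0 0) * (D 0 0 + D 1 1) + 2 * B 0 1 * (D 1 0 - D 0 1) &
      (D 1 0 + D 0 1) * \det (1%:M + B) =
        (B 1 1 - B 0 0) * (D 1 0 - D 0 1) - 2 * B 0 1 * (D 0 0 + D 1 1)].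
Proof.
rewrite /dzbar /beltrami_coef /dz; set d := \det _ => d0 H.
have dC : d%:C != 0 :> R[i] by rewrite eq_complex/= negb_and d0.
have H2 : (dx D + 'i * dy D) * d%:C =
    ((B 1 1)%:C - (B 0 0)%:C - 2 * 'i * (B 0 1)%:C) * (dx D - 'i * dy D).
  have E : dx D + 'i * dy D =
      2 * (((B 1 1)%:C - (B 0 0)%:C - 2 * 'i * (B 0 1)%:C) / d%:C * ((dx D - 'i * dy D) / 2)).
    by rewrite -H [RHS]mulrC divfK// pnatr_eq0.
  rewrite E; field.
  by rewrite dC.
move: H2; rewrite /dx /dy => /eqP; rewrite eq_complex/= => /andP[/eqP H3 /eqP H4].
by split; lra.
Qed.

Local Close Scope complex_scope.

Lemma det22 (B : 'M[R]_2) : \det B = B 0 0 * B 1 1 - B 0 1 * B 1 0.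
Proof.
rewrite (expand_det_row _ ord0) !big_ord_recl big_ord0 addr0 /cofactor/=.
rewrite !det_mx11 !mxE/= expr0 expr1 mul1r mulN1r mulrN.
have -> : lift ord0 0 = 1 :> 'I_2 by apply: val_inj.
by have -> : lift 1 0 = 0 :> 'I_2 by apply: val_inj.
Qed.

Lemma dotE (B : 'M[R]_2) (x : 'cV[R]_2) : B^T = B ->
  dot (B *m x) x = B 0 0 * x 0 0 ^+ 2 + 2 * B 0 1 * (x 0 0 * x 1 0) + B 1 1 * x 1 0 ^+ 2.
Proof.
move=> BT; have B10 : B 1 0 = B 0 1 by rewrite -{1}BT mxE.
rewrite /dot !big_ord_recl big_ord0 !mxE !big_ord_recl !big_ord0.
have -> : lift ord0 ord0 = 1 :> 'I_2 by apply: val_inj.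
by rewrite (_ : ord0 = 0)// B10; ring.
Qed.

(** Here a, b, c are the entries of the symmetric matrix B, and p, q are the
    rows of D.  In this form the Beltrami equation says that B maps each row of
    D to the other one, rotated by a quarter turn: the two components of the
    mapping are conjugate for B. *)
Lemma beltrami_rows (a b c p0 p1 q0 q1 d : R) : 0 < a -> 0 < c -> a * c - b ^+ 2 = 1 ->
  d = (1 + a) * (1 + c) - b ^+ 2 ->
  (p0 - q1) * d = (c - a) * (p0 + q1) + 2 * b * (q0 - p1) ->
  (q0 + p1) * d = (c - a) * (q0 - p1) - 2 * b * (p0 + q1) ->
  [/\ a * p0 + b * p1 = q1, b * p0 + c * p1 = - q0,
      a * q0 + b * q1 = - p1 & b * q0 + c * q1 = p0].
Proof.
move=> a0 c0 ac dE.
have {}dE : d = 2 + a + c by rewrite dE; lra.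
rewrite dE => H1 H2.
(* the defects of the four conclusions; the hypotheses give X = T and Y = - Z, and
   with a c - b^2 = 1 also (2 + a + c) X = 0, then (1 + a) Y = 0 *)
pose X := a * p0 + b * p1 - q1; pose Y := b * p0 + c * p1 + q0.
pose Z := a * q0 + b * q1 + p1; pose T := b * q0 + c * q1 - p0.
have XT : X = T by rewrite /X /T; lra.
have YZ : Y = - Z by rewrite /Y /Z; lra.
have E1 : c * X - b * Y = - T.
  have -> : c * X - b * Y = (a * c - b ^+ 2) * p0 - c * q1 - b * q0 by rewrite /X /Y; ring.
  by rewrite ac /T; ring.
have E2 : a * Y - b * X = Z.
  have -> : a * Y - b * X = (a * c - b ^+ 2) * p1 + a * q0 + b * q1 by rewrite /X /Y; ring.
  by rewrite ac /Z; ring.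
have X0 : X = 0.
  have : (2 + a + c) * X = 0.
    have -> : (2 + a + c) * X = (1 + a) * (c * X - b * Y + X) - (a * c - b ^+ 2 - 1) * X
      + b * (a * Y - b * X + Y) by ring.
    by rewrite ac E1 E2 XT YZ; ring.
  by move=> /eqP; rewrite mulf_eq0 => /orP[/eqP|/eqP//]; lra.
have Y0 : Y = 0.
  have : (1 + a) * Y = 0.
    have -> : (1 + a) * Y = (a * Y - b * X + Y) + b * X by ring.
    by rewrite E2 YZ X0; ring.
  by move=> /eqP; rewrite mulf_eq0 => /orP[/eqP|/eqP//]; lra.
by split; move: X0 Y0 XT YZ; rewrite /X /Y /Z /T; lra.
Qed.

(** By beltrami_rows the form of B on the combinations of the rows of D is
    det D times the Euclidean form.  Positivity of B then excludes
    det D = -1, and the lower ellipticity bound limits the size of D. *)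
Lemma beltrami_isometry (K : R) B D : 1 <= K -> B^T = B -> \det B = 1 ->
  (forall xi : 'cV[R]_2, K^-1 * dot xi xi <= dot (B *m xi) xi <= K * dot xi xi) ->
  `|\det D| = 1 -> dzbar D = beltrami_coef B * dz D ->
  [/\ D 0 0 * D 1 1 - D 0 1 * D 1 0 = 1,
      forall x y : R, B 0 0 * (x * D 0 0 + y * D 1 0) ^+ 2 +
         2 * B 0 1 * ((x * D 0 0 + y * D 1 0) * (x * D 0 1 + y * D 1 1)) +
         B 1 1 * (x * D 0 1 + y * D 1 1) ^+ 2 = x ^+ 2 + y ^+ 2
      & forall i j, `|D i j| <= K].
Proof.
move=> K1 BT detB ell detD bel.
have B10 : B 1 0 = B 0 1 by rewrite -{1}BT mxE.
have K0 : 0 < K by lra.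
pose V (x y : R) : 'cV[R]_2 := \col_j (if j == 0 then x else y).
have VE (x y : R) : dot (V x y) (V x y) = x ^+ 2 + y ^+ 2.
  rewrite /dot !big_ord_recl big_ord0 !mxE/=; ring.
have form (x y : R) : K^-1 * (x ^+ 2 + y ^+ 2) <=
    B 0 0 * x ^+ 2 + 2 * B 0 1 * (x * y) + B 1 1 * y ^+ 2 <= K * (x ^+ 2 + y ^+ 2).
  by have := ell (V x y); rewrite (dotE _ BT) VE !mxE.
rewrite det22 B10 -expr2 in detB.
have Ki : 0 < K^-1 by rewrite invr_gt0.
have [a1 a2] : K^-1 <= B 0 0 /\ B 0 0 <= K.
  by have /andP := form 1 0; rewrite !(expr1n, expr0n)/=; lra.
have [c1 c2] : K^-1 <= B 1 1 /\ B 1 1 <= K.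
  by have /andP := form 0 1; rewrite !(expr1n, expr0n)/=; lra.
have a0 : 0 < B 0 0 by lra.
have c0 : 0 < B 1 1 by lra.
have dE : \det (1%:M + B) = (1 + B 0 0) * (1 + B 1 1) - B 0 1 ^+ 2.
  by rewrite det22 !mxE/= B10 !add0r -expr2.
have d0 : \det (1%:M + B) != 0.
  have -> : \det (1%:M + B) = 2 + B 0 0 + B 1 1 by rewrite dE; lra.
  by rewrite gt_eqF//; lra.
have [H1 H2] := beltrami_real d0 bel.
have [E1 E2 E3 E4] := beltrami_rows a0 c0 detB dE H1 H2.
rewrite det22 in detD.
set J := D 0 0 * D 1 1 - D 0 1 * D 1 0 in detD *.
have formE x y : B 0 0 * (x * D 0 0 + y * D 1 0) ^+ 2 +
         2 * B 0 1 * ((x * D 0 0 + y * D 1 0) * (x * D 0 1 + y * D 1 1)) +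
         B 1 1 * (x * D 0 1 + y * D 1 1) ^+ 2 = J * (x ^+ 2 + y ^+ 2).
  set G0 := x * D 0 0 + y * D 1 0; set G1 := x * D 0 1 + y * D 1 1.
  have X0 : B 0 0 * G0 + B 0 1 * G1 = x * D 1 1 - y * D 0 1.
    have -> : B 0 0 * G0 + B 0 1 * G1 = x * (B 0 0 * D 0 0 + B 0 1 * D 0 1) +
      y * (B 0 0 * D 1 0 + B 0 1 * D 1 1) by rewrite /G0 /G1; ring.
    by rewrite E1 E3; ring.
  have X1 : B 0 1 * G0 + B 1 1 * G1 = - x * D 1 0 + y * D 0 0.
    have -> : B 0 1 * G0 + B 1 1 * G1 = x * (B 0 1 * D 0 0 + B 1 1 * D 0 1) +
      y * (B 0 1 * D 1 0 + B 1 1 * D 1 1) by rewrite /G0 /G1; ring.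
    by rewrite E2 E4; ring.
  transitivity (G0 * (B 0 0 * G0 + B 0 1 * G1) + G1 * (B 0 1 * G0 + B 1 1 * G1)).
    ring.
  by rewrite X0 X1 /J /G0 /G1; ring.
have JJ : J = 1.
  have J0 : 0 <= J.
    have /andP[+ _] := form (D 0 0) (D 0 1).
    have := formE 1 0; rewrite !mul1r !mul0r !addr0 expr1n expr0n/= addr0 mulr1 => ->.
    by apply: le_trans; rewrite mulr_ge0 ?(ltW Ki)// addr_ge0 ?sqr_ge0.
  by move: detD; rewrite ger0_norm.
have Dbound x y : (x * D 0 0 + y * D 1 0) ^+ 2 + (x * D 0 1 + y * D 1 1) ^+ 2 <= K * (x ^+ 2 + y ^+ 2).
  have /andP[+ _] := form (x * D 0 0 + y * D 1 0) (x * D 0 1 + y * D 1 1).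
  by rewrite formE JJ mul1r ler_pdivrMl.
have sqb (x : R) : x ^+ 2 <= K -> `|x| <= K.
  move=> xK; rewrite -ler_sqr ?nnegrE ?(ltW K0)// real_normK ?num_real//.
  by rewrite (le_trans xK)// expr2 ler_peMr// (ltW K0).
split=> //.
- by move=> x y; rewrite formE JJ mul1r.
- move=> i j; apply: sqb.
  have := Dbound 1 0; have := Dbound 0 1; rewrite !(mul1r, mul0r, addr0, add0r, expr1n, expr0n)/=.
  rewrite !(addr0, add0r, mulr1).
  have := sqr_ge0 (D 0 0); have := sqr_ge0 (D 0 1); have := sqr_ge0 (D 1 0); have := sqr_ge0 (D 1 1).
  by have [->|->] := ord2_cases i; have [->|->] := ord2_cases j; lra.
Qed.

End Beltrami.

(** * Test functions in the Rayleigh quotient *)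

Section Energy.
Import HBNNSimple.
Context {R : realType}.
Local Notation plane := (R * R)%type.
Local Notation Rm := (measurableTypeR R).
Local Notation mplane := (Rm * Rm)%type.
Local Notation area := (@lebesgue_measure R \x @lebesgue_measure R)%E.
Implicit Types (f g h v eta : plane -> R) (z w : plane) (O : set plane).

Lemma integral_supported O f M : BM M f -> (forall z, ~ O z -> f z = 0) ->
  (\int[area]_(z in O) (f z)%:E = (iint f)%:E)%E.
Proof.
move=> bf f0; rewrite -(iint_EFin bf) integral_mkcond; congr integral.
apply/funext => z; rewrite patchE; case: ifPn => // /negP.
by rewrite inE => /f0 ->.
Qed.

Lemma BM_Lloc1 O f M : BM M f -> Lloc 1 O f.
Proof.
move=> bf C cC CO; split; first by case: bf => mf _ _; exact: measurable_funTS.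
have mC := compact_measurable2 cC.
have H : (\int[area]_z (`|f z|)%:E < +oo)%E.
  by rewrite (iint_EFin (BM_norm bf)) ltry.
apply: le_lt_trans H.
have -> : (fun z => (`|f z| ^+ 1)%:E) = (fun z => (`|f z|)%:E).
  by apply/funext => z; rewrite expr1.
apply: ge0_subset_integral => //.
by apply/measurable_EFinP; case: (BM_norm bf).
Qed.

Lemma test_BM O eta : test_function O eta -> exists M, BM M eta.
Proof.
move=> te; have [se [r e0]] := test_function_bump_like te.
by apply: (BM_continuous (r := r)) e0; exact: smooth_continuous.
Qed.

Lemma BM_sqr f M : BM M f -> exists N, BM N (fun z => f z ^+ 2).
Proof.
move=> bf; have := bf; case=> mf fM _; eexists; exact: (BMMr bf mf fM).
Qed.

Lemma sq_L2norm_test O eta : test_function O eta ->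
  sq_L2norm O eta = (iint (fun z => eta z ^+ 2))%:E.
Proof.
move=> te; have [M bM] := test_BM te; have [N bN] := BM_sqr bM.
rewrite -(integral_supported (O := O) bN).
  by apply: eq_integral => z _; rewrite real_normK// num_real.
by move=> z /(test_function_eq0 te) ->; rewrite expr0n.
Qed.

Lemma dot0 (B : 'M[R]_2) : dot (B *m 0) 0 = 0.
Proof. by rewrite /dot big1// => i _; rewrite !mxE mulr0. Qed.

Lemma test_function_W12_0 A O eta : test_function O eta ->
  W12_0 A O eta (grad eta).
Proof.
move=> te; have be := test_function_bump_like te; have [se _] := be.
have ce := smooth_continuous se.
have [M bM] := test_BM te.
split.
- by case: bM => + _ _ => /(@measurable_funTS _ _ _ _ O); exact.
- by rewrite (sq_L2norm_test te) ltry.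
- move=> i; have tD := test_function_partial i te; have [N bN] := test_BM tD.
  have -> : (fun z => grad eta z i 0) = 'D_(dir i) eta by apply/funext => z; rewrite mxE.
  split; [exact: BM_Lloc1 bM|exact: BM_Lloc1 bN|move=> k tk].
  have [L bL] := test_BM tk; have tDk := test_function_partial i tk.
  have [L' bL'] := test_BM tDk.
  have [mL kL _] := bL; have [mL' kL' _] := bL'.
  rewrite (integral_supported (BMMr bM mL' kL')); last first.
    by move=> z /(test_function_eq0 te) ->; rewrite mul0r.
  rewrite (integral_supported (BMMr bN mL kL)); last first.
    by move=> z /(test_function_eq0 tD) ->; rewrite mul0r.
  rewrite (iint_by_parts (test_function_bump_like tk))//.
  + by move=> z; exact: smooth_derivable.
  + by apply: smooth_continuous; exact: smooth_partial.
- move=> e e0; exists eta => //; rewrite /W12_norm.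
  have -> : sq_L2norm O (fun z => eta z - eta z) = 0%E.
    by apply: integral0_eq => z _; rewrite subrr normr0 expr0n.
  have -> : energy A O (fun z => grad eta z - grad eta z) = 0%E.
    by apply: integral0_eq => z _; rewrite subrr dot0.
  by rewrite poweR0r ?invr_neq0// adde0 lte_fin.
Qed.

Lemma lambda1_le_test A O eta : test_function O eta ->
  0 < iint (fun z => eta z ^+ 2) ->
  (lambda1 A O <= energy A O (grad eta) / (iint (fun z => eta z ^+ 2))%:E)%E.
Proof.
move=> te e0; apply: ereal_inf_lbound; exists eta, (grad eta).
split; [exact: test_function_W12_0| |by rewrite (sq_L2norm_test te)].
move=> ae0; have [M bM] := test_BM te; have [N bN] := BM_sqr bM.
have b0 : BM 0 (fun=> 0 : R) by split=> // z; rewrite normr0.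
move: e0; rewrite (@iint_ae _ _ _ _ (fun=> 0) bN b0) ?iint0 ?ltxx//.
apply: ae_imp ae0 => z H.
have [/H ->|/(test_function_eq0 te) ->] := pselect (O z); by rewrite expr0n.
Qed.

(** This holds for f that are not measurable, such as the energy densities of
    A: the integral of the positive part is a supremum over simple functions,
    each of which is compared with g. *)
Lemma integral_le_iint O f g M : BM M g -> (forall z, 0 <= g z) ->
  ae_on O (fun z => f z <= g z) -> (\int[area]_(z in O) (f z)%:E <= (iint g)%:E)%E.
Proof.
move=> bg g0 fg; rewrite integralE -(iint_EFin bg).
have mg : measurable_fun [set: mplane] (fun z => (g z)%:E).
  by apply/measurable_EFinP; case: bg.
apply: (@le_trans _ _ (\int[area]_(z in O) ((EFin \o f)^\+%E z))%E).
  by rewrite -[leRHS]sube0; apply: leeB => //; exact: integral_ge0.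
rewrite ge0_integralE//; apply: ge_ereal_sup => _ [h hf <-].
rewrite -integralT_nnsfun; apply: ae_ge0_le_integral => //.
- by move=> z _; rewrite lee_fin; exact: fun_ge0.
- by apply/measurable_EFinP; exact: measurable_funP.
- by move=> z _; rewrite lee_fin.
apply: ae_imp fg => z fg _; apply: (le_trans (hf z)); rewrite patchE.
case: ifPn => [|_]; last by rewrite lee_fin.
by rewrite inE => /fg fgz; rewrite funeposE/= ge_max !lee_fin fgz g0.
Qed.

End Energy.

(** * Transplantation of test functions from the disc *)

Section Chart.
Context {R : realType}.
Local Notation plane := (R * R)%type.
Local Notation Rm := (measurableTypeR R).
Local Notation mplane := (Rm * Rm)%type.
Local Notation area := (@lebesgue_measure R \x @lebesgue_measure R)%E.
Implicit Types (f g h v eta : plane -> R) (z w : plane) (n : nat) (i j : 'I_2).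

Lemma lte_fin_between (x : R) (y : \bar R) : (x%:E < y)%E ->
  exists2 l : R, x < l & (l%:E <= y)%E.
Proof.
case: y => [l| |]//; first by rewrite lte_fin => xl; exists l.
by exists (x + 1); rewrite ?ltrDl ?ltr01 ?leey.
Qed.

Definition sqgrad v z : R := 'D_(dir 0) v z ^+ 2 + 'D_(dir 1) v z ^+ 2.

Definition sqnorm z : R := z.1 ^+ 2 + z.2 ^+ 2.

Lemma continuous_sqnorm : continuous (sqnorm : plane -> R).
Proof.
by move=> z; apply: cvgD; apply: cvgM; (exact: cvg_fst || exact: cvg_snd).
Qed.

Lemma disc_coord_le1 r z : r <= 1 -> disc r z -> `|z.1| <= 1 /\ `|z.2| <= 1.
Proof.
move=> r1 dz; have {}dz : z.1 ^+ 2 + z.2 ^+ 2 <= 1 by exact: le_trans dz r1.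
by move: z.1 z.2 dz => x y dz; split; rewrite ler_norml; apply/andP; split; nra.
Qed.

Lemma compact_disc r : r <= 1 -> compact (disc r : set plane).
Proof.
move=> r1; apply: (subclosed_compact _ (@compact_box R 1)).
  rewrite (_ : disc r = sqnorm @^-1` [set x | x <= r])//.
  apply: preimage_closed; last exact: closed_le.
  by move=> z _; exact: continuous_sqnorm.
by move=> z /(disc_coord_le1 r1)[h1 h2] /=; rewrite prod_normE ge_max h1.
Qed.

Lemma BM_restrict (W : set plane) f (B N : R) : compact W -> measurable_fun (W : set mplane) f ->
  0 <= B -> (forall z, W z -> `|z| <= N) -> (forall z, W z -> `|f z| <= B) ->
  BM (Num.max N B) (f \_ W).
Proof.
move=> cW mf B0 WN fB; split=> [|z|z].
- by apply/(measurable_restrictT f (compact_measurable2 cW)).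
- rewrite patchE; case: ifPn => [|_]; last by rewrite normr0 le_max B0 orbT.
  by rewrite inE => /fB fz; rewrite le_max fz orbT.
- rewrite gt_max => /andP[Nz _]; rewrite patchE ifF//; apply/negP.
  by rewrite inE => /WN; rewrite leNgt Nz.
Qed.

Variables (K : R) (Omega : set plane) (A : plane -> 'M[R]_2).
Variables (phi psi : plane -> plane) (Dphi : plane -> 'M[R]_2).
Hypotheses (K1 : 1 <= K) (oOmega : open Omega) (hA : M22 K Omega A).
Hypothesis homeo : homeomorphism_between Omega (unit_disc R) phi psi.
Hypothesis wd : weak_diff Omega phi Dphi.
Hypothesis bel :
  ae_on Omega (fun z => dzbar (Dphi z) = beltrami_coef (A z) * dz (Dphi z)).
Hypothesis vol : ae_on Omega (fun z => `|\det (Dphi z)| = 1).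

(** beltrami_isometry, solved for the form of A: its value at xi is the squared
    length of the inverse transpose of Dphi applied to xi. *)
Lemma chart_isometry : ae_on Omega (fun z =>
  [/\ Dphi z 0 0 * Dphi z 1 1 - Dphi z 0 1 * Dphi z 1 0 = 1,
      forall i j, `|Dphi z i j| <= K &
      forall xi : 'cV[R]_2, dot (A z *m xi) xi =
        (Dphi z 1 1 * xi 0 0 - Dphi z 1 0 * xi 1 0) ^+ 2 +
        (Dphi z 0 0 * xi 1 0 - Dphi z 0 1 * xi 0 0) ^+ 2]).
Proof.
have [_ sA dA eA] := hA.
apply: ae_imp (ae_and (ae_and dA eA) (ae_and bel vol)) => z [[d e] [b v]] Oz.
have AT := sA _ Oz.
have [D1 F DK] := beltrami_isometry K1 AT (d Oz) (e Oz) (v Oz) (b Oz).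
split=> // xi; rewrite (dotE _ AT).
set x := Dphi z 1 1 * xi 0 0 - Dphi z 1 0 * xi 1 0.
set y := Dphi z 0 0 * xi 1 0 - Dphi z 0 1 * xi 0 0.
rewrite -(F x y).
have -> : x * Dphi z 0 0 + y * Dphi z 1 0 = xi 0 0.
  by rewrite -[RHS]mul1r -D1 /x /y; ring.
have -> : x * Dphi z 0 1 + y * Dphi z 1 1 = xi 1 0.
  by rewrite -[RHS]mul1r -D1 /x /y; ring.
by [].
Qed.

(** The test function v lives in disc r with r < s < t < 1.  The preimages S and
    W of disc s and disc t are compact, and the open set O lies between them.
    On W everything is bounded, O carries the weak derivatives, and S contains
    the supports of the pull-backs. *)

Section Radii.
Variables (s t : R).
Hypotheses (st : s < t) (t1 : t < 1).

Let W := psi @` disc t.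
Let S := psi @` disc s.
Let O := [set z | Omega z /\ sqnorm (phi z) < t].
Let C : set plane := disc s.

Let disc_unit r : r < 1 -> disc r `<=` unit_disc R.
Proof. by move=> r1 z dz; exact: le_lt_trans dz r1. Qed.

Lemma compact_preimage_disc r : r < 1 -> compact (psi @` disc r).
Proof.
move=> r1; have [_ _ _ _ cpsi] := homeo.
apply: continuous_compact; last exact: (compact_disc (ltW r1)).
exact: (continuous_subspaceW (disc_unit r1) cpsi).
Qed.

Lemma preimage_discP r z : r < 1 -> (psi @` disc r) z <-> Omega z /\ disc r (phi z).
Proof.
move=> r1; have [_ hp [pK pK'] _ _] := homeo.
split=> [[w dw <-]|[Oz dz]]; last by exists (phi z) => //; exact: pK.
by have uw := disc_unit r1 dw; rewrite pK'//; split=> //; exact: hp.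
Qed.

Lemma chart_continuous z : Omega z -> {for z, continuous phi}.
Proof.
move=> Oz; have [_ _ _ cphi _] := homeo.
by move: cphi; rewrite continuous_open_subspace// => /(_ z); apply; rewrite inE.
Qed.

Lemma open_chart : open O.
Proof.
rewrite openE => z [Oz zt]; rewrite /interior/=.
have nO : nbhs z Omega by exact: open_nbhs_nbhs.
have cs : {for z, continuous (sqnorm \o phi)}.
  by apply: continuous_comp; [exact: chart_continuous|exact: continuous_sqnorm].
have nt : nbhs z [set w | sqnorm (phi w) < t].
  exact: (cs [set x | x < t] (open_nbhs_nbhs (conj (@open_lt _ t) zt))).
exact: filterI nO nt.
Qed.

Lemma chart_subset : O `<=` W.
Proof.
by move=> z [Oz zt]; apply/preimage_discP => //; split=> //; exact: ltW.
Qed.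

Let SO : S `<=` O.
Proof.
move=> z /(preimage_discP _ (lt_trans st t1))[Oz dz]; split=> //.
exact: le_lt_trans dz st.
Qed.

(** Dphi is bounded by K off a null set only; clamping its entries makes them
    bounded everywhere without changing the weak derivative. *)
Definition clamp (x : R) : R := Num.max (- K) (Num.min K x).

Let chart k : plane -> R := component phi k \_ W.
Let dchart k i : plane -> R := (fun z => clamp (Dphi z k i)) \_ W.

Let K0 : 0 <= K. Proof. exact: le_trans K1. Qed.

Lemma norm_clamp x : `|clamp x| <= K.
Proof.
rewrite ler_norml /clamp le_max lexx/= ge_max.
by rewrite ge_min lexx/= andbT ge0_cp.
Qed.

Lemma clamp_id x : `|x| <= K -> clamp x = x.
Proof.
by rewrite ler_norml => /andP[h1 h2]; rewrite /clamp (min_idPr h2) (max_idPr h1).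
Qed.

Let WP z : W z <-> Omega z /\ disc t (phi z).
Proof. exact: preimage_discP. Qed.

Let cW : compact W. Proof. exact: compact_preimage_disc. Qed.

Let WO : W `<=` Omega.
Proof. by move=> z /WP[]. Qed.

Lemma BM_chart : exists M, (forall k, BM M (chart k)) /\ (forall k i, BM M (dchart k i)).
Proof.
have [N [_ HN]] := compact_bounded cW.
have WN z : W z -> `|z| <= N + 1 by apply: HN; rewrite ltrDl.
exists (Num.max (N + 1) K); split=> k.
- apply: BM_restrict => //.
    by have [+ _ _] := wd k 0 => /(_ W cW WO)[].
  move=> z /WP[_ /(disc_coord_le1 (ltW t1))[h1 h2]]; rewrite /component.
  by case: ifP => _; exact: le_trans K1.
- move=> i; apply: BM_restrict => //; last by move=> z _; exact: norm_clamp.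
  have [_ + _] := wd k i => /(_ W cW WO)[mD _].
  by apply: measurable_maxr => //; apply: measurable_minr.
Qed.

Lemma continuous_chart k z : O z -> {for z, continuous (chart k)}.
Proof.
move=> Oz; have cphi := chart_continuous Oz.1.
have cc : {for z, continuous (component phi k)}.
  rewrite /component; case: (k == 0).
    by apply: (continuous_comp cphi); exact: cvg_fst.
  by apply: (continuous_comp cphi); exact: cvg_snd.
have E : \forall w \near z, component phi k w = chart k w.
  have := open_nbhs_nbhs (conj (open_chart) Oz); apply: filterS => w Ow.
  by rewrite /chart patchE mem_set//; exact: chart_subset.
change (chart k w @[w --> z] --> chart k z).
rewrite -(nbhs_singleton E); apply: cvg_trans cc; apply: near_eq_cvg; exact: E.
Qed.

Lemma dchart_ae k i : {ae area, forall z, W z -> Dphi z k i = dchart k i z}.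
Proof.
apply: ae_imp chart_isometry => z H Wz; have [_ DK _] := H (WO Wz).
by rewrite /dchart patchE mem_set// clamp_id.
Qed.

(** A test function of O vanishes off W, so that phi may be cut off outside W,
    and Dphi changed on a null set. *)
Lemma wder_chart k i : wder O i (chart k) (dchart k i).
Proof.
move=> eta te; have [M [bc bd]] := BM_chart.
have OOm : O `<=` Omega by move=> z [].
have teOm : test_function Omega eta by case: te => se ce sO; split=> //; exact: subset_trans OOm.
have tD := test_function_partial i te.
have [L [mL Lb _]] := test_BM te; have [L' [mL' Lb' _]] := test_BM tD.
have off g z : test_function O g -> ~ W z -> g z = 0.
  by move=> tg nW; apply: (test_function_eq0 tg) => /chart_subset.
have [_ _ /(_ eta teOm) H] := wd k i.
apply: EFin_inj; rewrite EFinN.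
rewrite -(integral_supported (O := Omega) (BMMr (bc k) mL' Lb')); last first.
  by move=> z nO; rewrite (test_function_eq0 tD) ?mulr0// => -[].
rewrite -(integral_supported (O := Omega) (BMMr (bd k i) mL Lb)); last first.
  by move=> z nO; rewrite (test_function_eq0 te) ?mulr0// => -[].
have E1 : (fun z => (chart k z * 'D_(dir i) eta z)%:E) =
          (fun z => (component phi k z * 'D_(dir i) eta z)%:E).
  apply/funext => z; have [Wz|nW] := pselect (W z).
    by rewrite /chart patchE mem_set.
  by rewrite (off _ _ tD nW) !mulr0.
rewrite E1 H; congr (- _)%E.
have E2 : (fun z => (Dphi z k i * eta z)%:E) =
          (fun z => (((fun z => Dphi z k i) \_ W) z * eta z)%:E).
  apply/funext => z; have [Wz|nW] := pselect (W z).
    by rewrite patchE mem_set.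
  by rewrite (off _ _ te nW) !mulr0.
rewrite E2; apply: ae_eq_integral.
- exact: open_measurable2.
- apply/measurable_EFinP; apply: measurable_funTS; apply: measurable_funM => //.
  apply/(measurable_restrictT _ (compact_measurable2 cW)).
  by have [_ + _] := wd k i => /(_ W cW WO)[].
- apply/measurable_EFinP; apply: measurable_funTS; apply: measurable_funM => //.
  by case: (bd k i).
- apply: ae_imp (dchart_ae k i) => z Hz _; rewrite patchE /=.
  case: ifPn => [|nW]; first by rewrite inE => Wz; rewrite (Hz Wz).
  by rewrite /dchart patchE (negbTE nW).
Qed.

Lemma chart_inv z : O z -> C (chart 0 z, chart 1 z) -> S z.
Proof.
move=> Oz; rewrite /chart !patchE mem_set; last exact: chart_subset.
rewrite /component/= -surjective_pairing => Cz.
by apply/preimage_discP; [exact: lt_trans st t1|split=> //; case: Oz].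
Qed.

Lemma chart_jacobian : {ae area, forall z, S z ->
  dchart 0 0 z * dchart 1 1 z - dchart 0 1 z * dchart 1 0 z = 1}.
Proof.
apply: ae_imp chart_isometry => z H Sz; have Wz := chart_subset (SO Sz).
have [J DK _] := H (WO Wz).
by rewrite /dchart !patchE mem_set// !clamp_id.
Qed.

Variables (v : plane -> R) (r : R).
Hypotheses (bv : bump_like v) (rs : r < s) (vr : forall z, v z != 0 -> disc r z).

Let s1 : s < 1. Proof. exact: lt_trans st t1. Qed.

Let cS : compact S. Proof. exact: compact_preimage_disc. Qed.

Let clC : closed C.
Proof. by apply: compact_closed; [exact: norm_hausdorff|exact: compact_disc (ltW s1)]. Qed.

Let vC z : v z != 0 -> C z.
Proof. by move=> /vr dz; exact: le_trans dz (ltW rs). Qed.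

Let pullc := pull S (chart 0) (chart 1).

Lemma pull_sqr h : pullc (fun z => h z ^+ 2) = (fun z => pullc h z ^+ 2).
Proof.
apply/funext => z; rewrite /pullc /pull indicE; case: (z \in S).
  by rewrite !mul1r.
by rewrite !mul0r expr0n.
Qed.

Lemma continuous_pull h : continuous h -> (forall z, h z != 0 -> C z) ->
  continuous (pullc h).
Proof.
move=> ch hC z; change (pullc h w @[w --> z] --> pullc h z).
have [Oz|nO] := pselect (O z).
  have E : \forall w \near z, h (chart 0 w, chart 1 w) = pullc h w.
    have := open_nbhs_nbhs (conj open_chart Oz); apply: filterS => w Ow.
    by rewrite /pullc (pull_eq chart_inv).
  rewrite -(nbhs_singleton E); apply: cvg_trans (near_eq_cvg E) _.
  apply: (@continuous_comp _ _ _ (fun w => (chart 0 w, chart 1 w)) h); last exact: ch.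
  by apply: (cvg_pair (continuous_chart Oz) (continuous_chart Oz)).
have nS : (~` S) z by move=> Sz; apply: nO; exact: SO.
have oS : open (~` S).
  by apply: closed_openC; apply: compact_closed => //; exact: norm_hausdorff.
have E : \forall w \near z, 0 = pullc h w.
  have := open_nbhs_nbhs (conj oS nS); apply: filterS => w nw.
  by rewrite /pullc; have [[-> _]|[_ /nw]] := pull_cases S (chart 0) (chart 1) h w.
rewrite -(nbhs_singleton E); apply: cvg_trans (near_eq_cvg E) _; exact: cvg_cst.
Qed.

Lemma pull_sqr_gt0 : (exists z, v z != 0) -> 0 < iint (pullc (fun z => v z ^+ 2)).
Proof.
move=> [w vw]; have [M [bc _]] := BM_chart.
have [L bL] := BM_pull_bump cS (bc 0) (bc 1) bv.
rewrite pull_sqr; have [N bN] := BM_sqr bL.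
have cu : continuous (pullc v).
  by apply: continuous_pull => //; exact: smooth_continuous bv.1.
apply: (@iint_gt0 _ _ N (psi w) bN).
- by move=> z; apply: cvgM; exact: cu.
- by move=> z; exact: sqr_ge0.
rewrite lt_def sqr_ge0 andbT sqrf_eq0.
have Cw := vC vw.
have Opw : O (psi w).
  by apply: SO; exists w.
rewrite /pullc (pull_eq chart_inv)// /chart !patchE mem_set; last exact: chart_subset.
rewrite /component/= -surjective_pairing.
by have [_ _ [_ ->]] := homeo => //; exact: (disc_unit s1 Cw).
Qed.

Let G := pull_grad S (chart 0) (chart 1) (dchart 0) (dchart 1) v.

(** The quadratic form of A, as given by chart_isometry. *)
Let form (E0 E1 : plane -> R) z : R :=
  (E0 z * dchart 1 1 z + E1 z * - dchart 1 0 z) ^+ 2 +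
  (E1 z * dchart 0 0 z + E0 z * - dchart 0 1 z) ^+ 2.

Lemma form_cvg : L1cvg (fun n => form (moll n (G 0)) (moll n (G 1))) (form (G 0) (G 1)).
Proof.
have [M [bc bd]] := BM_chart.
have cG i : L1cvg (moll^~ (G i)) (G i).
  by have [N bN] := BM_pull_grad cS (bc 0) (bc 1) (bd 0) (bd 1) bv i; exact: moll_cvg bN.
have cGd i k j : L1cvg (fun n z => moll n (G i) z * dchart k j z) (fun z => G i z * dchart k j z).
  by have [md Md _] := bd k j; exact: L1cvgMr (cG i) md Md.
have cGd' i k j : L1cvg (fun n z => moll n (G i) z * - dchart k j z) (fun z => G i z * - dchart k j z).
  by have [md Md _] := BMN (bd k j); exact: L1cvgMr (cG i) md Md.
by apply: L1cvgD; apply: L1cvgM; apply: L1cvgD.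
Qed.

Lemma BM_pull_sqgrad : exists M, BM M (pullc (sqgrad v)).
Proof.
have [M [bc _]] := BM_chart.
have H i : exists N, BM N (fun z => pullc ('D_(dir i) v) z ^+ 2).
  have [N bN] := BM_pull_bump cS (bc 0) (bc 1) (bump_like_partial i bv).
  exact: BM_sqr bN.
have [N0 b0] := H 0; have [N1 b1] := H 1.
exists (N0 + N1); rewrite (_ : pullc (sqgrad v) =
  (fun z => pullc ('D_(dir 0) v) z ^+ 2 + pullc ('D_(dir 1) v) z ^+ 2)); first exact: BMD.
apply/funext => z; have E h : pullc h z ^+ 2 = pullc (fun z => h z ^+ 2) z by rewrite pull_sqr.
by rewrite !E /pullc /pull /sqgrad mulrDr.
Qed.

(** Since the Jacobian is 1, the form of A takes on the weak gradient of
    v o phi the value |grad v|^2 o phi. *)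
Lemma iint_form : iint (form (G 0) (G 1)) = iint (pullc (sqgrad v)).
Proof.
have [N [_ bN _]] := form_cvg; have [N' bN'] := BM_pull_sqgrad.
apply: (iint_ae bN bN'); apply: ae_imp chart_jacobian => z J.
rewrite /form /G /pull_grad /pullc /pull indicE; have [|] := boolP (z \in S).
  rewrite inE => /J {}J; rewrite /sqgrad !mul1r.
  move: J; move: (dchart 0 0 z) (dchart 0 1 z) (dchart 1 0 z) (dchart 1 1 z) => a b c d J.
  set x := ('D_(dir 0) v) _; set y := ('D_(dir 1) v) _.
  congr (_ ^+ 2 + _ ^+ 2).
    by rewrite -[RHS]mulr1 -J; ring.
  by rewrite -[RHS]mulr1 -J; ring.
by rewrite !mul0r !addr0 !mul0r !addr0 expr0n/= addr0.
Qed.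

Lemma energy_moll_le n : test_function O (moll n (pullc v)) ->
  (forall i, 'D_(dir i) (moll n (pullc v)) = moll n (G i)) ->
  (energy A Omega (grad (moll n (pullc v))) <= (iint (form (moll n (G 0)) (moll n (G 1))))%:E)%E.
Proof.
move=> te DE; have [N [bN _ _]] := form_cvg.
apply: (integral_le_iint (bN n)); first by move=> z; rewrite addr_ge0// sqr_ge0.
have dae : {ae area, forall z, forall k i, W z -> Dphi z k i = dchart k i z}.
  apply: ae_imp (ae_and (ae_and (dchart_ae 0 0) (dchart_ae 0 1))
    (ae_and (dchart_ae 1 0) (dchart_ae 1 1))) => z [[h1 h2] [h3 h4]].
  by move=> k i; have [->|->] := ord2_cases k; have [->|->] := ord2_cases i.
apply: ae_imp (ae_and chart_isometry dae) => z [H d] Omz.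
have gE i : grad (moll n (pullc v)) z i 0 = moll n (G i) z.
  by rewrite mxE; exact: (congr1 (fun g : plane -> R => g z) (DE i)).
have [_ _ ->] := H Omz; rewrite /form !gE.
have [Oz|nO] := pselect (O z).
  have Wz := chart_subset Oz; rewrite !d// le_eqVlt; apply/orP; left; apply/eqP.
  by congr (_ ^+ 2 + _ ^+ 2); ring.
have G0 i : moll n (G i) z = 0.
  rewrite -(congr1 (fun g : plane -> R => g z) (DE i)).
  exact: (test_function_eq0 (test_function_partial i te) nO).
by rewrite !G0 !mulr0 subr0 expr0n/= !mul0r !addr0 expr0n/= addr0.
Qed.

(** The mollifications of v o phi compete in the infimum, and their energies
    and norms converge. *)
Lemma lambda1_le_pull : (exists z, v z != 0) ->
  (lambda1 A Omega <= (iint (pullc (sqgrad v)) / iint (pullc (fun z => v z ^+ 2)))%:E)%E.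
Proof.
move=> /pull_sqr_gt0 a0; have [M [bc bd]] := BM_chart.
have [L bL] := BM_pull_bump cS (bc 0) (bc 1) bv.
have cu := moll_cvg bL.
have cu2 : iint (fun z => moll n (pullc v) z ^+ 2) @[n --> \oo] -->
    iint (pullc (fun z => v z ^+ 2)).
  by rewrite pull_sqr; apply: L1cvg_iint; exact: L1cvgM.
have cq : iint (form (moll n (G 0)) (moll n (G 1))) / iint (fun z => moll n (pullc v) z ^+ 2)
    @[n --> \oo] --> iint (pullc (sqgrad v)) / iint (pullc (fun z => v z ^+ 2)).
  apply: cvgM; last by apply: cvgV cu2; rewrite gt_eqF.
  by rewrite -iint_form; apply: L1cvg_iint; exact: form_cvg.
have near_le : \forall n \near \oo, (lambda1 A Omega <=
    (iint (form (moll n (G 0)) (moll n (G 1))) / iint (fun z => moll n (pullc v) z ^+ 2))%:E)%E.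
  have mt := moll_pull_test open_chart cS SO clC (bc 0) (bc 1) (bd 0) (bd 1)
    (@continuous_chart 0) (@continuous_chart 1) (wder_chart 0) (wder_chart 1) chart_inv bv vC.
  have pos : \forall n \near \oo, 0 < iint (fun z => moll n (pullc v) z ^+ 2).
    exact: (cvgr_gt _ cu2 _ a0).
  apply: filterS2 mt pos => n [te DE] pn.
  have teOm : test_function Omega (moll n (pullc v)).
    by case: te => se ce sO; split=> //; apply: (subset_trans sO) => z [].
  apply: (le_trans (lambda1_le_test A teOm pn)).
  rewrite inver gt_eqF// EFinM lee_wpmul2r//; last exact: energy_moll_le.
  by rewrite lee_fin invr_ge0 ltW.
rewrite leNgt; apply/negP => /lte_fin_between[l ql lL].
have [n [h1 h2]] := filter_ex (filterI near_le (cvgr_lt _ cq _ ql)).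
by have := le_trans lL h1; rewrite lee_fin leNgt h2.
Qed.

Lemma BM_sqgrad : exists M, BM M (sqgrad v).
Proof.
have H i : exists N, BM N (fun z => 'D_(dir i) v z ^+ 2).
  by have [N bN] := bump_like_BM (bump_like_partial i bv); exact: BM_sqr bN.
have [N0 b0] := H 0; have [N1 b1] := H 1.
by exists (N0 + N1); exact: BMD.
Qed.

(** pull_proportional, applied to v^2 and |grad v|^2, removes phi from the
    quotient. *)
Lemma lambda1_le_rayleigh : (exists z, v z != 0) ->
  (lambda1 A Omega <= (iint (sqgrad v) / iint (fun z => v z ^+ 2))%:E)%E.
Proof.
move=> v0; have a0 := pull_sqr_gt0 v0; have := lambda1_le_pull v0.
have [M [bc bd]] := BM_chart.
have [N bN] := bump_like_BM bv; have [N2 bN2] := BM_sqr bN; have [N' bN'] := BM_sqgrad.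
have cv := smooth_continuous bv.1.
have cD i : continuous ('D_(dir i) v).
  by apply: smooth_continuous; exact: (smooth_partial i bv.1).
have DvC i z : 'D_(dir i) v z != 0 -> disc r z.
  have cldisc : closed (disc r : set plane).
    apply: compact_closed; first exact: norm_hausdorff.
    exact: (compact_disc (ltW (lt_trans rs s1))).
  move=> /(partial_support bv.1); rewrite (closure_id (disc r)).1 //.
  by move: z; exact: closure_subset.
have P := pull_proportional open_chart cS SO clC (bc 0) (bc 1) (bd 0) (bd 1)
  (@continuous_chart 0) (@continuous_chart 1) (wder_chart 0) (wder_chart 1) chart_inv
  chart_jacobian rs (ltW s1) (@subset_refl _ C).
have {}P : iint (pullc (fun z => v z ^+ 2)) * iint (sqgrad v) =
           iint (pullc (sqgrad v)) * iint (fun z => v z ^+ 2).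
  apply: (P _ _ (Num.max N2 N')).
  - by apply: BMW bN2; rewrite le_max lexx.
  - by apply: BMW bN'; rewrite le_max lexx orbT.
  - by move=> z; apply: cvgM; exact: cv.
  - by move=> z; apply: cvgD; apply: cvgM; exact: cD.
  - by move=> z; exact: sqr_ge0.
  - by move=> z; rewrite addr_ge0// sqr_ge0.
  - by move=> z; rewrite sqrf_eq0; exact: vr.
  - move=> z; rewrite /sqgrad; have [->|+ _] := eqVneq ('D_(dir 0) v z) 0; last exact: DvC.
    have [->|+ _] := eqVneq ('D_(dir 1) v z) 0; last exact: DvC.
    by rewrite expr0n/= addr0 eqxx.
have b0 : 0 < iint (fun z => v z ^+ 2).
  have [w vw] := v0; apply: (@iint_gt0 _ _ N2 w bN2).
  - by move=> z; apply: cvgM; exact: cv.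
  - by move=> z; exact: sqr_ge0.
  - by rewrite lt_def sqr_ge0 andbT sqrf_eq0.
suff -> : iint (sqgrad v) / iint (fun z => v z ^+ 2) =
  iint (pullc (sqgrad v)) / iint (pullc (fun z => v z ^+ 2)) by [].
by apply/eqP; rewrite eqr_div ?(lt0r_neq0 a0) ?(lt0r_neq0 b0)// mulrC P.
Qed.

End Radii.

Lemma test_function_disc v : test_function (unit_disc R) v -> (exists z, v z != 0) ->
  exists2 r, r < 1 & forall z, v z != 0 -> disc r z.
Proof.
move=> [sv cs sD] [w vw].
have [||c cc H] := @compact_EVT_max _ R sqnorm _ _ cs.
- by exists w; exact: subset_closure.
- by apply: continuous_subspaceT; exact: continuous_sqnorm.
exists (sqnorm c); first by move: cc; rewrite inE => /sD.
by move=> z vz; apply: (H z); rewrite inE; exact: subset_closure.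
Qed.

Lemma lambda1_le_disc_test v : test_function (unit_disc R) v -> (exists z, v z != 0) ->
  (lambda1 A Omega <= (iint (sqgrad v) / iint (fun z => v z ^+ 2))%:E)%E.
Proof.
move=> tv v0; have [r r1 vr] := test_function_disc tv v0.
have rs : r < (r + 1) / 2 by lra.
have st : (r + 1) / 2 < ((r + 1) / 2 + 1) / 2 by lra.
have t1 : ((r + 1) / 2 + 1) / 2 < 1 by lra.
exact: (lambda1_le_rayleigh st t1 (test_function_bump_like tv) rs vr v0).
Qed.

End Chart.

(** * Passage from test functions to the Sobolev space *)

Section Comparison.
Context {R : realType}.
Local Notation plane := (R * R)%type.
Local Notation Rm := (measurableTypeR R).
Local Notation mplane := (Rm * Rm)%type.
Local Notation area := (@lebesgue_measure R \x @lebesgue_measure R)%E.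
Local Notation D := (unit_disc R).
Implicit Types (f g h v eta : plane -> R) (z w : plane) (n : nat) (i j : 'I_2).

Lemma measurable_unit_disc : measurable (D : set mplane).
Proof.
apply: open_measurable2; rewrite (_ : unit_disc R = sqnorm @^-1` [set x | x < 1])//.
by apply: open_comp; [move=> z _; exact: continuous_sqnorm|exact: open_lt].
Qed.

Lemma unit_disc_bigcup : D = \bigcup_n (disc (1 - n.+1%:R^-1) : set plane).
Proof.
apply/seteqP; split => [z Dz|z [n _ /= zn]]; last first.
  by apply: (le_lt_trans zn); rewrite ltrBlDr ltrDl invr_gt0 ltr0n.
have d0 : 0 < 1 - sqnorm z by rewrite subr_gt0.
have [n _ /(_ n (leqnn n)) /= Hn] := near_infty_natSinv_lt (PosNum d0).
by exists n => //; rewrite /disc /= lerBrDr addrC -lerBrDr ltW.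
Qed.

(** The disc is a countable union of compact discs. *)
Lemma Lloc_measurable p f : Lloc p D f -> measurable_fun (D : set mplane) f.
Proof.
move=> Lf; rewrite unit_disc_bigcup.
have r1 n : 1 - n.+1%:R^-1 < 1 :> R by rewrite ltrBlDr ltrDl invr_gt0 ltr0n.
apply/measurable_fun_bigcup => n; last first.
  have cn : compact (disc (1 - n.+1%:R^-1) : set plane) by exact: compact_disc (ltW (r1 n)).
  by have [] := Lf _ cn (fun z dz => le_lt_trans dz (r1 n)).
exact: compact_measurable2 (compact_disc (ltW (r1 n))).
Qed.

Definition sqint f : \bar R := (\int[area]_(z in D) (f z ^+ 2)%:E)%E.

Lemma sqint_ge0 f : (0 <= sqint f)%E.
Proof. by apply: integral_ge0 => z _; rewrite lee_fin sqr_ge0. Qed.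

Lemma sq_L2normE f : sq_L2norm D f = sqint f.
Proof. by apply: eq_integral => z _; rewrite real_normK// num_real. Qed.

Let msqr f : measurable_fun (D : set mplane) f ->
  measurable_fun (D : set mplane) (fun z => (f z ^+ 2)%:E).
Proof. by move=> mf; apply/measurable_EFinP; apply: measurable_funX. Qed.

Lemma energy_idE (G : plane -> 'cV[R]_2) :
  (forall i, measurable_fun (D : set mplane) (fun z => G z i 0)) ->
  energy (fun=> 1%:M) D G =
    (sqint (fun z => G z 0%R 0%R) + sqint (fun z => G z 1%R 0%R))%E.
Proof.
move=> mG; rewrite /sqint -ge0_integralD; first last.
- exact: msqr.
- by move=> z _; rewrite lee_fin sqr_ge0.
- exact: msqr.
- by move=> z _; rewrite lee_fin sqr_ge0.
- exact: measurable_unit_disc.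
apply: eq_integral => z _; rewrite mul1mx /dot !big_ord_recl big_ord0 addr0.
by rewrite -EFinD !expr2; congr (_ * _ + _ * _)%:E; congr (G z _ _); exact: val_inj.
Qed.

(** A triangle inequality for squared norms, from
    (x + y)^2 <= (1 + d) x^2 + (1 + 1/d) y^2. *)
Lemma sqint_split f g d : measurable_fun (D : set mplane) f ->
  measurable_fun (D : set mplane) g -> 0 < d ->
  (sqint f <= (1 + d)%:E * sqint g + (1 + d^-1)%:E * sqint (fun z => f z - g z)%R)%E.
Proof.
move=> mf mg d0; have mD := measurable_unit_disc.
have mfg : measurable_fun (D : set mplane) (fun z => f z - g z) by exact: measurable_funB.
have c1 : 0 <= 1 + d by rewrite addr_ge0// ltW.
have c2 : 0 <= 1 + d^-1 by rewrite addr_ge0// invr_ge0 ltW.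
have Z c h : 0 <= c -> measurable_fun (D : set mplane) h ->
    (c%:E * sqint h = \int[area]_(z in D) (c * h z ^+ 2)%:E)%E.
  move=> c0 mh; rewrite /sqint -ge0_integralZl_EFin//; last exact: msqr.
  by move=> z _; rewrite lee_fin sqr_ge0.
have M c h : measurable_fun (D : set mplane) h ->
    measurable_fun (D : set mplane) (fun z => (c * h z ^+ 2)%:E).
  by move=> mh; apply/measurable_EFinP; apply: measurable_funM => //; exact: measurable_funX.
have P c h z : 0 <= c -> (0 <= (c * h z ^+ 2 : R)%:E)%E.
  by move=> c0; rewrite lee_fin mulr_ge0// sqr_ge0.
rewrite Z// Z// -ge0_integralD//; [|by move=> z _; exact: P|exact: M
  |by move=> z _; apply: (P _ (fun z => f z - g z))|exact: M].
apply: ge0_le_integral => //.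
- by move=> z _; rewrite lee_fin sqr_ge0.
- exact: msqr.
- by apply: emeasurable_funD; exact: M.
move=> z _; rewrite -EFinD lee_fin -subr_ge0.
have -> : (1 + d) * g z ^+ 2 + (1 + d^-1) * (f z - g z) ^+ 2 - f z ^+ 2 =
          d^-1 * (d * g z - (f z - g z)) ^+ 2.
  by field; rewrite gt_eqF.
by rewrite mulr_ge0 ?sqr_ge0// invr_ge0 ltW.
Qed.

Lemma poweR_half_lt (x : \bar R) (e : R) : (0 <= x)%E -> 0 < e ->
  (x `^ 2^-1 < e%:E -> x <= (e ^+ 2)%:E)%E.
Proof.
case: x => [x| |]//; last by rewrite poweRyr ?invr_neq0// ltNge leey.
rewrite !lee_fin poweR_EFin lte_fin => x0 e0; rewrite powR12_sqrt// => xe.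
by rewrite -(sqr_sqrtr x0) lerXn2r ?nnegrE ?sqrtr_ge0// ltW.
Qed.

Lemma sqint_sym f g : sqint (fun z => f z - g z) = sqint (fun z => g z - f z).
Proof. by apply: eq_integral => z _; rewrite -[in RHS]sqrrN opprB. Qed.

Lemma fin_ge0 (x : \bar R) : (0 <= x)%E -> (x < +oo)%E -> exists2 r, 0 <= r & x = r%:E.
Proof. by case: x => [r| |]//; rewrite lee_fin => r0 _; exists r. Qed.

Lemma sqint_test eta : test_function D eta -> sqint eta = (iint (fun z => eta z ^+ 2))%:E.
Proof. by move=> te; rewrite -sq_L2normE (sq_L2norm_test te). Qed.

Lemma sqint_gt0 f : measurable_fun (D : set mplane) f ->
  ~ ae_on D (fun z => f z = 0) -> (0 < sqint f)%E.
Proof.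
move=> mf nf; rewrite lt_neqAle sqint_ge0 andbT eq_sym; apply/eqP => f0; apply: nf.
have : (\int[area]_(z in D) `|(f z ^+ 2)%:E| = 0)%E.
  rewrite -f0; apply: eq_integral => z _.
  by rewrite gee0_abs// lee_fin sqr_ge0.
move/(ae_eq_integral_abs area measurable_unit_disc (msqr mf)).
apply: ae_imp => z H Dz; have /= := H Dz.
by move=> [] /eqP; rewrite sqrf_eq0 => /eqP.
Qed.

(** Here a and E are the squared norm and the energy of a limit f of test
    functions, N and S those of a test function at distance d^2 from f, and l
    is a lower bound for S / N.  The errors (1 + 1/d) d^4 = d^4 + d^3 are at
    most 2 d, so l a exceeds E by a multiple of d at most. *)
Lemma gap_contradiction (l a E d N S : R) : 0 < d -> d <= 1 -> 0 <= E -> 0 <= l ->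
  d * (3 * E + 4 + 2 * l) < l * a - E ->
  a <= (1 + d) * N + (1 + d^-1) * d ^+ 2 ^+ 2 ->
  S <= (1 + d) * E + (1 + d^-1) * d ^+ 2 ^+ 2 ->
  l * N <= S -> False.
Proof.
move=> d0 d1 E0 l0 gap ha hS hN.
have X : (1 + d^-1) * d ^+ 2 ^+ 2 = d ^+ 4 + d ^+ 3 by field; rewrite gt_eqF.
rewrite X in ha hS.
have d3 : d ^+ 4 + d ^+ 3 <= 2 * d.
  have h2 : d ^+ 2 <= 1 by rewrite expr_le1// ltW.
  have h3 : d ^+ 3 <= 1 by rewrite expr_le1// ltW.
  have h4 : d ^+ 4 = d * d ^+ 3 by rewrite -exprS.
  have h5 : d ^+ 3 = d * d ^+ 2 by rewrite -exprS.
  by rewrite h4 h5; nra.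
set x := d ^+ 4 + d ^+ 3 in ha hS d3.
have h1 : l * a <= (1 + d) * (l * N) + l * x by nra.
have h2 : (1 + d) * (l * N) <= (1 + d) * S by rewrite ler_pM2l// addr_gt0.
have h3 : (1 + d) * S <= (1 + d) * ((1 + d) * E + x) by rewrite ler_pM2l// addr_gt0.
have h4 : (1 + d) * ((1 + d) * E + x) <= E + d * (3 * E + 4).
  have k1 : d * d <= d by rewrite ler_piMr// ltW.
  have k2 : d * d * E <= d * E by rewrite ler_wpM2r.
  have k3 : (1 + d) * x <= (1 + d) * (2 * d) by rewrite ler_pM2l// addr_gt0.
  have -> : (1 + d) * ((1 + d) * E + x) = E + 2 * (d * E) + d * d * E + (1 + d) * x by ring.
  by lra.
have h5 : l * x <= l * (2 * d) by rewrite ler_wpM2l.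
lra.
Qed.

(** If L exceeded the Rayleigh quotient of f, a close enough test function
    would violate the bound too. *)
Lemma lambda1_unit_disc_ge (L : \bar R) :
  (forall v, test_function D v -> (exists z, v z != 0) ->
     (L <= (iint (sqgrad v) / iint (fun z => v z ^+ 2))%:E)%E) ->
  (L <= lambda1 (fun=> 1%:M) D)%E.
Proof.
move=> HL; apply: le_ereal_inf_tmp => _ [f [G [[mf f_fin wG approx] nf ->]]].
have mG i : measurable_fun (D : set mplane) (fun z => G z i 0).
  by have [_ + _] := wG i; exact: Lloc_measurable.
have {}mf : measurable_fun (D : set mplane) f by exact: mf.
have a_gt0 := sqint_gt0 mf nf.
rewrite sq_L2normE in f_fin *.
have [a a0 aE] := fin_ge0 (sqint_ge0 f) f_fin.
rewrite aE lte_fin in a_gt0; rewrite aE inver gt_eqF//.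
rewrite (energy_idE mG); have g_ge0 i := sqint_ge0 (fun z => G z i 0).
have [->|] := eqVneq (sqint (fun z => G z 0%R 0%R) + sqint (fun z => G z 1%R 0%R))%E +oo%E.
  by rewrite gt0_mulye ?leey// lte_fin invr_gt0.
rewrite -ltey => e_fin.
have [g0 g00 g0E] : exists2 r, 0 <= r & sqint (fun z => G z 0%R 0%R) = r%:E.
  by apply: fin_ge0 => //; apply: le_lt_trans e_fin; rewrite leeDl.
have [g1 g10 g1E] : exists2 r, 0 <= r & sqint (fun z => G z 1%R 0%R) = r%:E.
  by apply: fin_ge0 => //; apply: le_lt_trans e_fin; rewrite leeDr.
rewrite g0E g1E -EFinD -EFinM leNgt; apply/negP => /lte_fin_between[l Hl lL].
have E0 : 0 <= g0 + g1 by rewrite addr_ge0.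
have l0 : 0 <= l by rewrite (le_trans _ (ltW Hl))// divr_ge0.
rewrite ltr_pdivrMr// -subr_gt0 in Hl.
set gap := l * a - (g0 + g1) in Hl; set c := 3 * (g0 + g1) + 4 + 2 * l.
have c0 : 0 < c by rewrite /c; lra.
(* this choice gives both d <= 1 and d * c < gap *)
pose d := gap / (gap + c).
have gc : 0 < gap + c by rewrite addr_gt0.
have d0 : 0 < d by rewrite divr_gt0.
have d1 : d <= 1 by rewrite ler_pdivrMr// mul1r lerDl ltW.
have dgap : d * c < gap.
  by rewrite /d mulrAC ltr_pdivrMr// ltr_pM2l// ltrDr.
(* the distance d^2 makes the errors small even when multiplied by 1/d *)
have [eta te] := approx (d ^+ 2) (exprn_gt0 2 d0).
rewrite /W12_norm => approx_d.
have tD i := test_function_partial i te.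
have mE g : test_function D g -> measurable_fun (D : set mplane) g.
  by move=> /test_BM[M [mg _ _]]; exact: measurable_funTS.
have en : energy (fun=> 1%:M) D (fun z => G z - grad eta z) =
    (sqint (fun z => G z 0%R 0%R - 'D_(dir 0) eta z)%R +
     sqint (fun z => G z 1%R 0%R - 'D_(dir 1) eta z)%R)%E.
  have E i : (fun z => (G z - grad eta z) i 0) = (fun z => G z i 0 - 'D_(dir i) eta z).
    by apply/funext => z; rewrite !mxE.
  rewrite energy_idE ?E// => i; rewrite E.
  by apply: measurable_funB => //; exact: mE.
have h1 : (sqint (fun z => f z - eta z)%R <= (d ^+ 2 ^+ 2)%:E)%E.
  apply: poweR_half_lt; [exact: sqint_ge0|exact: exprn_gt0|].
  by apply: le_lt_trans approx_d; rewrite -sq_L2normE leeDl// poweR_ge0.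
have h2 : (sqint (fun z => G z 0%R 0%R - 'D_(dir 0) eta z)%R +
     sqint (fun z => G z 1%R 0%R - 'D_(dir 1) eta z)%R <= (d ^+ 2 ^+ 2)%:E)%E.
  apply: poweR_half_lt; [by rewrite adde_ge0// sqint_ge0|exact: exprn_gt0|].
  by apply: le_lt_trans approx_d; rewrite -en leeDr// poweR_ge0.
have fin (x y : \bar R) (z : R) : (0 <= x)%E -> (0 <= y)%E -> (x + y <= z%:E)%E ->
    exists u v : R, [/\ x = u%:E, y = v%:E & u + v <= z].
  move=> x0 y0 xyz.
  have [u _ uE] : exists2 r, 0 <= r & x = r%:E.
    by apply: fin_ge0 => //; rewrite (@le_lt_trans _ _ z%:E) ?ltry// (le_trans _ xyz)// leeDl.
  have [v _ vE] : exists2 r, 0 <= r & y = r%:E.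
    by apply: fin_ge0 => //; rewrite (@le_lt_trans _ _ z%:E) ?ltry// (le_trans _ xyz)// leeDr.
  by exists u, v; split=> //; rewrite -lee_fin EFinD -uE -vE.
have [x0 x00 x0E] : exists2 r, 0 <= r & sqint (fun z => f z - eta z)%R = r%:E.
  by apply: fin_ge0 (sqint_ge0 _) (le_lt_trans h1 (ltry _)).
have [y0 [y1 [y0E y1E y01]]] := fin _ _ _ (sqint_ge0 _) (sqint_ge0 _) h2.
have hf := sqint_split mf (mE _ te) d0.
rewrite aE (sqint_test te) x0E -!EFinM -EFinD lee_fin in hf.
have h0 := sqint_split (mE _ (tD 0)) (mG 0) d0.
rewrite (sqint_test (tD 0)) g0E sqint_sym y0E -!EFinM -EFinD lee_fin in h0.
have h3 := sqint_split (mE _ (tD 1)) (mG 1) d0.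
rewrite (sqint_test (tD 1)) g1E sqint_sym y1E -!EFinM -EFinD lee_fin in h3.
rewrite x0E lee_fin in h1.
have [M0 b0] := test_BM (tD 0); have [N0 {}b0] := BM_sqr b0.
have [M1 b1] := test_BM (tD 1); have [N1 {}b1] := BM_sqr b1.
have di : 0 <= 1 + d^-1 by rewrite addr_ge0// invr_ge0 ltW.
have lN : l * iint (fun z => eta z ^+ 2) <= iint (sqgrad eta).
  have [z0|z0] := pselect (exists z, eta z != 0); last first.
    have -> : (fun z => eta z ^+ 2) = (fun=> 0).
      apply/funext => z; suff -> : eta z = 0 by rewrite expr0n.
      by apply/eqP/negPn/negP => ez; apply: z0; exists z.
    by rewrite iint0 mulr0 iint_ge0// => z; rewrite addr_ge0// sqr_ge0.
  have := le_trans lL (HL _ te z0); rewrite lee_fin ler_pdivlMr//.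
  have [M bM] := test_BM te; have [N bN] := BM_sqr bM; have [w ew] := z0.
  apply: (@iint_gt0 _ _ N w bN).
  - have ce := smooth_continuous (test_function_bump_like te).1.
    by move=> z; apply: cvgM; exact: ce.
  - by move=> z; exact: sqr_ge0.
  - by rewrite lt_def sqr_ge0 andbT sqrf_eq0.
apply: (gap_contradiction d0 d1 E0 l0 dgap _ _ lN).
  by apply: (le_trans hf); rewrite lerD2l ler_wpM2l.
rewrite /sqgrad (iintD b0 b1); apply: (le_trans (lerD h0 h3)).
rewrite addrACA -!mulrDr lerD2l ler_wpM2l//.
Qed.

Lemma lambda1_unit_disc_ge0 : (0 <= lambda1 (fun=> 1%:M) D)%E.
Proof.
apply: le_ereal_inf_tmp => _ [f [G [_ _ ->]]].
have h1 : (0 <= energy (fun=> 1%:M) D G)%E.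
  apply: integral_ge0 => z _; rewrite lee_fin mul1mx.
  by apply: sumr_ge0 => i _; rewrite -expr2 sqr_ge0.
rewrite mule_ge0// inve_ge0.
by apply: integral_ge0 => z _; rewrite lee_fin sqr_ge0.
Qed.

End Comparison.

Theorem corollary3p3 (R : realType) (K : R) (Omega : set (R * R))
    (A : R * R -> 'M[R]_2) (beta : R)
    (hK : 1 <= K) (hOmega : simply_connected_domain Omega)
    (hA : M22 K Omega A) (hbeta : 1 < beta)
    (hreg : volume_preserving_A_qc_regular A beta Omega) :
  (lambda1 A Omega <= K%:E * lambda1 (fun=> 1%:M) (unit_disc R))%E.
Proof.
have [phi [psi [Dphi [[[homeo [wd _ _] _] bel] _ vol]]]] := hreg.
have [oOmega _ _ _] := hOmega.
apply: (@le_trans _ _ (lambda1 (fun=> 1%:M) (unit_disc R))); last first.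
  by apply: lee_pemull; rewrite ?lee_fin//; exact: lambda1_unit_disc_ge0.
apply: lambda1_unit_disc_ge => v.
exact: (lambda1_le_disc_test hK oOmega hA homeo wd bel vol).
Qed.
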